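(* Let $\rho: X=\mathbb{C}^N\twoheadrightarrow Z=\mathbb{C}^{N-1}$ be a surjective linear map of codimension one and $\mathcal{M}$ an algebraic regular holonomic $\mathcal{D}$-module on $X=\mathbb{C}^N$. Let $Y=\mathbb{C}^N$ be the dual of $X$, let $L\simeq\mathbb{C}^{N-1}$ be the dual of $Z$, and let $\iota: L\hookrightarrow Y$ be the injective linear map induced by $\rho$ (its transpose). Then for any point $a\in Y\setminus\iota(L)$ the direct image $$\mathbf{D}\rho_*\bigl(\mathcal{M}\overset{D}{\otimes}\mathcal{O}_Xe^{-\langle z,a\rangle}\bigr)\in\mathbf{D}^{\mathrm{b}}_{\mathrm{hol}}(\mathcal{D}_Z)$$ is concentrated in degree $0$.
   Context: $X=\mathbb{C}^N_z$ is a complex vector space and $Y=\mathbb{C}^N_w$ its dual, with canonical pairing $\langle\cdot,\cdot\rangle:X\times Y\to\mathbb{C}$; all spaces are regarded as algebraic varieties and $\mathcal{D}_X$, etc. denote the sheaves of algebraic differential operators. Regularity of algebraic holonomic modules is in the usual algebraic sense (including regularity at infinity). $\mathcal{O}_Xe^{-\langle z,a\rangle}$ is the algebraic integrable connection of rank one on $X$ generated by $e^{-\langle z,a\rangle}$, i.e. $\mathcal{O}_X$ with $\partial_{z_i}$ acting as $\partial_{z_i}-a_i$. $\overset{D}{\otimes}$ is the (derived) tensor product over $\mathcal{O}_X$ of $\mathcal{D}_X$-modules, and $\mathbf{D}\rho_*(\cdot)=\mathrm{R}\rho_*(\mathcal{D}_{Z\leftarrow X}\otimes^{\mathrm{L}}_{\mathcal{D}_X}\cdot)$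 is the derived direct image of algebraic $\mathcal{D}$-modules. $\mathbf{D}^{\mathrm{b}}_{\mathrm{hol}}(\mathcal{D}_Z)$ is the bounded derived category of $\mathcal{D}_Z$-modules with holonomic cohomologies; ''concentrated in degree $0$'' means that the $j$-th cohomology vanishes for all $j\neq0$. *)

(* Defs.v *)
From HB Require Import structures.
From mathcomp Require Import all_boot all_order all_algebra.
From mathcomp Require Import reals complex.
From mathcomp.multinomials Require Import mpoly.
Set Implicit Arguments.
Unset Strict Implicit.
Unset Printing Implicit Defensive.
Import GRing.Theory.
Local Open Scope ring_scope.

(** * Algebraic D-modules on affine space

    Affine n-space is D-affine: taking global sections identifies
    quasi-coherent modules over the sheaf of algebraic differential operators
    with left modules over the Weyl algebra
      C<x_1..x_n, d_1..d_n> / ([x_i,x_j], [d_i,d_j], [d_i,x_j] = delta_ij),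
    i.e. with vector spaces carrying operators subject to these relations. *)

Record dmodule (C : fieldType) (n : nat) := DModule {
  dcarrier :> lmodType C;
  dX : 'I_n -> {linear dcarrier -> dcarrier};
  dD : 'I_n -> {linear dcarrier -> dcarrier};
  dXX : forall i j m, dX i (dX j m) = dX j (dX i m);
  dDD : forall i j m, dD i (dD j m) = dD j (dD i m);
  dDX : forall i j m, dD i (dX j m) = dX j (dD i m) + (i == j)%:R *: m }.

Arguments dX {C n} d i.
Arguments dD {C n} d i.

(* [inl i] stands for x_i and [inr i] for d_i. *)
Definition dop (C : fieldType) (n : nat) (M : dmodule C n)
  (s : 'I_n + 'I_n) : M -> M :=
  match s with inl i => dX M i | inr i => dD M i end.

Definition is_dhom (C : fieldType) (n : nat) (M N : dmodule C n)
  (f : {linear M -> N}) : Prop :=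
  forall s m, f (dop s m) = dop s (f m).

(** ** Holonomicity *)

Definition dword (C : fieldType) (n : nat) (M : dmodule C n)
  (w : seq ('I_n + 'I_n)) (m : M) : M := foldr (@dop C n M) m w.

(* The k-th step of the filtration of M that the Bernstein filtration of the
   Weyl algebra (by total degree in the x_i and the d_i) induces from v. *)
Definition bernstein_filt (C : fieldType) (n : nat) (M : dmodule C n)
  (r : nat) (v : 'I_r -> M) (k : nat) (m : M) : Prop :=
  exists s : seq (C * seq ('I_n + 'I_n) * 'I_r),
    all (fun u => size u.1.2 <= k)%N s /\
    m = \sum_(u <- s) u.1.1 *: dword u.1.2 (v u.2).

Definition has_dim (C : fieldType) (V : lmodType C) (S : V -> Prop)
  (d : nat) : Prop :=
  exists b : 'I_d -> V,
    [/\ forall i, S (b i),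
        forall c : 'I_d -> C, \sum_i c i *: b i = 0 -> forall i, c i = 0
      & forall m, S m -> exists c : 'I_d -> C, m = \sum_i c i *: b i].

(* Finitely generated, with Hilbert polynomial of degree at most n; by
   Bernstein's inequality the degree is then n, unless M = 0. *)
Definition holonomic (C : fieldType) (n : nat) (M : dmodule C n) : Prop :=
  exists (r : nat) (v : 'I_r -> M),
    (forall m, exists k, bernstein_filt v k m) /\
    exists (p : {poly rat}) (k0 : nat), (size p <= n.+1)%N /\
      forall k, (k0 <= k)%N ->
        exists d, has_dim (bernstein_filt v k) d /\ d%:R = p.[k%:R].

(** ** Tensor products and free resolutions *)

(* Biadditive maps on U x V that are balanced over the ring generated by C
   and by elements indexed by I, acting by f on U and by g on V. *)
Definition balanced (C : fieldType) (U V : lmodType C) (W : zmodType)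
  (I : Type) (f : I -> U -> U) (g : I -> V -> V) (b : U -> V -> W) : Prop :=
  [/\ forall u u' v, b (u + u') v = b u v + b u' v,
      forall u v v', b u (v + v') = b u v + b u v',
      forall (c : C) u v, b (c *: u) v = b u (c *: v)
    & forall i u v, b (f i u) v = b u (g i v)].

Definition is_tensor (C : fieldType) (U V : lmodType C) (T : zmodType)
  (I : Type) (f : I -> U -> U) (g : I -> V -> V) (t : U -> V -> T) : Prop :=
  balanced f g t /\
  forall (W : zmodType) (b : U -> V -> W), balanced f g b ->
    exists h : {additive T -> W},
      (forall u v, h (t u v) = b u v) /\
      forall h' : {additive T -> W},
        (forall u v, h' (t u v) = b u v) -> h' =1 h.

Definition is_free (C : fieldType) (n : nat) (P : dmodule C n) : Prop :=
  exists (I : Type) (e : I -> P), forall (N : dmodule C n) (v : I -> N),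
    exists h : {linear P -> N},
      [/\ is_dhom h, forall i, h (e i) = v i
        & forall h' : {linear P -> N},
            is_dhom h' -> (forall i, h' (e i) = v i) -> h' =1 h].

Record free_resolution (C : fieldType) (n : nat) (M : dmodule C n) :=
  FreeResolution {
  res :> nat -> dmodule C n;
  res_d : forall k, {linear res k.+1 -> res k};
  res_aug : {linear res 0%N -> M};
  res_free : forall k, is_free (res k);
  res_dhom : forall k, is_dhom (res_d k);
  res_aughom : is_dhom res_aug;
  res_aug_surj : forall m, exists p, res_aug p = m;
  res_exact0 : forall p, res_aug p = 0 <-> exists p', p = res_d 0 p';
  res_exact : forall k p,
    res_d k p = 0 <-> exists p', p = res_d k.+1 p' }.

Definition is_cycle (R : nzRingType) (T : nat -> lmodType R)
  (delta : forall k, {linear T k.+1 -> T k}) (k : nat) : T k -> Prop :=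
  match k with 0%N => fun _ => True | k'.+1 => fun c => delta k' c = 0 end.

(* H is the k-th homology module of T, with quotient map q (whose values are
   only meaningful on cycles). *)
Definition is_homology (R : nzRingType) (T : nat -> lmodType R)
  (delta : forall k, {linear T k.+1 -> T k}) (k : nat)
  (H : lmodType R) (q : T k -> H) : Prop :=
  [/\ forall (h : R) c c', is_cycle delta c -> is_cycle delta c' ->
        q (h *: c + c') = h *: q c + q c',
      forall h, exists2 c, is_cycle delta c & q c = h
    & forall c, is_cycle delta c ->
        (q c = 0 <-> exists c', c = delta k c')].

(** ** Regularity *)

(* A function field of one variable over C, i.e. the field of rational
   functions of an irreducible curve, with a separating transcendental
   element t and the derivation d/dt. *)
Record curve (C : fieldType) := Curve {
  cfun :> comUnitAlgType C;
  cfun_field : GRing.field_axiom cfun;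
  ct : cfun;
  ct_transc : forall p : {poly C}, horner_alg ct p = 0 -> p = 0;
  cfun_finite : exists (r : nat) (e : 'I_r -> cfun), forall h,
    exists (q : {poly C}) (p : 'I_r -> {poly C}),
      q != 0 /\ horner_alg ct q * h = \sum_i horner_alg ct (p i) * e i;
  cder : {linear cfun -> cfun};
  cder_leibniz : forall g h, cder (g * h) = cder g * h + g * cder h;
  cder_t : cder ct = 1 }.

(* The valuation rings of cfun/C: the local rings of the points of the smooth
   complete model of the curve. *)
Definition is_place (C : fieldType) (K : curve C) (V : K -> Prop) : Prop :=
  [/\ forall c : C, V c%:A,
      forall g h, V g -> V h -> V (g - h) /\ V (g * h),
      forall h, h != 0 -> V h \/ V h^-1
    & exists h, ~ V h].

Definition is_uniformizer (C : fieldType) (K : curve C) (V : K -> Prop)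
  (s : K) : Prop :=
  [/\ V s, s != 0, ~ V s^-1 & forall h, V h -> ~ V h^-1 -> V (h / s)].

(* A connection E over the function field is regular at V if E is spanned by a
   finitely generated V-submodule (generated by e) that is stable under the
   logarithmic derivation s d/ds = (s / (ds/dt)) d/dt. *)
Definition regular_at (C : fieldType) (K : curve C) (V : K -> Prop)
  (E : lmodType K) (nabla : E -> E) : Prop :=
  exists s : K, is_uniformizer V s /\
  exists (r : nat) (e : 'I_r -> E),
    (forall x, exists c : 'I_r -> K, x = \sum_i c i *: e i) /\
    forall i, exists c : 'I_r -> K,
      (forall j, V (c j)) /\
      (s / cder K s) *: nabla (e i) = \sum_j c j *: e j.

(* (E, nabla) is the cohomology in degree -k of the derived inverse image of M
   along phi : Spec K -> C^n, the restriction to its generic point of a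
   morphism from a curve. It is computed from a resolution by free D-modules
   (which are free over the polynomial ring), tensored over C[x_1..x_n] with
   K, where x_i acts as phi i. *)
Definition is_inverse_image (C : fieldType) (n : nat) (K : curve C)
  (phi : 'I_n -> K) (M : dmodule C n) (k : nat)
  (E : lmodType K) (nabla : E -> E) : Prop :=
  exists (P : free_resolution M)
         (T : nat -> lmodType K) (t : forall l, K -> P l -> T l)
         (delta : forall l, {linear T l.+1 -> T l})
         (nablaT : forall l, {additive T l -> T l}),
    (forall l, [/\
        is_tensor (fun i h => phi i * h) (dX (P l)) (t l),
        forall g h p, g *: t l h p = t l (g * h) p,
        forall h p, delta l (t l.+1 h p) = t l h (res_d P l p)
      & forall h p, nablaT l (t l h p) =
          t l (cder K h) p
          + \sum_i t l (h * cder K (phi i)) (dD (P l) i p)]) /\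
    exists q : T k -> E,
      is_homology delta q /\
      forall c, is_cycle delta c -> q (nablaT k c) = nabla (q c).

(* The curve criterion: for every morphism phi from a smooth curve to C^n, the
   cohomologies of the inverse image of M along phi are, generically on the
   curve, connections that are regular at every point of the smooth completion
   of the curve. The images of these points include points at infinity of C^n.
   Cohomologies are unique up to isomorphism. *)
Definition regular (C : fieldType) (n : nat) (M : dmodule C n) : Prop :=
  forall (K : curve C) (phi : 'I_n -> K) (k : nat),
    exists (E : lmodType K) (nabla : E -> E),
      is_inverse_image phi M k nabla /\
      forall V, is_place V -> regular_at V nabla.

Definition regular_holonomic (C : fieldType) (n : nat) (M : dmodule C n) :=
  holonomic M /\ regular M.

(** ** The exponential twist *)

(* The operators of O e^{-<z,a>}, writing p for the section p e^{-<z,a>}. *)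
Definition Oexp_X (C : fieldType) (n : nat) (i : 'I_n) (p : {mpoly C[n]}) :
  {mpoly C[n]} := 'X_i * p.
Definition Oexp_D (C : fieldType) (n : nat) (a : 'cV[C]_n) (i : 'I_n)
  (p : {mpoly C[n]}) : {mpoly C[n]} := mderiv i p - a i 0 *: p.

Fact Oexp_X_linear (C : fieldType) (n : nat) (i : 'I_n) :
  linear (@Oexp_X C n i).
Proof. by move=> c p q; rewrite /Oexp_X mulrDr scalerAr. Qed.
HB.instance Definition _ (C : fieldType) (n : nat) (i : 'I_n) :=
  GRing.isLinear.Build C {mpoly C[n]} {mpoly C[n]} _ (@Oexp_X C n i)
    (@Oexp_X_linear C n i).

Fact Oexp_D_linear (C : fieldType) (n : nat) (a : 'cV[C]_n) (i : 'I_n) :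
  linear (Oexp_D a i).
Proof.
move=> c p q; rewrite /Oexp_D mderivD mderivZ scalerDr scalerBr.
by rewrite !scalerA (mulrC c) opprD addrACA.
Qed.
HB.instance Definition _ (C : fieldType) (n : nat) (a : 'cV[C]_n) (i : 'I_n) :=
  GRing.isLinear.Build C {mpoly C[n]} {mpoly C[n]} _ (Oexp_D a i)
    (@Oexp_D_linear C n a i).

Fact mderivXM (C : fieldType) (n : nat) (i j : 'I_n) (p : {mpoly C[n]}) :
  mderiv i ('X_j * p) = 'X_j * mderiv i p + (i == j)%:R *: p.
Proof.
rewrite mderivM mderivX mnm1E eq_sym addrC; congr (_ + _).
case: eqP => [->|_]; last by rewrite !scale0r mul0r.
rewrite !scale1r (_ : (U_(j) - U_(j))%MM = 0%MM) ?mpolyX0 ?mul1r //.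
by apply/mnmP => k; rewrite mnmBE subnn mnm0E.
Qed.

Fact Oexp_XX (C : fieldType) (n : nat) (i j : 'I_n) (p : {mpoly C[n]}) :
  Oexp_X i (Oexp_X j p) = Oexp_X j (Oexp_X i p).
Proof. exact: mulrCA. Qed.

Fact Oexp_DD (C : fieldType) (n : nat) (a : 'cV[C]_n) (i j : 'I_n)
  (p : {mpoly C[n]}) : Oexp_D a i (Oexp_D a j p) = Oexp_D a j (Oexp_D a i p).
Proof.
rewrite /Oexp_D !mderivB !mderivZ !scalerBr !scalerA (mulrC (a j 0)).
rewrite (mderiv_comm i j) !opprB addrACA [RHS]addrACA.
by congr (_ + _); rewrite addrC.
Qed.

Fact Oexp_DX (C : fieldType) (n : nat) (a : 'cV[C]_n) (i j : 'I_n)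
  (p : {mpoly C[n]}) :
  Oexp_D a i (Oexp_X j p) = Oexp_X j (Oexp_D a i p) + (i == j)%:R *: p.
Proof. by rewrite /Oexp_D /Oexp_X mderivXM mulrBr scalerAr addrAC. Qed.

Definition Oexp (C : fieldType) (n : nat) (a : 'cV[C]_n) : dmodule C n :=
  @DModule C n {mpoly C[n]} (fun i => @Oexp_X C n i) (fun i => Oexp_D a i)
    (@Oexp_XX C n) (@Oexp_DD C n a) (@Oexp_DX C n a).

(* T is the tensor product of M and E over the polynomial ring O, on which the
   d_i act by the Leibniz rule. When E is free over O, as is [Oexp a], it is
   also the derived tensor product. *)
Definition is_Otensor (C : fieldType) (n : nat) (M E T : dmodule C n)
  (t : M -> E -> T) : Prop :=
  [/\ is_tensor (dX M) (dX E) t,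
      forall (c : C) m e, c *: t m e = t (c *: m) e,
      forall i m e, dX T i (t m e) = t (dX M i m) e
    & forall i m e, dD T i (t m e) = t (dD M i m) e + t m (dD E i e)].

(** ** Direct image along a linear map *)

(* For the linear map z |-> rho *m z from X = C^N to Z = C^n,
   D_{X->Z} = O_X (x) D_Z (over O_Z) is free over O_X on the monomials in the
   derivations of Z. We identify it with the polynomials in variables x_i
   (the 'X_(lshift n i), coordinates on X) and eta_j (the 'X_(rshift N j),
   standing for the derivations d_j of Z), the coefficients in x being written
   to the left of the eta_j. *)
Definition transfer (C : fieldType) (N n : nat) := {mpoly C[N + n]}.

(* Left action of D_X. *)
Definition tr_X (C : fieldType) (N n : nat) (i : 'I_N)
  (b : transfer C N n) : transfer C N n := 'X_(lshift n i) * b.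
Definition tr_D (C : fieldType) (N n : nat) (rho : 'M[C]_(n, N)) (i : 'I_N)
  (b : transfer C N n) : transfer C N n :=
  mderiv (lshift n i) b + (\sum_j rho j i *: 'X_(rshift N j)) * b.

(* Right action of D_Z: eta^alpha z_j = z_j eta^alpha + alpha_j eta^(alpha-e_j),
   where z_j acts on O_X as the j-th component of rho. *)
Definition tr_rX (C : fieldType) (N n : nat) (rho : 'M[C]_(n, N)) (j : 'I_n)
  (b : transfer C N n) : transfer C N n :=
  (\sum_i rho j i *: 'X_(lshift n i)) * b + mderiv (rshift N j) b.
Definition tr_rD (C : fieldType) (N n : nat) (j : 'I_n)
  (b : transfer C N n) : transfer C N n := 'X_(rshift N j) * b.

(* D_{Z<-X} = Omega_X (x) D_{X->Z} (x) Omega_Z^{-1} (over O_X and O_Z): both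
   canonical sheaves are trivialised by the coordinates, and left and right
   actions are exchanged by the formal adjoint x_i |-> x_i, d_i |-> - d_i. *)
Definition transfer_right (C : fieldType) (N n : nat) (rho : 'M[C]_(n, N))
  (s : 'I_N + 'I_N) (b : transfer C N n) : transfer C N n :=
  match s with inl i => tr_X i b | inr i => - tr_D rho i b end.
Definition transfer_left (C : fieldType) (N n : nat) (rho : 'M[C]_(n, N))
  (s : 'I_n + 'I_n) (b : transfer C N n) : transfer C N n :=
  match s with inl j => tr_rX rho j b | inr j => - tr_rD j b end.

(* H is the cohomology in degree -k of the direct image of M. As rho is affine,
   this is the k-th left derived functor of D_{Z<-X} (x) _ (over D_X); in
   particular there is no cohomology in positive degrees. *)
Definition is_direct_image (C : fieldType) (N n : nat) (rho : 'M[C]_(n, N))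
  (M : dmodule C N) (k : nat) (H : dmodule C n) : Prop :=
  exists (P : free_resolution M)
         (T : nat -> dmodule C n)
         (t : forall l, transfer C N n -> P l -> T l)
         (delta : forall l, {linear T l.+1 -> T l}),
    (forall l, [/\
        is_tensor (transfer_right rho) (@dop C N (P l)) (t l),
        forall (c : C) b p, c *: t l b p = t l (c *: b) p,
        forall s b p, dop s (t l b p) = t l (transfer_left rho s b) p
      & forall b p, delta l (t l.+1 b p) = t l b (res_d P l p)]) /\
    exists q : T k -> H,
      @is_homology C (fun l => dcarrier (T l)) delta k H q /\
      forall s c, @is_cycle C (fun l => dcarrier (T l)) delta k c ->
        q (dop s c) = dop s (q c).

(* Main.v *)
From HB Require Import structures.
Require Import Defs.
From mathcomp Require Import ring lra zify ssrAC.
From mathcomp Require Import all_boot all_order all_algebra.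
From mathcomp Require Import reals complex boolp.
From mathcomp.multinomials Require Import ssrcomplements mpoly.
Set Implicit Arguments.
Unset Strict Implicit.
Unset Printing Implicit Defensive.
Import Order.TTheory GRing.Theory Num.Theory.
Local Open Scope ring_scope.

(** Choose coordinates in which rho forgets the first one. Then the direct image
    of a D-module N along rho is the de Rham complex of N along the fibres, with
    the derivation D_0 along the first coordinate: its cohomologies in degrees 0
    and -1 are the cokernel and the kernel of D_0 on N, and the others vanish.
    Multiplication by the exponential identifies M with the twist of M by
    O e^{-<z,a>} and turns D_0 into D_0 - c, where c is the value of a on the
    kernel of rho. It is nonzero, because a does not come from L. So two facts
    have to be shown: D_0 - c is injective on M, and its cokernel is holonomic.

    Injectivity ([no_exponential_section]) is where regularity enters. A section
    m of M with D_0 m = c m grows like an exponential along the lines parallel to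
    the first axis, which a regular module does not allow. To reach a
    contradiction with the curve criterion, m has to be restricted to one line
    without becoming zero. The complex of a free resolution of M is restricted
    to one coordinate after the other ([state_step]): if the class under
    consideration can be chosen in an eigenspace of the coordinate y, then y is
    restricted to that eigenvalue and the connecting map moves the class to a
    homology one degree higher; if it cannot, then y behaves like a free
    variable and a generic value can be taken ([generic_value]), since modules
    of countable dimension over an uncountable field leave out some value. In
    the end a line carries a homology class z with D_0 z = c z that is not
    torsion, hence an exponential section of the connection that M induces on the
    line. At infinity t d/dt preserves a lattice of this connection, and the
    equation t d/dt z = c t z puts z into all multiples of that lattice
    ([exponential_irregular]).

    The cokernel of D_0 - c is exhausted by the images of the steps F_k of the
    Bernstein filtration of M, and the operators of the base act on it through
    operators of M of order one. As D_0 - c is injective of order one, the k-th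
    image has dimension at most p(k) - p(k - 1), where p is the Hilbert polynomial
    of M, and this is a polynomial of one degree less ([holonomic_quotient]). A
    module with a filtration of such growth is finitely generated: by Bernstein's
    inequality every step of a chain of submodules takes up a definite share of
    the growth ([finitely_generated]). What remains is that the dimensions of the
    Bernstein filtration of a finitely generated module are eventually polynomial.
    This is shown by a Groebner basis argument ([hilbert_function]): the standard
    monomials form a basis, and the count of the elements of bounded degree in an
    order ideal of N^m is eventually polynomial ([order_ideal_evpoly]).

    The identification of the direct image with the de Rham complex is made on a
    free resolution P of N. The tensor product of D_(Z<-X) with P_l is generated
    by the classes of 1 (x) p, and 1 (x) p = 0 exactly if p lies in D_0 P_l
    ([transfer_gen_ker]). Since D_0 is injective on the free modules P_l, a
    diagram chase ([fibre_cycle]) does the rest. *)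

(** * Subspaces and quotients *)

Record subspace (R : nzRingType) (V : lmodType R) := Subspace {
  in_sub :> V -> Prop;
  sub0 : in_sub 0;
  sub_lin : forall c x y, in_sub x -> in_sub y -> in_sub (c *: x + y) }.

Section SubspaceTheory.
Variables (R : nzRingType) (V : lmodType R) (S : subspace V).

Lemma subD x y : S x -> S y -> S (x + y).
Proof. by move=> hx hy; rewrite -[x]scale1r; apply: sub_lin. Qed.

Lemma subZ c x : S x -> S (c *: x).
Proof. by move=> hx; rewrite -[_ *: _]addr0; apply: sub_lin => //; apply: sub0. Qed.

Lemma subN x : S x -> S (- x).
Proof. by rewrite -scaleN1r; apply: subZ. Qed.

Lemma subB x y : S x -> S y -> S (x - y).
Proof. by move=> hx hy; apply: subD => //; apply: subN. Qed.

Lemma sub_sum I (r : seq I) (P : pred I) (F : I -> V) :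
  (forall i, P i -> S (F i)) -> S (\sum_(i <- r | P i) F i).
Proof. by move=> h; elim/big_ind: _ => //; [apply: sub0 | apply: subD]. Qed.

Lemma subBK x y : S (x - y) -> S y -> S x.
Proof. by move=> h1 h2; rewrite -(subrK y x); apply: subD. Qed.

Lemma subBC x y : S (x - y) -> S (y - x).
Proof. by move=> h; rewrite -opprB; apply: subN. Qed.

Lemma subB_trans y x z : S (x - y) -> S (y - z) -> S (x - z).
Proof. by move=> h1 h2; rewrite -(subrK y x) -addrA; apply: subD. Qed.

End SubspaceTheory.

Definition lin_fun (R : nzRingType) (V W : lmodType R) (f : V -> W)
  (hf : linear f) := f.
HB.instance Definition _ (R : nzRingType) (V W : lmodType R) (f : V -> W)
  (hf : linear f) := GRing.isLinear.Build R V W _ (lin_fun hf) hf.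
Definition mklin (R : nzRingType) (V W : lmodType R) (f : V -> W)
  (hf : linear f) : {linear V -> W} := lin_fun hf.
Lemma mklinE (R : nzRingType) (V W : lmodType R) (f : V -> W)
  (hf : linear f) x : mklin hf x = f x.
Proof. by []. Qed.

Section Kernel.
Variables (R : nzRingType) (V W : lmodType R) (f : {linear V -> W}).
Fact ker_lin c x y : f x = 0 -> f y = 0 -> f (c *: x + y) = 0.
Proof. by move=> h1 h2; rewrite linearP h1 h2 scaler0 addr0. Qed.
Definition ker_sub : subspace V := Subspace (linear0 f) ker_lin.
End Kernel.

Definition add_fun_of (V W : zmodType) (f : V -> W)
  (hf : {morph f : x y / x - y}) := f.
HB.instance Definition _ (V W : zmodType) (f : V -> W)
  (hf : {morph f : x y / x - y}) :=
  GRing.isZmodMorphism.Build V W (add_fun_of hf) hf.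
Definition mkadd (V W : zmodType) (f : V -> W)
  (hf : {morph f : x y / x - y}) : {additive V -> W} := add_fun_of hf.

Section Quotient.
Variables (R : nzRingType) (V : lmodType R) (S : subspace V).

Definition qmem : {pred V} := fun x => `[< S x >].

Fact qmem_zmod : zmod_closed qmem.
Proof.
split=> [|x y]; rewrite !unfold_in; first by apply/asboolP/sub0.
by move=> /asboolP hx /asboolP hy; apply/asboolP/subB.
Qed.
HB.instance Definition _ := GRing.isZmodClosed.Build V qmem qmem_zmod.

Definition qspace := Quotient.quot qmem.
HB.instance Definition _ := GRing.Zmodule.on qspace.

Definition qpi (x : V) : qspace := (\pi_(Quotient.quot qmem) x)%qT.
Definition qrepr (x : qspace) : V := repr (x : Quotient.quot qmem).

Lemma qreprK x : qpi (qrepr x) = x.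
Proof. exact: reprK. Qed.

Lemma qpi_eq x y : qpi x = qpi y <-> S (x - y).
Proof.
split=> [/eqP|h]; last first.
  by apply/eqP; rewrite /qpi -Quotient.idealrBE unfold_in; apply/asboolP.
by rewrite /qpi -Quotient.idealrBE unfold_in => /asboolP.
Qed.

Lemma qpiD x y : qpi (x + y) = qpi x + qpi y.
Proof. by rewrite /qpi !piE. Qed.

Definition qscale (c : R) (x : qspace) : qspace := qpi (c *: qrepr x).

Lemma qscaleE c x : qscale c (qpi x) = qpi (c *: x).
Proof.
apply/qpi_eq; rewrite -scalerBr; apply: subZ; apply/qpi_eq; exact: qreprK.
Qed.

Fact qscaleA a b x : qscale a (qscale b x) = qscale (a * b) x.
Proof. by rewrite -[x]qreprK !qscaleE scalerA. Qed.
Fact qscale1 x : qscale 1 x = x.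
Proof. by rewrite -[x]qreprK !qscaleE scale1r. Qed.
Fact qscaleDr : right_distributive qscale +%R.
Proof. by move=> c x y; rewrite -[x]qreprK -[y]qreprK -qpiD !qscaleE scalerDr qpiD. Qed.
Fact qscaleDl x a b : qscale (a + b) x = qscale a x + qscale b x.
Proof. by rewrite -[x]qreprK !qscaleE scalerDl qpiD. Qed.
HB.instance Definition _ :=
  GRing.Zmodule_isLmodule.Build R qspace qscaleA qscale1 qscaleDr qscaleDl.

Fact qpi_linear : linear qpi.
Proof. by move=> c x y; rewrite qpiD -qscaleE. Qed.
HB.instance Definition _ := GRing.isLinear.Build R V qspace _ qpi qpi_linear.

Lemma qpi0 x : qpi x = 0 <-> S x.
Proof. by rewrite -[X in _ = X](linear0 qpi) qpi_eq subr0. Qed.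

End Quotient.

(** A tensor product is generated by the pure tensors: the projection to the
    quotient by their span and the zero map agree on them, hence are equal. *)
Lemma tensor_span (C : fieldType) (U V : lmodType C) (K : nzRingType)
  (T : lmodType K) (I : Type) (f : I -> U -> U) (g : I -> V -> V)
  (t : U -> V -> T) (S : subspace T) :
  is_tensor f g t -> (forall u v, S (t u v)) -> forall x, S x.
Proof.
move=> [hb hu] hS x.
have b0 : balanced f g (fun (_ : U) (_ : V) => (0 : qspace S)).
  by split=> *; rewrite ?addr0.
have [h [_ huniq]] := hu _ _ b0.
pose z := mkadd (fun x y => esym (subr0 (0 : qspace S)) : (fun _ : T => 0 : qspace S) (x - y) = _).
have e1 : z =1 h by apply: huniq.
have e2 : (qpi S : {additive T -> qspace S}) =1 h.
  by apply: huniq => u v /=; apply/qpi0.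
by apply/qpi0; rewrite (e2 x) -(e1 x).
Qed.

Section SubspaceConstructions.
Variables (R : nzRingType) (V W : lmodType R).

Fact zero_lin (c : R) (x y : V) : x = 0 -> y = 0 -> c *: x + y = 0.
Proof. by move=> -> ->; rewrite scaler0 addr0. Qed.
Definition zero_sub : subspace V := Subspace (erefl 0) zero_lin.

Definition add_im (S : subspace W) (f : {linear V -> W}) (x : W) :=
  exists w, S (x - f w).
Fact add_im0 S f : add_im S f 0.
Proof. by exists 0; rewrite linear0 subrr; apply: sub0. Qed.
Fact add_im_lin S f c x y : add_im S f x -> add_im S f y -> add_im S f (c *: x + y).
Proof.
move=> [u hu] [w hw]; exists (c *: u + w).
by rewrite linearP opprD addrACA -scalerBr; apply: sub_lin.
Qed.
Definition add_im_sub S f : subspace W := Subspace (add_im0 S f) (@add_im_lin S f).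

Lemma add_im_l (S : subspace W) f x : S x -> add_im_sub S f x.
Proof. by move=> h; exists 0; rewrite linear0 subr0. Qed.
Lemma add_im_r (S : subspace W) f w : add_im_sub S f (f w).
Proof. by exists w; rewrite subrr; apply: sub0. Qed.
End SubspaceConstructions.

Lemma add_im_stable (R : nzRingType) (V V' W W' : lmodType R) (S : subspace W)
  (S' : subspace W') (f : {linear V -> W}) (f' : {linear V' -> W'})
  (h : {linear W -> W'}) (h' : V -> V') :
  (forall x, S x -> S' (h x)) -> (forall w, h (f w) = f' (h' w)) ->
  forall x, add_im_sub S f x -> add_im_sub S' f' (h x).
Proof. by move=> hS e x [w hw]; exists (h' w); rewrite -e -linearB; apply: hS. Qed.

(** * Ordered polynomials in operators *)

Lemma msize_leP (C : nzRingType) m (f : {mpoly C[m]}) k :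
  (msize f <= k)%N <-> forall al, (k <= mdeg al)%N -> f@_al = 0.
Proof.
split=> [hf al hal|h].
  by apply/memN_msupp_eq0/(contraL _ (leq_trans hf hal)) => /msize_mdeg_lt; rewrite -ltnNge.
rewrite mmeasureE; apply/bigmax_leqP_seq => al hal _; rewrite ltnNge.
by apply: contraL hal => /h h0; rewrite mcoeff_msupp h0 eqxx.
Qed.

Lemma mdeg_gt0_var m (al : 'X_{1..m}) : (0 < mdeg al)%N -> exists i, (0 < al i)%N.
Proof.
move=> hp; apply/existsP; apply: contraLR hp; rewrite negb_exists => /forallP h.
rewrite -eqn0Ngt mdegE sum_nat_eq0; apply/forallP => i.
by have := h i; rewrite lt0n negbK.
Qed.

Lemma mnm_split m (al : 'X_{1..m}) i : (0 < al i)%N -> al = (U_(i) + (al - U_(i)))%MM.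
Proof.
move=> hi; apply/mnmP => j; rewrite mnmDE mnmBE mnm1E.
by case: eqP => [<-|_]; [rewrite addnC subnK | rewrite subn0].
Qed.

Section OpAct.
Variables (C : fieldType) (m : nat) (V : lmodType C).
Variable A : 'I_m -> {linear V -> V}.
Implicit Types (al : 'X_{1..m}) (f : {mpoly C[m]}) (s : seq 'I_m).

Fact iter_linear (T : {linear V -> V}) k : linear (iter k T).
Proof. by move=> c x y; elim: k => //= k ->; rewrite linearP. Qed.
HB.instance Definition _ (T : {linear V -> V}) k :=
  GRing.isLinear.Build C V V _ (iter k T) (iter_linear T k).

Definition lmon s al (v : V) : V := foldr (fun i w => iter (al i) (A i) w) v s.
Definition mon al v := lmon (enum 'I_m) al v.

Fact lmon_linear s al : linear (lmon s al).
Proof. by move=> c x y; elim: s => //= i s ->; rewrite linearP. Qed.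
HB.instance Definition _ s al := GRing.isLinear.Build C V V _ (lmon s al) (lmon_linear s al).
HB.instance Definition _ al := GRing.Linear.copy (mon al) (lmon (enum 'I_m) al).

(** The operator obtained by substituting the operators A_i, ordered by
    increasing index in each monomial, for the variables of f. *)
Definition opact f v : V := \sum_(al <- msupp f) f@_al *: mon al v.

Lemma opactwE k f v : (msize f <= k)%N ->
  opact f v = \sum_(al : 'X_{1..m < k}) f@_al *: mon al v.
Proof.
pose I : subFinType _ := 'X_{1..m < k}.
move=> le_fk; rewrite /opact (big_mksub I) ?msupp_uniq //=; first last.
  by move=> x /msize_mdeg_lt /leq_trans; apply.
by rewrite big_rmcond //= => j /memN_msupp_eq0 ->; rewrite scale0r.
Qed.

Fact opact_linear_r f : linear (opact f).
Proof.
move=> c x y; rewrite /opact scaler_sumr -big_split /=; apply: eq_bigr => al _.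
by rewrite linearP scalerDr !scalerA mulrC.
Qed.
HB.instance Definition _ f := GRing.isLinear.Build C V V _ (opact f) (opact_linear_r f).

Lemma opactP c f g v : opact (c *: f + g) v = c *: opact f v + opact g v.
Proof.
pose k := maxn (msize (c *: f + g)) (maxn (msize f) (msize g)).
rewrite !(@opactwE k) ?leq_max ?leqnn ?orbT // scaler_sumr -big_split /=.
by apply: eq_bigr => al _; rewrite mcoeffD mcoeffZ scalerDl scalerA.
Qed.

Definition opactl v : {linear {mpoly C[m]} -> V} :=
  mklin (fun c f g => opactP c f g v : (fun f => opact f v) (c *: f + g) = _).

Lemma opactD f g v : opact (f + g) v = opact f v + opact g v.
Proof. exact: (linearD (opactl v)). Qed.
Lemma opactN f v : opact (- f) v = - opact f v.
Proof. exact: (linearN (opactl v)). Qed.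
Lemma opact0 v : opact 0 v = 0.
Proof. exact: (linear0 (opactl v)). Qed.
Lemma opactZ c f v : opact (c *: f) v = c *: opact f v.
Proof. by rewrite -[c *: f]addr0 opactP opact0 addr0. Qed.
Lemma opact_sum I (r : seq I) (P : pred I) (F : I -> {mpoly C[m]}) v :
  opact (\sum_(i <- r | P i) F i) v = \sum_(i <- r | P i) opact (F i) v.
Proof. exact: (linear_sum (opactl v)). Qed.

Lemma opactX al v : opact 'X_[al] v = mon al v.
Proof. by rewrite /opact msuppX big_seq1 mcoeffX eqxx scale1r. Qed.

Lemma mon0 v : mon 0%MM v = v.
Proof. by rewrite /mon; elim: (enum _) => //= i s ->; rewrite mnm0E. Qed.

Lemma opactC c v : opact c%:MP v = c *: v.
Proof. by rewrite -[c%:MP]mulr1 mul_mpolyC opactZ -mpolyX0 opactX mon0. Qed.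

Lemma opact1 v : opact 1 v = v.
Proof. by rewrite -[1]/(1%:MP) opactC scale1r. Qed.

End OpAct.

Lemma mpoly_lin_ext (C : fieldType) m (V : lmodType C)
  (F G : {linear {mpoly C[m]} -> V}) :
  (forall al, F 'X_[al] = G 'X_[al]) -> F =1 G.
Proof.
move=> h f; rewrite [f]mpolyE !linear_sum; apply: eq_bigr => al _.
by rewrite !linearZ h.
Qed.

Section OpActComm.
Variables (C : fieldType) (m : nat) (V : lmodType C).
Variable A : 'I_m -> {linear V -> V}.
Implicit Types (al : 'X_{1..m}) (f : {mpoly C[m]}) (s : seq 'I_m).

Lemma eq_lmon s al (be : 'X_{1..m}) v : {in s, forall j, al j = be j} -> lmon A s al v = lmon A s be v.
Proof.
elim: s => //= i s ih h; rewrite ih ?h ?mem_head // => j hj.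
by apply: h; rewrite inE hj orbT.
Qed.

Section Scalar.
Variables (B : {linear V -> V}) (ka : 'I_m -> C).

Lemma iter_comm i k v :
  (forall w, B (A i w) = A i (B w) + ka i *: w) ->
  B (iter k (A i) v) = iter k (A i) (B v) + (k%:R * ka i) *: iter k.-1 (A i) v.
Proof.
move=> hB; elim: k => [|k ih] /=; first by rewrite mul0r scale0r addr0.
rewrite hB ih linearD linearZ -addrA; congr (_ + _).
case: k {ih} => [|k] /=; first by rewrite mul0r scale0r add0r mul1r.
by rewrite -scalerDl; congr (_ *: _); rewrite -[k.+2%:R]natr1 mulrDl mul1r.
Qed.

Lemma lmon_comm s al v :
  uniq s -> (forall j w, B (A j w) = A j (B w) + ka j *: w) ->
  B (lmon A s al v) = lmon A s al (B v) +
    \sum_(j <- s) (ka j * (al j)%:R) *: lmon A s (al - U_(j)) v.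
Proof.
move=> + hB; elim: s => [|i s ih] /=; first by rewrite big_nil addr0.
case/andP=> hi hs; rewrite iter_comm // ih // linearD /= -addrA; congr (_ + _).
rewrite big_cons addrC; congr (_ + _).
  rewrite mulrC; case: (posnP (al i)) => [->|h0]; first by rewrite mulr0 !scale0r.
  congr (_ *: _); rewrite mnmBE mnm1E eqxx subn1; congr iter.
  apply: eq_lmon => j hj; rewrite mnmBE mnm1E.
  by case: eqP hj hi => [<- ->|]; rewrite ?subn0.
rewrite linear_sum; apply: eq_big_seq => j hj; rewrite linearZ /=.
congr (_ *: _); rewrite mnmBE mnm1E.
by case: eqP hj hi => [-> ->|]; rewrite ?subn0.
Qed.

Lemma mderivXE al j : mderiv j ('X_[al] : {mpoly C[m]}) = (al j)%:R *: 'X_[al - U_(j)].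
Proof. exact: mderivX. Qed.

(** An operator with scalar commutators against the A_j acts as a derivation. *)
Lemma opact_comm f v :
  (forall j w, B (A j w) = A j (B w) + ka j *: w) ->
  B (opact A f v) = opact A f (B v) + \sum_j ka j *: opact A (mderiv j f) v.
Proof.
move=> hB.
have hF : linear (fun f => B (opact A f v)).
  by move=> c p q; rewrite opactP linearP.
have hG : linear (fun f => opact A f (B v) + \sum_j ka j *: opact A (mderiv j f) v).
  move=> c p q; rewrite opactP scalerDr addrACA; congr (_ + _).
  rewrite scaler_sumr -big_split; apply: eq_bigr => j _ /=.
  by rewrite mderivD mderivZ opactP scalerDr !scalerA mulrC.
apply: (mpoly_lin_ext (F := mklin hF) (G := mklin hG)) => al; rewrite !mklinE.
rewrite !opactX /mon lmon_comm ?enum_uniq //; congr (_ + _).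
rewrite big_enum; apply: eq_bigr => j _.
by rewrite mderivXE opactZ opactX scalerA.
Qed.
End Scalar.

Section Letter.
Variables (i : 'I_m) (ka : 'I_m -> C).

Lemma lmon_letter s al v :
  pairwise (fun j k : 'I_m => j < k)%N s -> i \in s ->
  (forall j : 'I_m, (j < i)%N -> forall w, A i (A j w) = A j (A i w) + ka j *: w) ->
  (forall j : 'I_m, (i <= j)%N -> ka j = 0) ->
  A i (lmon A s al v) = lmon A s (al + U_(i)) v +
    \sum_(j <- s) (ka j * (al j)%:R) *: lmon A s (al - U_(j)) v.
Proof.
move=> + + hA h0; elim: s => [|k s ih] //= /andP[hk hs].
rewrite inE; case: eqP => [eik|/eqP hik] /=.
  subst k; move=> _; rewrite big_cons h0 // mul0r scale0r add0r big1_seq ?addr0.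
    rewrite mnmDE mnm1E eqxx addn1 /=; do 2!f_equal.
    apply: eq_lmon => j /(allP hk) hj; rewrite mnmDE mnm1E.
    by case: eqP hj => [->|]; rewrite ?ltnn ?addn0.
  move=> j /andP[_ /(allP hk)/ltnW hj]; by rewrite h0 ?mul0r ?scale0r.
move=> his; have hki := allP hk _ his.
rewrite (@iter_comm (A i) ka) ?ih //; last exact: hA.
rewrite linearD /= -addrA; congr (_ + _).
  by rewrite mnmDE mnm1E (negbTE hik) addn0.
rewrite big_cons addrC; congr (_ + _).
  rewrite mulrC; case: (posnP (al k)) => [->|hp]; first by rewrite mulr0 !scale0r.
  congr (_ *: _); rewrite mnmBE mnm1E eqxx subn1; congr iter.
  apply: eq_lmon => j /(allP hk) hj; rewrite mnmBE mnm1E.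
  by case: eqP hj => [->|]; rewrite ?ltnn ?subn0.
rewrite linear_sum; apply: eq_big_seq => j /(allP hk) hj; rewrite linearZ /=.
congr (_ *: _); rewrite mnmBE mnm1E.
by case: eqP hj => [->|]; rewrite ?ltnn ?subn0.
Qed.

Lemma pairwise_enum_ord : pairwise (fun j k : 'I_m => j < k)%N (enum 'I_m).
Proof.
have := iota_ltn_sorted 0 m; rewrite (sorted_pairwise ltn_trans) -val_enum_ord.
by rewrite pairwise_map.
Qed.

(** Multiplying by a letter from the left: the letter has to be moved past
    the letters of smaller index. *)
Lemma opact_letter f v :
  (forall j : 'I_m, (j < i)%N -> forall w, A i (A j w) = A j (A i w) + ka j *: w) ->
  (forall j : 'I_m, (i <= j)%N -> ka j = 0) ->
  A i (opact A f v) = opact A ('X_i * f + \sum_j ka j *: mderiv j f) v.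
Proof.
move=> hA h0.
have hF : linear (fun f => A i (opact A f v)).
  by move=> c p q; rewrite opactP linearP.
have hG : linear (fun f => opact A ('X_i * f + \sum_j ka j *: mderiv j f) v).
  move=> c p q; rewrite -opactP; congr opact.
  rewrite mulrDr scalerDr -scalerAr addrACA; congr (_ + _).
  rewrite scaler_sumr -big_split; apply: eq_bigr => j _ /=.
  by rewrite mderivD mderivZ scalerDr !scalerA mulrC.
apply: (mpoly_lin_ext (F := mklin hF) (G := mklin hG)) => al; rewrite !mklinE.
rewrite opactX /mon (lmon_letter _ _ pairwise_enum_ord) ?mem_enum //.
rewrite opactD -mpolyXD opactX addmC opact_sum; congr (_ + _).
rewrite big_enum; apply: eq_bigr => j _.
by rewrite mderivXE !opactZ opactX scalerA.
Qed.
End Letter.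

Lemma opact_letter_comm (i : 'I_m) f v :
  (forall j : 'I_m, (j < i)%N -> forall w, A i (A j w) = A j (A i w)) ->
  A i (opact A f v) = opact A ('X_i * f) v.
Proof.
move=> h; rewrite (opact_letter (ka := fun=> 0)) //.
  by rewrite big1 ?addr0 // => j _; rewrite scale0r.
by move=> j hj w; rewrite h // scale0r addr0.
Qed.

(** From the right, the letter has to be moved past the letters of larger index. *)
Lemma opact_rletter (i : 'I_m) f v :
  (forall j : 'I_m, (i < j)%N -> forall w, A i (A j w) = A j (A i w)) ->
  opact A f (A i v) = opact A ('X_i * f) v.
Proof.
move=> hA.
have hl s al : pairwise (fun j k : 'I_m => j < k)%N s -> i \in s ->
    lmon A s al (A i v) = lmon A s (al + U_(i)) v.
  elim: s => [|k s ih] //= /andP[hk hs]; rewrite inE mnmDE mnm1E.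
  case: eqP => [eik|/eqP hik] /=; last by move=> /ih ->; rewrite ?addn0.
  move=> _; rewrite addn1 iterSr -eik; congr iter.
  have {hk} hk j : j \in s -> (i < j)%N by move=> /(allP hk); rewrite -eik.
  elim: s hk {hs ih} => //= j s ih hk; rewrite ih; last first.
    by move=> j' hj'; apply: hk; rewrite inE hj' orbT.
  rewrite mnmDE mnm1E; have hj : (i < j)%N by apply: hk; rewrite mem_head.
  case: eqP hj => [->|_ hj]; first by rewrite ltnn.
  by rewrite addn0; elim: (al j) => //= p ->; rewrite hA.
have hF : linear (fun f => opact A f (A i v)) by move=> c p q; rewrite opactP.
have hG : linear (fun f => opact A ('X_i * f) v).
  by move=> c p q; rewrite -opactP mulrDr -scalerAr.
apply: (mpoly_lin_ext (F := mklin hF) (G := mklin hG)) => al; rewrite !mklinE.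
by rewrite -mpolyXD !opactX addmC /mon hl ?mem_enum ?pairwise_enum_ord.
Qed.

(** A filtration raised by one by the letters is raised by the degree by
    the monomials. *)
Lemma mon_filt (F : nat -> V -> Prop) k v al :
  (forall i l w, F l w -> F l.+1 (A i w)) -> F k v -> F (k + mdeg al)%N (mon A al v).
Proof.
move=> hF hv; rewrite /mon mdegE -big_enum /=.
elim: (enum _) => [|i s ih] /=; first by rewrite big_nil addn0.
rewrite big_cons addnCA; elim: (al i) => //= p; exact: hF.
Qed.

Lemma opact_sub (S : subspace V) f v :
  (forall i w, S w -> S (A i w)) -> S v -> S (opact A f v).
Proof.
move=> hS hv; apply: sub_sum => al _; apply: subZ.
by apply: (mon_filt (F := fun _ => S) (k := 0)) => // i _; apply: hS.
Qed.
End OpActComm.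

(** * The Weyl algebra and its action on D-modules *)

Lemma msizeXM (C : fieldType) m (k : 'I_m) (g : {mpoly C[m]}) :
  g != 0 -> msize ('X_k * g) = (msize g).+1.
Proof.
move=> g0; have hX : msize ('X_k : {mpoly C[m]}) = 2 by rewrite mmeasureX /= mdeg1.
by rewrite msizeM ?hX // -msize_poly_eq0 hX.
Qed.

Lemma msize_mderiv (C : fieldType) m (k : 'I_m) (f : {mpoly C[m]}) l :
  (msize f <= l.+1)%N -> (msize (mderiv k f) <= l)%N.
Proof.
move=> /msize_leP h; apply/msize_leP => al hal; rewrite mcoeff_deriv h ?mul0rn //.
by rewrite mdegD mdeg1 addn1 ltnS.
Qed.

(** Induction on the degree: a monomial of positive degree is a variable times
    a smaller one, up to terms of lower degree, which are covered as well. *)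
Lemma mpoly_gen (C : fieldType) m (S : subspace {mpoly C[m]}) (E : 'I_m -> {mpoly C[m]} -> {mpoly C[m]}) :
  (forall k f l, (msize f <= l.+1)%N -> (msize (E k f) <= l)%N) ->
  S 1 -> (forall k f, S f -> S ('X_k * f + E k f)) -> forall f, S f.
Proof.
move=> hE S1 hS f; have [d] := ubnP (msize f); elim: d f => // d ih f; rewrite ltnS => hf.
rewrite [f]mpolyE big_seq; apply: sub_sum => al /msize_mdeg_lt hal; apply: subZ.
have {}hal := leq_trans hal hf.
case: (posnP (mdeg al)) => [/eqP|hp].
  by rewrite mdeg_eq0 => /eqP ->; rewrite mpolyX0.
have [i hi] := mdeg_gt0_var hp.
pose be := (al - U_(i))%MM.
have e : al = (U_(i) + be)%MM by apply: mnm_split.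
have hbe : (mdeg be).+1 = mdeg al by rewrite e mdegD mdeg1 add1n.
have sbe : msize ('X_[be] : {mpoly C[m]}) = mdeg al by rewrite mmeasureX /= hbe.
have h1 : S 'X_[be] by apply: ih; rewrite sbe.
rewrite e mpolyXD -[_ * _](addrK (E i 'X_[be])); apply: subB; first exact: hS.
apply: ih; apply: (@leq_ltn_trans (mdeg be)); first by apply: hE; rewrite sbe hbe.
by apply: leq_trans hal; rewrite -hbe.
Qed.

Fact dop_linear (C : fieldType) n (M : dmodule C n) s : linear (@dop C n M s).
Proof. by case: s => i c x y; rewrite /= linearP. Qed.
HB.instance Definition _ (C : fieldType) n (M : dmodule C n) s :=
  GRing.isLinear.Build C M M _ (@dop C n M s) (dop_linear s).

Section WeylAction.
Variables (C : fieldType) (n : nat) (M : dmodule C n).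

Definition wl (k : 'I_(n + n)) : {linear M -> M} :=
  match split k with inl i => dX M i | inr j => dD M j end.

(** The action on M of the differential operator with normally ordered symbol
    f, in which the variables lshift n i and rshift n i stand for x_i and d_i. *)
Definition wop (f : {mpoly C[n + n]}) (v : M) : M := opact wl f v.
HB.instance Definition _ f := GRing.Linear.copy (wop f) (opact wl f).

Lemma wl_l i : wl (lshift n i) = dX M i.
Proof. by rewrite /wl (unsplitK (inl i)). Qed.
Lemma wl_r i : wl (rshift n i) = dD M i.
Proof. by rewrite /wl (unsplitK (inr i)). Qed.

Lemma sum_delta (W : lmodType C) (F : 'I_n -> W) i :
  \sum_j (i == j)%:R *: F j = F i.
Proof.
rewrite (bigD1 i) //= eqxx scale1r big1 ?addr0 // => j /negbTE.
by rewrite eq_sym => ->; rewrite scale0r.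
Qed.

Lemma wop_X i f v : wop ('X_(lshift n i) * f) v = dX M i (wop f v).
Proof.
rewrite -wl_l /wop opact_letter_comm // => j hj w; rewrite wl_l.
case: (split_ordP j) hj => k ->; last by rewrite /= ltnNge (leq_trans (ltnW (ltn_ord i))) ?leq_addr.
by move=> _; rewrite wl_l dXX.
Qed.

Lemma wop_D i f v :
  wop (mderiv (lshift n i) f + 'X_(rshift n i) * f) v = dD M i (wop f v).
Proof.
pose ka (k : 'I_(n + n)) : C := if split k is inl j then (i == j)%:R else 0.
have kal j : ka (lshift n j) = (i == j)%:R by rewrite /ka (unsplitK (inl j)).
have kar j : ka (rshift n j) = 0 by rewrite /ka (unsplitK (inr j)).
rewrite -wl_r /wop (@opact_letter _ _ _ _ _ ka).
- congr opact; rewrite addrC big_split_ord /=; congr (_ + _).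
  under eq_bigr do rewrite kal; rewrite sum_delta big1 ?addr0 // => j _.
  by rewrite kar scale0r.
- move=> j _ w; case: (split_ordP j) => k ->; rewrite wl_r.
    by rewrite wl_l kal dDX.
  by rewrite wl_r kar scale0r addr0 dDD.
- move=> j; case: (split_ordP j) => k -> /=; last by rewrite kar.
  by rewrite leqNgt (leq_trans (ltn_ord k)) ?leq_addr.
Qed.
End WeylAction.

Section WeylModule.
Variables (C : fieldType) (n : nat).

Definition weyl_X (i : 'I_n) (f : {mpoly C[n + n]}) := 'X_(lshift n i) * f.
Definition weyl_D (i : 'I_n) (f : {mpoly C[n + n]}) :=
  mderiv (lshift n i) f + 'X_(rshift n i) * f.

Fact weyl_X_linear i : linear (weyl_X i).
Proof. by move=> c p q; rewrite /weyl_X mulrDr scalerAr. Qed.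
HB.instance Definition _ i := GRing.isLinear.Build C {mpoly C[n + n]} {mpoly C[n + n]} _
  (weyl_X i) (weyl_X_linear i).
Fact weyl_D_linear i : linear (weyl_D i).
Proof.
move=> c p q; rewrite /weyl_D mderivD mderivZ mulrDr -scalerAr.
by rewrite scalerDr addrACA.
Qed.
HB.instance Definition _ i := GRing.isLinear.Build C {mpoly C[n + n]} {mpoly C[n + n]} _
  (weyl_D i) (weyl_D_linear i).

Fact weyl_XX i j f : weyl_X i (weyl_X j f) = weyl_X j (weyl_X i f).
Proof. exact: mulrCA. Qed.
Fact weyl_DD i j f : weyl_D i (weyl_D j f) = weyl_D j (weyl_D i f).
Proof.
rewrite /weyl_D !mderivD !mderivXM (mderiv_comm (lshift n i)) !mulrDr.
rewrite !(eq_lrshift, scale0r, addr0) (mulrCA 'X_(rshift n i)).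
by rewrite -!addrA; congr (_ + _); rewrite addrCA.
Qed.
Fact weyl_DX i j f : weyl_D i (weyl_X j f) = weyl_X j (weyl_D i f) + (i == j)%:R *: f.
Proof.
rewrite /weyl_D /weyl_X mderivXM mulrDr (inj_eq (@lshift_inj _ _)).
by rewrite addrAC (mulrCA 'X_(rshift n i)).
Qed.

(** The Weyl algebra as a left module over itself, in terms of normally ordered
    symbols. *)
Definition weyl : dmodule C n :=
  @DModule C n {mpoly C[n + n]} (fun i => weyl_X i) (fun i => weyl_D i)
    weyl_XX weyl_DD weyl_DX.

Lemma wop_dop (M : dmodule C n) s (f : weyl) (v : M) :
  wop (dop s f) v = dop s (wop f v).
Proof. by case: s => i; [apply: wop_X | apply: wop_D]. Qed.

Lemma wop1 (M : dmodule C n) (v : M) : wop 1 v = v.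
Proof. exact: opact1. Qed.

Lemma msize_dop s (f : weyl) : (msize (dop s f : {mpoly C[n + n]}) <= (msize (f : {mpoly C[n + n]})).+1)%N.
Proof.
have hX k (g : {mpoly C[n + n]}) : (msize ('X_k * g) <= (msize g).+1)%N.
  case: (eqVneq g 0) => [->|g0]; first by rewrite mulr0 mmeasure0.
  by rewrite msizeXM.
case: s => i; first exact: hX.
apply: leq_trans (msizeD_le _ _) _; rewrite geq_max hX andbT.
by apply/leqW/msize_mderiv/leqW.
Qed.
End WeylModule.

(** * Free D-modules *)

Section LinComb.
Variables (C : fieldType) (V : lmodType C).

Definition lcomb n (w : 'I_n -> C) (A : 'I_n -> {linear V -> V}) (v : V) :=
  \sum_i w i *: A i v.
Fact lcomb_linear n (w : 'I_n -> C) A : linear (lcomb w A).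
Proof.
move=> c x y; rewrite /lcomb scaler_sumr -big_split; apply: eq_bigr => i _ /=.
by rewrite linearP scalerDr !scalerA mulrC.
Qed.
HB.instance Definition _ n (w : 'I_n -> C) A :=
  GRing.isLinear.Build C V V _ (lcomb w A) (lcomb_linear w A).

Lemma lcomb_comp n (g h : 'M[C]_n) (A : 'I_n -> {linear V -> V}) i v :
  g *m h = 1%:M -> \sum_k g i k *: lcomb (h k) A v = A i v.
Proof.
move=> e; under eq_bigr do rewrite /lcomb scaler_sumr.
rewrite exchange_big /= -(sum_delta (fun j => A j v)); apply: eq_bigr => j _.
have -> : (i == j)%:R = (g *m h) i j by rewrite e mxE.
by rewrite mxE scaler_suml; apply: eq_bigr => k _; rewrite scalerA.
Qed.

End LinComb.

Lemma lcomb_comm (C : fieldType) (V W : lmodType C) n (w : 'I_n -> C)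
  (A : 'I_n -> {linear V -> V}) (B : 'I_n -> {linear W -> W}) (h : {linear V -> W}) v :
  (forall k, h (A k v) = B k (h v)) -> h (lcomb w A v) = lcomb w B (h v).
Proof.
by move=> e; rewrite linear_sum; apply: eq_bigr => k _; rewrite linearZ /= e.
Qed.

(** Linear change of coordinates: the new coordinates are g x and the new
    derivations are the dual ones. *)
Section Twist.
Variables (C : fieldType) (n : nat) (M : dmodule C n) (g h : 'M[C]_n).
Hypothesis hgh : g *m h = 1%:M.

Definition tw_X i : {linear M -> M} := lcomb (g i) (dX M).
Definition tw_D i : {linear M -> M} := lcomb (h^T i) (dD M).

Fact lin_sum2 (A B : 'I_n -> {linear M -> M}) (a b : 'I_n -> C) m :
  lcomb a A (lcomb b B m) = \sum_k \sum_l (a k * b l) *: A k (B l m).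
Proof.
apply: eq_bigr => k _; rewrite linear_sum scaler_sumr; apply: eq_bigr => l _.
by rewrite linearZ scalerA.
Qed.

Fact tw_XX i j m : tw_X i (tw_X j m) = tw_X j (tw_X i m).
Proof.
rewrite /tw_X /tw_D /= !lin_sum2 exchange_big; apply: eq_bigr => k _; apply: eq_bigr => l _.
by rewrite dXX mulrC.
Qed.
Fact tw_DD i j m : tw_D i (tw_D j m) = tw_D j (tw_D i m).
Proof.
rewrite /tw_X /tw_D /= !lin_sum2 exchange_big; apply: eq_bigr => k _; apply: eq_bigr => l _.
by rewrite dDD mulrC.
Qed.
Fact tw_DX i j m : tw_D i (tw_X j m) = tw_X j (tw_D i m) + (i == j)%:R *: m.
Proof.
rewrite /tw_X /tw_D /= !lin_sum2 exchange_big /=.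
have -> : (i == j)%:R = (g *m h) j i by rewrite hgh mxE eq_sym.
rewrite mxE scaler_suml -big_split /=; apply: eq_bigr => k _.
under eq_bigr do rewrite dDX scalerDr mulrC.
rewrite big_split; congr (_ + _) => /=.
rewrite (bigD1 k) //= eqxx scale1r mxE big1 ?addr0 // => l /negbTE.
by move=> ->; rewrite scale0r scaler0.
Qed.

Definition twist : dmodule C n := @DModule C n M tw_X tw_D tw_XX tw_DD tw_DX.
End Twist.

Lemma twist_dhom (C : fieldType) n (g h : 'M[C]_n) (hgh : g *m h = 1%:M)
  (M N : dmodule C n) (f : {linear M -> N}) :
  is_dhom f -> is_dhom (f : {linear twist M hgh -> twist N hgh}).
Proof.
move=> hf [] i m; apply: lcomb_comm => k.
  exact: (hf (inl k)).
exact: (hf (inr k)).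
Qed.

Lemma untwist_dhom (C : fieldType) n (g h : 'M[C]_n) (hgh : g *m h = 1%:M)
  (hhg : h *m g = 1%:M) (M N : dmodule C n) (f : {linear M -> N}) :
  is_dhom (f : {linear M -> twist N hhg}) ->
  is_dhom (f : {linear twist M hgh -> N}).
Proof.
move=> hf [] i m /=.
  rewrite -[in RHS](lcomb_comp (dX N) _ _ hgh) linear_sum; apply: eq_bigr => k _.
  by rewrite linearZ /=; congr (_ *: _); exact: (hf (inl k) m).
have e : h^T *m g^T = 1%:M by rewrite -trmx_mul hgh trmx1.
rewrite -[in RHS](lcomb_comp (dD N) _ _ e) linear_sum; apply: eq_bigr => k _.
by rewrite linearZ /=; congr (_ *: _); exact: (hf (inr k) m).
Qed.

Lemma retwist_dhom (C : fieldType) n (g h : 'M[C]_n) (hgh : g *m h = 1%:M)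
  (hhg : h *m g = 1%:M) (M N : dmodule C n) (f : {linear M -> N}) :
  is_dhom (f : {linear twist M hgh -> N}) ->
  is_dhom (f : {linear M -> twist N hhg}).
Proof.
move=> hf [] i m /=.
  rewrite -{1}(lcomb_comp (dX M) i m hhg) linear_sum; apply: eq_bigr => k _.
  by rewrite linearZ /=; congr (_ *: _); exact: (hf (inl k) m).
have e : g^T *m h^T = 1%:M by rewrite -trmx_mul hhg trmx1.
rewrite -{1}(lcomb_comp (dD M) i m e) linear_sum; apply: eq_bigr => k _.
by rewrite linearZ /=; congr (_ *: _); exact: (hf (inr k) m).
Qed.

Lemma twist_free (C : fieldType) n (g h : 'M[C]_n) (hgh : g *m h = 1%:M)
  (P : dmodule C n) : is_free P -> is_free (twist P hgh).
Proof.
move=> [I [e he]]; have hhg := mulmx1C hgh.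
exists I, e => N v; have [f [hf fe fu]] := he (twist N hhg) v.
exists f; split=> //; first exact: untwist_dhom.
by move=> f' hf' fe'; apply: fu => //; apply: retwist_dhom.
Qed.

Section QuotientModule.
Variables (C : fieldType) (n : nat) (M : dmodule C n) (S : subspace M).
Hypothesis hS : forall s m, S m -> S (dop s m).

Definition qop s (x : qspace S) : qspace S := qpi S (dop s (qrepr x)).
Lemma qopE s m : qop s (qpi S m) = qpi S (dop s m).
Proof.
apply/qpi_eq; rewrite /dop; case: s => i; rewrite -linearB.
  by apply: (hS (inl i)); apply/qpi_eq; rewrite qreprK.
by apply: (hS (inr i)); apply/qpi_eq; rewrite qreprK.
Qed.
Fact qop_linear s : linear (qop s).
Proof.
move=> c x y; rewrite -[x]qreprK -[y]qreprK -linearP !qopE -linearP.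
by case: s => i /=; rewrite linearP.
Qed.
HB.instance Definition _ s := GRing.isLinear.Build C (qspace S) (qspace S) _ (qop s) (qop_linear s).

Fact qop_XX i j m : qop (inl i) (qop (inl j) m) = qop (inl j) (qop (inl i) m).
Proof. by rewrite -[m]qreprK !qopE /= dXX. Qed.
Fact qop_DD i j m : qop (inr i) (qop (inr j) m) = qop (inr j) (qop (inr i) m).
Proof. by rewrite -[m]qreprK !qopE /= dDD. Qed.
Fact qop_DX i j m : qop (inr i) (qop (inl j) m) =
  qop (inl j) (qop (inr i) m) + (i == j)%:R *: m.
Proof. by rewrite -[m]qreprK !qopE /= dDX -linearZ -linearD. Qed.

Definition quotient_module : dmodule C n :=
  @DModule C n (qspace S) (fun i => qop (inl i)) (fun i => qop (inr i))
    qop_XX qop_DD qop_DX.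

Lemma qpi_dhom : is_dhom (qpi S : {linear M -> quotient_module}).
Proof. by case=> i m; rewrite [RHS]qopE. Qed.
End QuotientModule.

Section FreeModule.
Variables (C : fieldType) (n : nat) (P : dmodule C n).
Variables (I : Type) (e : I -> P).
Hypothesis free_e : forall (N : dmodule C n) (v : I -> N),
  exists h : {linear P -> N},
    [/\ is_dhom h, forall i, h (e i) = v i
      & forall h' : {linear P -> N},
          is_dhom h' -> (forall i, h' (e i) = v i) -> h' =1 h].

(** The projection to the quotient by S and the zero map agree on the basis. *)
Lemma free_gen (S : subspace P) :
  (forall s m, S m -> S (dop s m)) -> (forall i, S (e i)) -> forall p, S p.
Proof.
move=> hS he p; pose Q := quotient_module hS.
have [h [_ _ hu]] := free_e (fun _ => 0 : Q).
have e1 : (qpi S : {linear P -> Q}) =1 h.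
  by apply: hu => [|i]; [exact: qpi_dhom | apply/qpi0].
have e2 : (\0 : {linear P -> Q}) =1 h.
  by apply: hu => // s m /=; case: s => i /=; rewrite linear0.
by apply/qpi0; rewrite (e1 p) -(e2 p).
Qed.

Local Notation J := {classic I}.

Lemma free_coord_exists (i : J) : { la : {linear P -> weyl C n} |
  is_dhom la /\ forall j : J, la (e j) = (i == j)%:R }.
Proof.
apply: cid; have [h [h1 h2 _]] := free_e (fun j : J => (i == j)%:R : weyl C n).
by exists h.
Qed.

Definition free_coord i : {linear P -> weyl C n} := sval (free_coord_exists i).

Lemma free_coord_dhom i : is_dhom (free_coord i).
Proof. exact: (svalP (free_coord_exists i)).1. Qed.
Lemma free_coordE i (j : J) : free_coord i (e j) = ((i : J) == j)%:R.
Proof. exact: (svalP (free_coord_exists i)).2. Qed.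

Lemma big_uniq_sub (W : zmodType) (s s' : seq J) (F : J -> W) :
  uniq s -> uniq s' -> {subset s <= s'} -> (forall i, i \notin s -> F i = 0) ->
  \sum_(i <- s') F i = \sum_(i <- s) F i.
Proof.
move=> us us' ss h0; rewrite (bigID (mem s)) /= [X in _ + X]big1 ?addr0.
  rewrite -big_filter; apply: perm_big; apply: uniq_perm; rewrite ?filter_uniq //.
  by move=> i; rewrite mem_filter; apply/andP/idP => [[]|hi] //; split=> //; apply: ss.
by move=> i hi; apply: h0.
Qed.

(** The elements that satisfy this identity form a submodule, which contains the
    basis. *)
Lemma free_decomp p : exists s : seq J, p = \sum_(i <- s) wop (free_coord i p) (e i).
Proof.
pose dec p (s : seq J) := [/\ uniq s, forall i, i \notin s -> free_coord i p = 0
  & p = \sum_(i <- s) wop (free_coord i p) (e i)].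
have w0 v : wop (0 : {mpoly C[n + n]}) (v : P) = 0 by apply: opact0.
have ext p1 s s' : uniq s' -> {subset s <= s'} -> dec p1 s -> dec p1 s'.
  move=> us' ss [us h0 e1]; split=> // [i hi|].
    by apply: h0; apply: contraNN hi; apply: ss.
  rewrite {1}e1; apply/esym/big_uniq_sub => // i /h0 ->; exact: w0.
have S0 : exists s, dec 0 s.
  by exists [::]; split=> //; rewrite ?big_nil // => i _; rewrite linear0.
have Slin c x y : (exists s, dec x s) -> (exists s, dec y s) -> exists s, dec (c *: x + y) s.
  move=> [s1 d1] [s2 d2]; pose s := undup (s1 ++ s2).
  have us : uniq s by apply: undup_uniq.
  have {d1} [_ z1 e1] : dec x s.
    by apply: ext d1 => // i hi; rewrite mem_undup mem_cat hi.
  have {d2} [_ z2 e2] : dec y s.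
    by apply: ext d2 => // i hi; rewrite mem_undup mem_cat hi orbT.
  exists s; split=> // [i hi|]; first by rewrite linearP z1 // z2 // scaler0 addr0.
  rewrite {1}e1 {1}e2 scaler_sumr -big_split; apply: eq_bigr => i _ /=.
  by rewrite linearP /wop opactP.
suff [s [_ _ h]] : exists s, dec p s by exists s.
apply: (@free_gen (Subspace S0 Slin)) p => /=.
  move=> t m [s [us z em]]; exists s; split=> // [i /z zi|].
    by rewrite free_coord_dhom zi linear0.
  by rewrite {1}em linear_sum; apply: eq_bigr => i _; rewrite free_coord_dhom wop_dop.
move=> i; exists [:: (i : J)]; split=> // [j|].
  by rewrite inE => /negbTE h; rewrite free_coordE h.
by rewrite big_seq1 free_coordE eqxx wop1.
Qed.

Lemma free_coord_inj p : (forall i, free_coord i p = 0) -> p = 0.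
Proof.
move=> h; have [s ->] := free_decomp p; apply: big1_seq => i _.
by rewrite h; apply: opact0.
Qed.
End FreeModule.

(** A lift of the values on the basis extends to P, and the two maps to B agree
    on the basis. *)
Lemma free_lift (C : fieldType) n (P A B : dmodule C n) (d : {linear A -> B})
  (f : {linear P -> B}) :
  is_free P -> is_dhom d -> is_dhom f -> (forall p, exists a, f p = d a) ->
  exists f' : {linear P -> A}, is_dhom f' /\ forall p, d (f' p) = f p.
Proof.
move=> [I [e he]] hd hf him.
pose v i := sval (cid (him (e i))).
have vP i : d (v i) = f (e i) by rewrite /v; case: cid.
have [f' [hf' fe _]] := he A v; exists f'; split=> // p.
have [h [_ _ hu]] := he B (fun i => f (e i)).
have e1 : (d \o f' : {linear P -> B}) =1 h.
  by apply: hu => [s m|i] /=; rewrite ?hf' ?hd // fe vP.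
by rewrite -[d _]/((d \o f' : {linear P -> B}) p) e1 -(hu f).
Qed.

(** * Comparison of free resolutions *)

Lemma dependent_choice_seq (A : nat -> Type) (Q : forall l, A l -> Prop)
  (R : forall l, A l -> A l.+1 -> Prop) :
  (exists a, Q 0%N a) ->
  (forall l a, Q l a -> exists b, Q l.+1 b /\ R l a b) ->
  exists f : forall l, A l, forall l, Q l (f l) /\ R l (f l) (f l.+1).
Proof.
move=> h0 hs.
pose step l (x : {a | Q l a}) : {b : A l.+1 | Q l.+1 b /\ R l (sval x) b} :=
  cid (hs l _ (svalP x)).
pose F := fix F l : {a | Q l a} := match l with
  | 0%N => cid h0
  | l'.+1 => exist _ (sval (step l' (F l'))) (svalP (step l' (F l'))).1
  end.
exists (fun l => sval (F l)) => l; split; first exact: svalP.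
exact: (svalP (step l (F l))).2.
Qed.

Section Comparison.
Variables (C : fieldType) (n : nat) (M : dmodule C n).

Lemma res_dd (P : free_resolution M) l p : res_d P l (res_d P l.+1 p) = 0.
Proof. by apply/res_exact; exists p. Qed.

Lemma aug_d (P : free_resolution M) p : res_aug P (res_d P 0 p) = 0.
Proof. by apply/res_exact0; exists p. Qed.

(** Built degree by degree by [free_lift]. The induction carries along that the
    composite with the differential lands in the boundaries of P'. *)
Lemma chain_map_exists (P P' : free_resolution M) :
  exists f : forall l, {linear P l -> P' l},
    [/\ forall l, is_dhom (f l), forall p, res_aug P' (f 0%N p) = res_aug P p
      & forall l p, res_d P' l (f l.+1 p) = f l (res_d P l p)].
Proof.
pose A l := {linear P l -> P' l}.
pose Q l (f : A l) := [/\ is_dhom f, (forall p, exists p', f (res_d P l p) = res_d P' l p')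
  & (match l return A l -> Prop with
     | 0%N => fun f => forall p, res_aug P' (f p) = res_aug P p | _ => fun=> True end) f].
pose R l (f : A l) (f' : A l.+1) := forall p, res_d P' l (f' p) = f (res_d P l p).
have [||f hf] := @dependent_choice_seq A Q R.
- have [f [hf fe]] : exists f : {linear P 0%N -> P' 0%N},
      is_dhom f /\ forall p, res_aug P' (f p) = res_aug P p.
    apply: free_lift; try exact: res_aughom; first exact: res_free.
    by move=> p; have [a] := res_aug_surj P' (res_aug P p); exists a.
  exists f; split=> // p.
  by apply/res_exact0; rewrite fe aug_d.
- move=> l f [hf fi _].
  have [f' [hf' fe]] : exists f' : {linear P l.+1 -> P' l.+1},
      is_dhom f' /\ forall p, res_d P' l (f' p) = (f \o res_d P l) p.
    apply: free_lift => //; [exact: res_free | exact: res_dhom |].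
    by move=> s m /=; rewrite res_dhom hf.
  exists f'; split=> //; split=> // p; apply/res_exact.
  by rewrite fe /= res_dd linear0.
exists f; split=> [l|p|l p]; last exact: (hf l).2; first by have [[]] := hf l.
by have [[_ _ h] _] := hf 0%N; apply: h.
Qed.

(** Again by [free_lift]: u - s d takes values in the cycles, hence in the
    boundaries. *)
Lemma homotopy_exists (P : free_resolution M) (u : forall l, {linear P l -> P l}) :
  (forall l, is_dhom (u l)) -> (forall p, res_aug P (u 0%N p) = 0) ->
  (forall l p, res_d P l (u l.+1 p) = u l (res_d P l p)) ->
  exists s : forall l, {linear P l -> P l.+1},
    [/\ forall l, is_dhom (s l), forall p, u 0%N p = res_d P 0 (s 0%N p)
      & forall l p, u l.+1 p = res_d P l.+1 (s l.+1 p) + s l (res_d P l p)].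
Proof.
move=> hu u0 uc.
pose A l := {linear P l -> P l.+1}.
pose Q l (s : A l) := [/\ is_dhom s,
    (forall p, exists p', u l.+1 p - s (res_d P l p) = res_d P l.+1 p')
  & (match l return A l -> Prop with
     | 0%N => fun s => forall p, res_d P 0 (s p) = u 0%N p | _ => fun=> True end) s].
pose R l (s : A l) (s' : A l.+1) :=
  forall p, res_d P l.+1 (s' p) = u l.+1 p - s (res_d P l p).
have [||s hs] := @dependent_choice_seq A Q R.
- have [s [hs se]] : exists s : {linear P 0%N -> P 1%N},
      is_dhom s /\ forall p, res_d P 0 (s p) = u 0%N p.
    apply: free_lift => //; [exact: res_free | exact: res_dhom |].
    by move=> p; have /res_exact0 [p' ->] := u0 p; exists p'.
  exists s; split=> // p; apply/res_exact.
  by rewrite linearB uc se subrr.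
- move=> l s [hs si _].
  have [s' [hs' se]] : exists s' : {linear P l.+1 -> P l.+2},
      is_dhom s' /\ forall p, res_d P l.+1 (s' p) = (u l.+1 \- (s \o res_d P l)) p.
    apply: free_lift => //; [exact: res_free | exact: res_dhom |].
    by move=> t m /=; rewrite res_dhom hs hu linearB.
  exists s'; split=> //; split=> // p; apply/res_exact.
  by rewrite linearB uc se /= res_dd linear0 subr0 subrr.
exists s; split=> [l|p|l p]; first by have [[]] := hs l.
  by have [[_ _ h] _] := hs 0%N; rewrite h.
by have [_ ->] := hs l; rewrite subrK.
Qed.
End Comparison.

(** * Dimension counting modulo a subspace *)

(** A homogeneous linear system with more unknowns than equations. *)
Lemma underdetermined (C : fieldType) (I J : finType) (a : I -> J -> C) : (#|J| < #|I|)%N ->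
  exists c : I -> C, (exists i, c i != 0) /\ forall j, \sum_i c i * a i j = 0.
Proof.
move=> lt; pose B := \matrix_(i < #|I|, j < #|J|) a (enum_val i) (enum_val j).
have kn0 : kermx B != 0.
  by rewrite -mxrank_eq0 mxrank_ker subn_eq0 -ltnNge (leq_ltn_trans (rank_leq_col B)).
pose x := nz_row (kermx B).
have x0 : x *m B = 0 by apply/sub_kermxP/nz_row_sub.
have /rV0Pn [i hi] : x != 0 by rewrite nz_row_eq0.
exists (fun i => x 0 (enum_rank i)); split; first by exists (enum_val i); rewrite enum_valK.
move=> j; have := congr1 (fun y : 'rV_#|J| => y 0 (enum_rank j)) x0.
rewrite !mxE => e; rewrite -[RHS]e (reindex_onto enum_val enum_rank) => [|? _]; last exact: enum_rankK.
rewrite (eq_bigl xpredT) => [|k]; last by rewrite enum_valK eqxx.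
by apply: eq_bigr => k _; rewrite mxE enum_rankK enum_valK.
Qed.
Section Dimension.
Variables (C : fieldType) (V : lmodType C).
Implicit Types (S A : subspace V).

Definition indep S d (u : 'I_d -> V) :=
  forall c : 'I_d -> C, S (\sum_i c i *: u i) -> forall i, c i = 0.

Definition spanned S d (w : 'I_d -> V) x := exists c : 'I_d -> C, S (x - \sum_i c i *: w i).

Fact spanned0 S d (w : 'I_d -> V) : spanned S w 0.
Proof. by exists (fun=> 0); rewrite big1 ?subr0 => [|i _]; [apply: sub0 | rewrite scale0r]. Qed.
Fact spanned_lin S d (w : 'I_d -> V) c x y :
  spanned S w x -> spanned S w y -> spanned S w (c *: x + y).
Proof.
move=> [a ha] [b hb]; exists (fun i => c * a i + b i).
have -> : \sum_i (c * a i + b i) *: w i = c *: (\sum_i a i *: w i) + \sum_i b i *: w i.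
  by rewrite scaler_sumr -big_split; apply: eq_bigr => i _; rewrite scalerDl scalerA.
by rewrite opprD addrACA -scalerBr; apply: sub_lin.
Qed.
Definition span_mod S d (w : 'I_d -> V) : subspace V :=
  Subspace (spanned0 S w) (@spanned_lin S d w).

Lemma span_gen S d (w : 'I_d -> V) i : span_mod S w (w i).
Proof.
exists (fun j => (i == j)%:R); rewrite (bigD1 i) //= eqxx scale1r big1 ?addr0.
  by rewrite subrr; apply: sub0.
by move=> j /negbTE; rewrite eq_sym => ->; rewrite scale0r.
Qed.

(** Steinitz: a nonzero solution of the linear system given by the coefficients
    of the u_i with respect to the w_j is a relation between the u_i modulo S. *)
Lemma steinitz S d e (u : 'I_d -> V) (w : 'I_e -> V) :
  indep S u -> (forall i, span_mod S w (u i)) -> (d <= e)%N.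
Proof.
move=> hu hw; rewrite leqNgt; apply/negP => lt_ed.
pose c i := sval (cid (hw i)).
have cP i : S (u i - \sum_j c i j *: w j) by rewrite /c; case: cid.
have [|r [[i ri] r0]] := @underdetermined C _ _ c; first by rewrite !card_ord.
case/eqP: ri; apply: (hu r) i.
have -> : \sum_i r i *: u i = \sum_i r i *: (u i - \sum_j c i j *: w j).
  under [RHS]eq_bigr do rewrite scalerBr; rewrite sumrB.
  rewrite [X in _ - X](_ : _ = 0) ?subr0 //.
  under eq_bigr do rewrite scaler_sumr; rewrite exchange_big big1 // => j _ /=.
  under eq_bigr do rewrite scalerA; rewrite -scaler_suml r0 scale0r.
  by [].
by apply: sub_sum => i _; apply: subZ.
Qed.

Definition fcons d (x : V) (u : 'I_d -> V) (i : 'I_d.+1) : V := oapp u x (unlift ord0 i).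

Lemma indep_cons S d x (u : 'I_d -> V) :
  indep S u -> ~ span_mod S u x -> indep S (fcons x u).
Proof.
move=> hu hx c; rewrite big_ord_recl /fcons unlift_none /=.
under eq_bigr do rewrite liftK /=; move=> hc.
have c0 : c ord0 = 0.
  apply: contra_notP hx => /eqP cn0.
  exists (fun i => - (c ord0)^-1 * c (lift ord0 i)).
  have -> : x - \sum_i (- (c ord0)^-1 * c (lift ord0 i)) *: u i =
      (c ord0)^-1 *: (c ord0 *: x + \sum_i c (lift ord0 i) *: u i).
    rewrite scalerDr scalerA mulVf // scale1r scaler_sumr -sumrN; congr (_ + _).
    by apply: eq_bigr => i _; rewrite mulNr scaleNr opprK scalerA.
  exact: subZ.
move: hc; rewrite c0 scale0r add0r => /hu h i.
by case: (unliftP ord0 i) => [j ->|->].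
Qed.

Lemma indep_zero (S : subspace V) d (u : 'I_d -> V) : indep S u -> indep (zero_sub V) u.
Proof. by move=> h c /= e; apply: h; rewrite e; apply: sub0. Qed.

Lemma indep_cat (S : subspace V) d (u : 'I_d -> V) d' (u' : 'I_d' -> V) :
  indep S u -> (forall i, S (u' i)) -> indep (zero_sub V) u' ->
  indep (zero_sub V) (fun i : 'I_(d + d') => match split i with inl j => u j | inr j => u' j end).
Proof.
move=> hu hS hu' c; rewrite /= big_split_ord /=.
under eq_bigr do rewrite (unsplitK (inl _)).
under [X in _ + X]eq_bigr do rewrite (unsplitK (inr _)).
move=> e; have c0 : forall i, c (lshift d' i) = 0.
  apply: (hu (fun i => c (lshift d' i))).
  move/eqP: e; rewrite addr_eq0 => /eqP ->; apply/subN/sub_sum => i _.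
  exact: subZ.
move=> i; case: (split_ordP i) => j -> //.
apply: (hu' (fun i => c (rshift d i))) => /=.
by move: e; rewrite big1 ?add0r // => k _; rewrite c0 scale0r.
Qed.

(** A maximal family independent modulo S; by [steinitz] there is one. *)
Lemma basis_exists S A e (w : 'I_e -> V) :
  (forall x, A x -> span_mod S w x) ->
  exists d (u : 'I_d -> V), [/\ forall i, A (u i), indep S u & forall x, A x -> span_mod S u x].
Proof.
move=> hA; pose Q d := exists u : 'I_d -> V, (forall i, A (u i)) /\ indep S u.
have Q0 : `[< Q 0%N >] by apply/asboolP; exists (fun=> 0); split=> [[]|c _ []].
have bd d : `[< Q d >] -> (d <= e)%N.
  by move=> /asboolP [u [hu iu]]; apply: (steinitz iu) => i; apply: hA.
have [d /asboolP [u [hu iu]] hmax] := ex_maxnP (ex_intro (fun d => is_true `[< Q d >]) _ Q0) bd.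
exists d, u; split=> // x hx; apply: contrapT => nx.
have : `[< Q d.+1 >].
  apply/asboolP; exists (fcons x u); split; last exact: indep_cons.
  by move=> i; rewrite /fcons; case: unlift.
by move/hmax; rewrite ltnn.
Qed.
End Dimension.

(** ** Countable dimension *)

Section Countable.
Variable C : fieldType.

Definition comb (V : lmodType C) (e : nat -> V) k (c : nat -> C) : V := \sum_(i < k) c i *: e i.

(** Z / B has at most countable dimension. *)
Definition ctbl (V : lmodType C) (Z : V -> Prop) (B : subspace V) :=
  exists e : nat -> V, forall z, Z z -> exists k c, B (z - comb e k c).

Lemma comb_widen (V : lmodType C) (e : nat -> V) k l c : (k <= l)%N ->
  comb e k c = comb e l (fun i => if (i < k)%N then c i else 0).
Proof.
move=> /subnKC <-; rewrite /comb big_split_ord /= [X in _ + X]big1 ?addr0.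
  by apply: eq_bigr => i _; rewrite ltn_ord.
by move=> i _; rewrite ltnNge leq_addr scale0r.
Qed.

Lemma ctbl_mono (V : lmodType C) (Z Z' : V -> Prop) (B B' : subspace V) :
  (forall x, Z' x -> Z x) -> (forall x, B x -> B' x) -> ctbl Z B -> ctbl Z' B'.
Proof.
by move=> hZ hB [e he]; exists e => z /hZ/he [k [c /hB h]]; exists k, c.
Qed.

(** Two sequences that span together are interleaved. *)
Lemma ctbl_merge (V : lmodType C) (B : subspace V) (f g : nat -> V) (Z : V -> Prop) :
  (forall z, Z z -> exists k c l d, B (z - comb f k c - comb g l d)) -> ctbl Z B.
Proof.
move=> h; exists (fun i => if odd i then g i./2 else f i./2) => z /h [k [c [l [d hz]]]].
pose m := maxn k l; exists m.*2.
move: hz; rewrite (comb_widen f c (leq_maxl k l)) (comb_widen g d (leq_maxr k l)) -/m.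
move: (fun i => _) (fun i => _) => d' c' hz.
exists (fun i => if odd i then d' i./2 else c' i./2).
rewrite (_ : comb _ m.*2 _ = comb f m c' + comb g m d') ?opprD ?addrA //.
have combS (e : nat -> V) p b : comb e p.+1 b = comb e p b + b p *: e p.
  by rewrite /comb big_ord_recr.
elim: (m) => [|p ih]; first by rewrite /comb double0 !big_ord0 addr0.
rewrite doubleS !combS ih /= odd_double /= doubleK uphalf_double.
by rewrite -!addrA; congr (_ + _); rewrite addrCA.
Qed.

(** An extension of spaces of countable dimension has countable dimension; the
    projection to the quotient is given as a linear relation, as it will be
    the connecting map of a long exact sequence. *)
Lemma ctbl_ext (V W : lmodType C) (Z' A : V -> Prop) (B' : subspace V) (Z : W -> Prop)
  (B : subspace W) (R : V -> W -> Prop) :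
  (forall c p p', Z' p -> Z' p' -> Z' (c *: p + p')) ->
  (forall c p s p' s', R p s -> R p' s' -> R (c *: p + p') (c *: s + s')) ->
  (forall p, Z' p -> exists2 s, Z s & R p s) ->
  (forall p s, Z' p -> R p s -> B s -> exists2 a, A a & B' (p - a)) ->
  ctbl Z B -> ctbl A B' -> ctbl Z' B'.
Proof.
move=> Zlin Rlin hZ hA [e he] [g hg].
pose lead k x := exists s c, [/\ Z' x, R x s & B (s - comb e k c - e k)].
pose f k := if pselect (exists x, lead k x) is left h then sval (cid h) else 0.
have fP k x : lead k x -> lead k (f k).
  by move=> hx; rewrite /f; case: pselect => [h|[]]; [case: cid | exists x].
suff main k : forall p s c, Z' p -> R p s -> B (s - comb e k c) ->
    exists d a, A a /\ B' (p - comb f k d - a).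
  apply: (@ctbl_merge _ B' f g) => p hp.
  have [s hs hR] := hZ _ hp; have [k [c hc]] := he _ hs.
  have [d [a [ha hd]]] := main k p s c hp hR hc.
  have [l [b hb]] := hg _ ha; exists k, d, l, b.
  by apply: subB_trans hd hb.
elim: k => [|k ih] p s c hp hR hc.
  have [|a ha hB] := hA p s hp hR; first by move: hc; rewrite /comb big_ord0 subr0.
  by exists (fun=> 0), a; split=> //; rewrite /comb big_ord0 subr0.
move: hc; rewrite /comb big_ord_recr /= -/(comb e k c) opprD addrA => hc.
case: (eqVneq (c k) 0) => [ck0|ck].
  have [|d [a [ha hd]]] := ih p s c hp hR.
    by move: hc; rewrite ck0 scale0r subr0.
  exists (fun i => if (i < k)%N then d i else 0), a; split=> //.
  rewrite big_ord_recr /= ltnn scale0r addr0 (_ : \sum_(i < k) _ = comb f k d) //.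
  by apply: eq_bigr => i _; rewrite ltn_ord.
have hl : lead k (f k).
  apply: (fP k ((c k)^-1 *: p + 0)).
  have R0 : R (0 : V) (0 : W).
    have := Rlin (- 1) p s p s hR hR; by rewrite !scaleN1r !addNr.
  have Z0 : Z' 0 by have := Zlin (- 1) p p hp hp; rewrite scaleN1r addNr.
  exists ((c k)^-1 *: s + 0), (fun i => (c k)^-1 * c i); split.
  - exact: Zlin.
  - exact: Rlin.
  have -> : (c k)^-1 *: s + 0 - comb e k (fun i => (c k)^-1 * c i) - e k =
      (c k)^-1 *: (s - comb e k c - c k *: e k).
    rewrite addr0 !scalerBr scalerA mulVf // scale1r; congr (_ - _ - _).
    by rewrite /comb scaler_sumr; apply: eq_bigr => i _; rewrite scalerA.
  exact: subZ.
have [sk [ek [hZk hRk hBk]]] := hl.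
have [|||d [a [ha hd]]] := ih (- c k *: f k + p) (- c k *: sk + s) (fun i => c i - c k * ek i).
- exact: Zlin.
- exact: Rlin.
- have -> : - c k *: sk + s - comb e k (fun i => c i - c k * ek i) =
     (s - comb e k c - c k *: e k) - c k *: (sk - comb e k ek - e k).
    rewrite (_ : comb e k (fun i => c i - c k * ek i) = comb e k c - c k *: comb e k ek).
      rewrite !scalerBr scaleNr.
      move: (c k *: sk) (c k *: comb _ _ _) (c k *: e k) (comb e k c) => x y z w.
      by rewrite [- (x - y - z)]opprB addrA subrK !opprB addrA [RHS]addrA [RHS](ACl (4*1*3*2)).
    rewrite /comb scaler_sumr -sumrB; apply: eq_bigr => i _.
    by rewrite scalerBl scalerA.
  by apply: subB => //; apply: subZ.
exists (fun i => if (i < k)%N then d i else c k), a; split=> //.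
rewrite big_ord_recr /= ltnn (_ : \sum_(i < k) _ = comb f k d); last first.
  by apply: eq_bigr => i _; rewrite ltn_ord.
rewrite (_ : p - _ - a = - c k *: f k + p - comb f k d - a) //; congr (_ - a).
by rewrite scaleNr opprD addrA [RHS](ACl (2*3*1)).
Qed.
End Countable.

(** * Restricting a complex to a well-chosen point *)

(** ** Polynomials in one operator *)

Section PolyAct.
Variables (C : fieldType) (V : lmodType C) (y : {linear V -> V}).

Implicit Types g : {poly C}.

Definition pact (g : {poly C}) (v : V) := \sum_(i < size g) g`_i *: iter i y v.

Lemma pactwE k g v : (size g <= k)%N -> pact g v = \sum_(i < k) g`_i *: iter i y v.
Proof.
move=> /subnKC <-; rewrite big_split_ord /= [X in _ + X]big1 ?addr0 // => i _.
by rewrite nth_default ?scale0r // leq_addr.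
Qed.

Lemma pactP c g g' v : pact (c *: g + g') v = c *: pact g v + pact g' v.
Proof.
pose k := maxn (size (c *: g + g')) (maxn (size g) (size g')).
rewrite !(@pactwE k) ?leq_max ?leqnn ?orbT // scaler_sumr -big_split.
by apply: eq_bigr => i _; rewrite coefD coefZ scalerDl scalerA.
Qed.

Fact pact_linear_r g : linear (pact g).
Proof.
have iter_lin k c x z : iter k y (c *: x + z) = c *: iter k y x + iter k y z.
  by elim: k => //= k ->; rewrite linearP.
move=> c x z; rewrite scaler_sumr -big_split; apply: eq_bigr => i _.
by rewrite iter_lin scalerDr !scalerA mulrC.
Qed.
HB.instance Definition _ g := GRing.isLinear.Build C V V _ (pact g) (pact_linear_r g).

Lemma pactC c v : pact c%:P v = c *: v.
Proof. by rewrite (@pactwE 1) ?size_polyC_leq1 // big_ord1 coefC eqxx. Qed.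

Lemma pactMX g v : pact ('X * g) v = y (pact g v).
Proof.
rewrite (@pactwE (size g).+1) ?(leq_trans (size_polyMleq _ _)) ?size_polyX //.
rewrite big_ord_recl coefXM eqxx scale0r add0r linear_sum.
by apply: eq_bigr => i _; rewrite coefXM /= linearZ.
Qed.

Lemma pactXsub b g v : pact (('X - b%:P) * g) v = y (pact g v) - b *: pact g v.
Proof.
rewrite mulrBl mul_polyC addrC -scaleNr pactP pactMX scaleNr.
by rewrite addrC.
Qed.

Lemma pact_sum I (r : seq I) (F : I -> {poly C}) v :
  pact (\sum_(i <- r) F i) v = \sum_(i <- r) pact (F i) v.
Proof.
have p0 : pact 0 v = 0 by rewrite -[0]/(0%:P) pactC scale0r.
elim: r => [|i r ih]; first by rewrite !big_nil.
by rewrite !big_cons -ih -[F i]scale1r pactP !scale1r.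
Qed.

Lemma pactZ c g v : pact (c *: g) v = c *: pact g v.
Proof.
have p0 : pact 0 v = 0 by rewrite -[0]/(0%:P) pactC scale0r.
by rewrite -[c *: g]addr0 pactP p0 addr0.
Qed.

Lemma pact_sub (S : subspace V) g v :
  (forall w, S w -> S (y w)) -> S v -> S (pact g v).
Proof.
move=> hS hv; apply: sub_sum => i _; apply: subZ.
by elim: (val i) => //= k; apply: hS.
Qed.

Lemma pact_prod g b v :
  pact (g * ('X - b%:P)) v = pact g (y v - b *: v).
Proof.
elim/poly_ind: g => [|g c ih] in v *.
  by rewrite mul0r -[0]/(0%:P) !pactC !scale0r.
rewrite mulrDl (mulrC g) -mulrA.
have e (h1 h2 : {poly C}) w : pact (h1 + h2) w = pact h1 w + pact h2 w.
  by rewrite -[h1]scale1r pactP !scale1r.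
rewrite !e !pactMX ih pactC; congr (_ + _).
by rewrite mulrC pactXsub pactC linearZ /= scalerBr !scalerA (mulrC b).
Qed.

(** On eigenvectors modulo S a polynomial acts through its value. *)
Lemma pact_eigen (S : subspace V) b g v :
  (forall w, S w -> S (y w)) -> S (y v - b *: v) -> S (pact g v - g.[b] *: v).
Proof.
move=> hS hv; have /factor_theorem [q hq] : root (g - g.[b]%:P) b.
  by rewrite /root !hornerE subrr.
have -> : pact g v - g.[b] *: v = pact (g - (g.[b])%:P) v.
  by rewrite addrC -pactC -scaleN1r -pactP scaleN1r addrC.
by rewrite hq pact_prod; apply: pact_sub.
Qed.
End PolyAct.

(** ** The generic value of an operator on a space of countable dimension *)

(** If Z / B is spanned by a sequence, then each v b lies in the span of the first
    k terms for some k, and for each k there are at most k such b. *)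
Lemma countably_many (C : fieldType) (V : lmodType C) (Z : V -> Prop) (B : subspace V)
  (A : C -> Prop) (v : C -> V) :
  ctbl Z B -> (forall b, A b -> Z (v b)) ->
  (forall (s : seq C) (c : C -> C), uniq s -> (forall b, b \in s -> A b) ->
     B (\sum_(b <- s) c b *: v b) -> forall b, b \in s -> c b = 0) ->
  exists g : nat -> seq C, forall b, A b -> exists k, b \in g k.
Proof.
move=> [e he] hZ hind.
pose Ak k b := A b /\ exists c, B (v b - comb e k c).
suff fin k : exists s : seq C, forall b, Ak k b -> b \in s.
  exists (fun k => sval (cid (fin k))) => b hb.
  by have [k hk] := he _ (hZ _ hb); exists k; case: cid => s /= hs; apply: hs; split.
pose Q d := exists s : seq C, [/\ uniq s, size s = d & forall b, b \in s -> Ak k b].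
have Q0 : `[< Q 0%N >] by apply/asboolP; exists [::].
have bd d : `[< Q d >] -> (d <= k)%N.
  move=> /asboolP [s [us <- hs]].
  apply: (@steinitz _ _ B _ _ (fun i : 'I_(size s) => v (nth 0 s i)) (fun i : 'I_k => e i)).
    move=> c hc i.
    have := hind s (fun b => nth 0 [seq c i | i <- enum 'I_(size s)] (index b s)) us
      (fun b hb => (hs b hb).1).
    have nthc (j : 'I_(size s)) :
        nth 0 [seq c i | i <- enum 'I_(size s)] (index (nth 0 s j) s) = c j.
      rewrite index_uniq // (nth_map j) ?nth_ord_enum ?size_enum_ord //.
    rewrite (big_nth 0) big_mkord.
    move=> /(_ _ (nth 0 s i) (mem_nth 0 (ltn_ord i))); rewrite nthc; apply.
    by under eq_bigr do rewrite nthc.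
  move=> i; have [_ [c hc]] := hs _ (mem_nth 0 (ltn_ord i)).
  by exists (fun j => c j).
have [d /asboolP [s [us sd hs]] hmax] := ex_maxnP (ex_intro (fun d => is_true `[< Q d >]) _ Q0) bd.
exists s => b hb; apply: contraT => nb.
have : `[< Q d.+1 >].
  apply/asboolP; exists (b :: s); split; rewrite /= ?nb ?sd // => b'.
  by rewrite inE => /orP[/eqP ->|/hs].
by move/hmax; rewrite ltnn.
Qed.

Section GenericValue.
Variables (C : closedFieldType) (V : lmodType C).
Hypothesis uncountable : forall g : nat -> seq C, exists b, forall k, b \notin g k.
Variables (Z B : subspace V) (y E : {linear V -> V}).
Hypotheses (yZ : forall v, Z v -> Z (y v)) (yB : forall v, B v -> B (y v)).
Hypothesis Ey : forall v, E (y v) = y (E v).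
Hypothesis hctbl : ctbl Z B.

Lemma Bpact g v : B v -> B (pact y g v).
Proof. exact: pact_sub. Qed.

Lemma pact_E g v : E (pact y g v) = pact y g (E v).
Proof.
rewrite linear_sum; apply: eq_bigr => i _; rewrite linearZ /=; congr (_ *: _).
by elim: (val i) => //= k <-.
Qed.

(** Over an algebraically closed field a polynomial in y splits into factors
    y - b, which can be cancelled one at a time. *)
Lemma torsion_free :
  (forall b p, Z p -> B (E p) -> B (y p - b *: p) -> B p) ->
  forall g p, g != 0 -> Z p -> B (E p) -> B (pact y g p) -> B p.
Proof.
move=> h g p g0 hp hE; have [r ->] := closed_field_poly_normal g.
rewrite pactZ => /(subZ (lead_coef g)^-1).
rewrite scalerA mulVf ?lead_coef_eq0 // scale1r.
elim: r => [|b r ih]; first by rewrite big_nil -[1]/(1%:P) pactC scale1r.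
rewrite big_cons pactXsub => hb; apply: ih; apply: (h b) => //.
  exact: pact_sub.
by rewrite pact_E; apply: Bpact.
Qed.

(** Either some nonzero class killed by E is an eigenvector of y, or y behaves
    like a free variable: for b outside a countable set y - b is injective and p0
    is not a multiple of y - b. Indeed eigenvectors for distinct eigenvalues are
    independent, and so are the quotients p0 / (y - b), by partial fractions. *)
Lemma generic_value p0 : Z p0 -> ~ B p0 -> B (E p0) ->
  (exists b p, [/\ Z p, ~ B p, B (E p) & B (y p - b *: p)]) \/
  exists b, (forall s, Z s -> B (y s - b *: s) -> B s) /\
    ~ exists2 w, Z w & B (p0 - (y w - b *: w)).
Proof.
move=> Zp nBp BEp.
case: (pselect (exists b p, [/\ Z p, ~ B p, B (E p) & B (y p - b *: p)])) => [|no]; first by left.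
right; have {}no b p : Z p -> B (E p) -> B (y p - b *: p) -> B p.
  by move=> h1 h2 h3; apply: contrapT => h4; apply: no; exists b, p.
have tf := torsion_free no.
pose A1 b := exists s, [/\ Z s, ~ B s & B (y s - b *: s)].
pose A2 b := exists2 w, Z w & B (p0 - (y w - b *: w)).
pose pr (s : seq C) : {poly C} := \prod_(b <- s) ('X - b%:P).
have pr0 (s : seq C) b : b \in s -> (pr s).[b] = 0.
  by move=> hb; apply/rootP; rewrite root_prod_XsubC.
have prn0 (s : seq C) b : b \notin s -> (pr s).[b] != 0.
  by move=> hb; apply: contra hb => /eqP/rootP; rewrite root_prod_XsubC.
have [g1 hg1] : exists g : nat -> seq C, forall b, A1 b -> exists k, b \in g k.
  pose v b := if pselect (A1 b) is left h then sval (cid h) else 0.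
  have vP b : A1 b -> [/\ Z (v b), ~ B (v b) & B (y (v b) - b *: v b)].
    by move=> hb; rewrite /v; case: pselect => // h; case: cid.
  apply: (countably_many (v := v) hctbl) => [b /vP[]//|s c us hs hB b hb].
  have [_ nb _] := vP b (hs _ hb); apply: contra_notP nb => /eqP cb.
  have := Bpact (pr (rem b s)) hB; rewrite linear_sum => h1.
  pose t := \sum_(b' <- s) c b' *: ((pr (rem b s)).[b'] *: v b').
  have ht : B t.
    apply/(subBK _ h1)/subBC; rewrite -sumrB big_seq; apply: sub_sum => b' hb'.
    rewrite linearZ -scalerBr; apply: subZ; apply: pact_eigen => //.
    by have [] := vP _ (hs _ hb').
  move: ht; rewrite /t (big_rem b) //= big_seq big1 => [|b' hb'].
    rewrite addr0 scalerA => /(subZ (c b * (pr (rem b s)).[b])^-1).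
    rewrite scalerA mulVf ?scale1r // mulf_neq0 // prn0 //.
    by rewrite mem_rem_uniq // inE eqxx.
  by rewrite pr0 // scale0r scaler0.
have [g2 hg2] : exists g : nat -> seq C, forall b, A2 b -> exists k, b \in g k.
  pose v b := if pselect (A2 b) is left h then s2val (cid2 h) else 0.
  have vP b : A2 b -> Z (v b) /\ B (p0 - (y (v b) - b *: v b)).
    by move=> hb; rewrite /v; case: pselect => // h; case: cid2.
  apply: (countably_many (v := v) hctbl) => [b /vP[]//|s c us hs hB b hb].
  pose g := \sum_(b' <- s) c b' *: pr (rem b' s).
  have hg : B (pact y g p0).
    have := Bpact (pr s) hB; rewrite linear_sum => h1.
    apply/(subBK _ h1)/subBC; rewrite /g pact_sum -sumrB big_seq.
    apply: sub_sum => b' hb'; rewrite pactZ linearZ -scalerBr; apply: subZ.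
    have -> : pr s = pr (rem b' s) * ('X - b'%:P).
      by rewrite /pr (big_rem b') //= mulrC.
    rewrite /= pact_prod -linearB; apply: Bpact; apply: subBC.
    by have [] := vP _ (hs _ hb').
  apply/eqP; apply: contra_notT nBp => cb; apply: tf hg => //.
  apply: contraTneq (cb) => g0; rewrite negbK.
  have : g.[b] = 0 by rewrite g0 horner0.
  rewrite /g horner_sum (big_rem b) //= big_seq big1 => [|b' hb']; last first.
    rewrite hornerZ pr0 ?mulr0 // mem_rem_uniq // inE hb andbT.
    by apply: contraTneq hb' => ->; rewrite mem_rem_uniq // inE eqxx.
  rewrite addr0 hornerZ => /eqP; rewrite mulf_eq0 => /orP[] // /negPn/negP[].
  by rewrite prn0 // mem_rem_uniq // inE eqxx.
have [b hb] := uncountable (fun k => g1 k ++ g2 k); exists b; split.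
  move=> s hs hB; apply: contrapT => nB.
  have [|k hk] := hg1 b; first by exists s.
  by have := hb k; rewrite mem_cat hk.
by move=> /hg2 [k hk]; have := hb k; rewrite mem_cat hk orbT.
Qed.
End GenericValue.

Section PointIdeal.
Variables (C : fieldType) (V : lmodType C) (Y : nat -> {linear V -> V}).

Definition psub k (b : C) (p : V) : V := Y k p - b *: p.
Fact psub_linear k b : linear (psub k b).
Proof.
move=> c p q; rewrite /psub linearP scalerBr scalerDr !scalerA (mulrC b) opprD.
by rewrite addrACA.
Qed.
HB.instance Definition _ k b := GRing.isLinear.Build C V V _ (psub k b) (psub_linear k b).

(** The sum of the images of the Y_k - b_k, where b_k is the entry of s that
    is followed by k entries: the coordinates of a point are prepended one
    after the other. *)
Fixpoint ptI (s : seq C) : subspace V :=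
  if s is b :: s' then add_im_sub (ptI s') (psub (size s') b) else zero_sub V.
End PointIdeal.

Section Restriction.
Variable C : closedFieldType.
Variables (P : nat -> lmodType C) (d : forall l, {linear P l.+1 -> P l}).
Variables (Y : forall l, nat -> {linear P l -> P l}) (E : forall l, {linear P l -> P l}).
Hypothesis dd : forall l p, d l (d l.+1 p) = 0.
Hypothesis Yd : forall l k p, d l (Y l.+1 k p) = Y l k (d l p).
Hypothesis YY : forall l k k' p, Y l k (Y l k' p) = Y l k' (Y l k p).
Hypothesis Ed : forall l p, d l (E l.+1 p) = E l (d l p).
Hypothesis EY : forall l k p, E l (Y l k p) = Y l k (E l p).

Local Notation ysub := (psub (Y _)).
Local Notation inI l s := (ptI (Y l) s).

Lemma ysub_d l k b p : d l (ysub k b p) = ysub k b (d l p).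
Proof. by rewrite /psub linearB linearZ /= Yd. Qed.
Lemma ysub_E l k b p : E l (ysub k b p) = ysub k b (E l p).
Proof. by rewrite /psub linearB linearZ /= EY. Qed.
Lemma ysub_Y l k b k' p : Y l k' (ysub k b p) = ysub k b (Y l k' p).
Proof. by rewrite /psub linearB linearZ /= YY. Qed.

Variable n : nat.
Hypothesis regular_seq : forall l s b w, (size s < n)%N ->
  inI l s (ysub (size s) b w) -> inI l s w.

Lemma inI_d l s p : inI l.+1 s p -> inI l s (d l p).
Proof.
elim: s p => [|b s ih] p; first by move=> /= ->; rewrite linear0.
exact: (add_im_stable (h' := d l) ih (fun w => ysub_d (size s) b w)).
Qed.
Lemma inI_E l s p : inI l s p -> inI l s (E l p).
Proof.
elim: s p => [|b s ih] p; first by move=> /= ->; rewrite linear0.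
exact: (add_im_stable (h' := E l) ih (fun w => ysub_E (size s) b w)).
Qed.
Lemma inI_Y l s k p : inI l s p -> inI l s (Y l k p).
Proof.
elim: s p => [|b s ih] p; first by move=> /= ->; rewrite linear0.
exact: (add_im_stable (h' := Y l k) ih (fun w => ysub_Y (size s) b k w)).
Qed.

(** Cycles and boundaries of the complex P / (Y_k - b_k). *)
Definition cyc_pred l (s : seq C) : P l -> Prop :=
  match l with 0%N => fun=> True | l'.+1 => fun p => inI l' s (d l' p) end.
Fact cyc0 l s : @cyc_pred l s 0.
Proof. by case: l => //= l; rewrite linear0; apply: sub0. Qed.
Fact cyc_lin l s c x y : @cyc_pred l s x -> @cyc_pred l s y -> @cyc_pred l s (c *: x + y).
Proof. by case: l x y => //= l x y; rewrite linearP; apply: sub_lin. Qed.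
Definition cyc l s : subspace (P l) := Subspace (cyc0 l s) (@cyc_lin l s).
Definition bnd l s : subspace (P l) := add_im_sub (inI l s) (d l).

Lemma cyc_Y l s k p : cyc l s p -> cyc l s (Y l k p).
Proof. by case: l p => //= l p; rewrite Yd; apply: inI_Y. Qed.
Lemma bnd_E l s p : bnd l s p -> bnd l s (E l p).
Proof.
exact: (add_im_stable (h' := E l.+1) (@inI_E l s) (fun w => esym (Ed w))).
Qed.
Lemma bnd_Y l s k p : bnd l s p -> bnd l s (Y l k p).
Proof.
exact: (add_im_stable (h' := Y l.+1 k) (@inI_Y l s k) (fun w => esym (Yd k w))).
Qed.

Section Step.
Variables (s : seq C) (b : C).
Hypothesis hs : (size s < n)%N.
Local Notation y := (ysub (size s) b).

Lemma cyc_mono l p : cyc l s p -> cyc l (b :: s) p.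
Proof. by case: l p => //= l p h; apply: add_im_l. Qed.
Lemma bnd_mono l p : bnd l s p -> bnd l (b :: s) p.
Proof. by move=> [w hw]; exists w; apply: add_im_l. Qed.
Lemma bnd_y l p : bnd l (b :: s) (y p : P l).
Proof. by apply: add_im_l; apply: add_im_r. Qed.

(** The long exact sequence of multiplication by Y_k - b on the complex
    P / (Y_0 - b_0, .., Y_(k-1) - b_(k-1)). *)
Lemma connecting l p : cyc l.+1 (b :: s) p ->
  exists2 w, cyc l s w & inI l s (d l p - y w).
Proof.
move=> [w hw]; exists w => //; case: l p w hw => //= l p w hw.
apply: (@regular_seq _ _ b) => //; rewrite -ysub_d.
by have := inI_d hw; rewrite linearB /= dd sub0r => /subN; rewrite opprK.
Qed.

Lemma connecting_bnd l p w : inI l s (d l p - y w) -> bnd l s w ->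
  exists2 z, cyc l.+1 s z & bnd l.+1 (b :: s) (p - z).
Proof.
move=> h [u hu]; exists (p - y u).
  rewrite /= linearB /= ysub_d.
  apply: subB_trans h _; rewrite -linearB.
  have : forall x, inI l s x -> inI l s (y x) by move=> x hx; apply: subB; [apply: inI_Y | apply: subZ].
  exact.
by rewrite opprB addrCA subrr addr0; apply: bnd_y.
Qed.

Lemma bnd_cyc l z : cyc l s z -> bnd l (b :: s) z ->
  exists2 w, cyc l s w & bnd l s (z - y w).
Proof.
move=> hz [u [w hw]]; exists w; last by exists u; rewrite addrAC.
case: l z hz u w hw => //= l z hz u w hw.
apply: (@regular_seq _ _ b) => //; rewrite -ysub_d.
have := inI_d hw; rewrite 2!linearB /= dd subr0 => h.
have hz' : inI l s (d l z) := hz.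
exact: subBK (subBC h) hz'.
Qed.

Lemma ctbl_step l : (forall k, ctbl (cyc k s) (bnd k s)) ->
  ctbl (cyc l (b :: s)) (bnd l (b :: s)).
Proof.
case: l => [|l] hc.
  by apply: ctbl_mono (hc 0%N) => // x; apply: bnd_mono.
apply: (@ctbl_ext _ _ _ _ (cyc l.+1 s) _ (cyc l s) (bnd l s)
  (fun p w => inI l s (d l p - y w))).
- by move=> *; apply: sub_lin.
- move=> c p w p' w' h1 h2; rewrite [d l _]linearP [ysub _ _ _]linearP opprD addrACA.
  by rewrite -scalerBr; apply: sub_lin.
- by move=> p; apply: connecting.
- by move=> p w _; apply: connecting_bnd.
- exact: hc.
by apply: ctbl_mono (hc l.+1) => // x; apply: bnd_mono.
Qed.
End Step.

(** After restricting to the point s: the homology vanishes above degree r, in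
    degree r there is a nonzero class killed by E, and all homology has
    countable dimension. *)
Definition state (s : seq C) r :=
  [/\ forall k p, (r < k)%N -> cyc k s p -> bnd k s p,
      exists p, [/\ cyc r s p, ~ bnd r s p & bnd r s (E r p)]
    & forall k, ctbl (cyc k s) (bnd k s)].

Hypothesis uncountable : forall g : nat -> seq C, exists b, forall k, b \notin g k.

(** Each coordinate is restricted either to an eigenvalue, which raises the
    degree of the top class, or to a generic value, which keeps it. *)
Lemma state_step s r : (size s < n)%N -> state s r -> exists b r', state (b :: s) r'.
Proof.
move=> hs [hvan [p0 [Zp nBp BEp]] hc].
have [[b [p [hZ nB BE By]]]|[b [inj nb]]] := generic_value uncountable
  (@cyc_Y r s (size s)) (@bnd_Y r s (size s)) (fun v => EY (size s) v)
  (hc r) Zp nBp BEp.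
  exists b, r.+1; split; last by move=> k; apply: ctbl_step.
    move=> [//|k] q hk hq; have [w hw hqw] := connecting hs hq.
    have [z hz hqz] := connecting_bnd hqw (hvan _ _ hk hw).
    by apply: subBK hqz _; apply/bnd_mono/hvan => //; apply: ltnW.
  have [w hw] : bnd r s (ysub (size s) b p) := By.
  have hIw : inI r s (d r w - ysub (size s) b p) by apply: subBC.
  exists w; split.
  - by exists p.
  - move=> [w2 [w1 hw1]].
    have h1 := inI_d hw1; rewrite 2!linearB /= dd subr0 ysub_d in h1.
    have h2 : inI r s (ysub (size s) b (p - d r w1)).
      by rewrite linearB; apply: subB_trans (subBC hIw) h1.
    by case: nB; exists w1; apply: regular_seq h2.
  have [w2 hw2] := BE.
  have h3 : inI r s (d r (E r.+1 w - ysub (size s) b w2)).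
    rewrite linearB /= Ed ysub_d.
    apply: (@subB_trans _ _ _ (ysub (size s) b (E r p))).
      by rewrite -ysub_E -linearB; apply: inI_E.
    by rewrite -linearB; apply: subB; [apply: inI_Y | apply: subZ].
  have := hvan r.+1 _ (leqnn _) h3.
  by move=> /(bnd_mono b) h4; apply: subBK h4 _; apply: bnd_y.
exists b, r; split; last by move=> k; apply: ctbl_step.
  move=> [//|k] q hk hq; have [w hw hqw] := connecting hs hq.
  have hbw : bnd k s w.
    move: hk; rewrite ltnS leq_eqVlt => /orP[/eqP e|hk]; last exact: hvan.
    subst r; apply: inj => //; have : bnd k s (ysub (size s) b w); last by [].
    by exists q; apply: subBC.
  have [z hz hqz] := connecting_bnd hqw hbw.
  by apply: subBK hqz _; apply/bnd_mono/hvan.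
exists p0; split; first exact: cyc_mono.
  move=> hb; have [w hw hb'] := bnd_cyc hs Zp hb.
  by apply: nb; exists w.
exact: bnd_mono.
Qed.

(** Starting from the unrestricted complex, the coordinates are treated one by one. *)
Lemma state_full r : state [::] r -> exists s r', size s = n /\ state s r'.
Proof.
move=> h0; suff : forall k, (k <= n)%N -> exists s r', size s = k /\ state s r' by apply.
elim=> [|k ih] hk; first by exists [::], r.
have [s [r' [es hst]]] := ih (ltnW hk).
have [|b [r'' h]] := state_step _ hst; first by rewrite es.
by exists (b :: s), r''; rewrite /= es.
Qed.
End Restriction.

(** * Free D-modules at a point *)

Section Specialize.
Variables (C : fieldType) (m : nat).
Local Notation S := {mpoly C[m]}.

Definition specialize (k : 'I_m) (b : C) : {rmorphism S -> S} :=
  mmap (@mpolyC m C) (fun j => if j == k then b%:MP else 'X_j).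

Lemma specializeX k b j : specialize k b 'X_j = if j == k then b%:MP else 'X_j.
Proof. by rewrite /specialize /= mmapX mmap1U. Qed.
Lemma specializeC k b c : specialize k b c%:MP = c%:MP.
Proof. by rewrite /specialize /= mmapC. Qed.

Lemma mpoly_ring_ind (Q : S -> Prop) :
  (forall c, Q c%:MP) -> (forall j, Q 'X_j) ->
  (forall f g, Q f -> Q g -> Q (f + g)) -> (forall f g, Q f -> Q g -> Q (f * g)) ->
  forall f, Q f.
Proof.
move=> QC QX QD QM f; have Q0 : Q 0 by rewrite -mpolyC0.
have Q1 : Q 1 by rewrite -mpolyC1.
rewrite [f]mpolyE; apply: (big_ind Q) => // al _.
rewrite -mul_mpolyC; apply: (QM) => //; rewrite mpolyXE_id.
apply: (big_ind Q) => // i _.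
by elim: (al i) => [|p ih]; rewrite ?expr0 // exprS; apply: (QM).
Qed.

(** Substituting b for a variable is reduction modulo X_k - b. *)
Lemma specialize_sub k b f : exists g, f - specialize k b f = ('X_k - b%:MP) * g.
Proof.
apply: (mpoly_ring_ind (Q := fun f => exists g, f - specialize k b f = ('X_k - b%:MP) * g)).
- by move=> c; exists 0; rewrite specializeC subrr mulr0.
- move=> j; rewrite specializeX; case: eqP => [->|_]; last by exists 0; rewrite subrr mulr0.
  by exists 1; rewrite mulr1.
- move=> f1 f2 [g1 h1] [g2 h2]; exists (g1 + g2).
  by rewrite rmorphD mulrDr -h1 -h2 opprD addrACA.
move=> f1 f2 [g1 h1] [g2 h2]; exists (f1 * g2 + g1 * specialize k b f2).
rewrite rmorphM mulrDr mulrCA -h2 mulrA -h1 mulrBr mulrBl.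
by rewrite addrA subrK.
Qed.
End Specialize.

Section Point.
Variables (C : fieldType) (n : nat).
Local Notation N := n.+1.
Local Notation S := {mpoly C[N + N]}.

(** The coordinates other than the first one, counted from 0, and zero for k >= n. *)
Definition Yop (M : dmodule C N) k : {linear M -> M} :=
  if insub k is Some j then dX M (lift ord0 (j : 'I_n)) else \0.

Lemma Yop_dhom (M M' : dmodule C N) (f : {linear M -> M'}) k m :
  is_dhom f -> f (Yop M k m) = Yop M' k (f m).
Proof.
move=> hf; rewrite /Yop; case: insubP => [j _ _|_] /=; last by rewrite linear0.
exact: (hf (inl _)).
Qed.
Lemma Yop_comm (M : dmodule C N) k k' m : Yop M k (Yop M k' m) = Yop M k' (Yop M k m).
Proof.
rewrite /Yop; case: (insub k) => [j|] /=; case: (insub k') => [j'|] //=.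
- exact: dXX.
- by rewrite linear0.
by rewrite linear0.
Qed.
Lemma Yop_D0 (M : dmodule C N) k m : dD M ord0 (Yop M k m) = Yop M k (dD M ord0 m).
Proof.
rewrite /Yop; case: insubP => [j _ _|_] /=; last by rewrite linear0.
by rewrite dDX scale0r addr0.
Qed.

Lemma ptI_map (V W : lmodType C) (Y : nat -> {linear V -> V}) (Y' : nat -> {linear W -> W})
  (f : {linear V -> W}) s v :
  (forall k v, f (Y k v) = Y' k (f v)) -> ptI Y s v -> ptI Y' s (f v).
Proof.
move=> h; elim: s v => [|b s ih] v; first by move=> /= ->; rewrite linear0.
by apply: (add_im_stable (h' := f) ih) => w; rewrite /psub linearB linearZ /= h.
Qed.

(** Evaluation of a normally ordered symbol at the point with coordinates s. *)
Fixpoint theta (s : seq C) : {rmorphism S -> S} :=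
  if s is b :: s' then
    if insub (size s') is Some j then
      (specialize (lshift N (lift ord0 (j : 'I_n))) b \o theta s' : {rmorphism S -> S})
    else theta s'
  else (idfun : {rmorphism S -> S}).

Lemma theta_cons b s (j : 'I_n) f : size s = j ->
  theta (b :: s) f = specialize (lshift N (lift ord0 j)) b (theta s f).
Proof. by move=> /= ->; rewrite valK. Qed.

Lemma thetaC s c : theta s c%:MP = c%:MP.
Proof.
by elim: s => //= b s ih; case: insubP => [j _ _|_] //=; rewrite ih ?specializeC.
Qed.
Lemma thetaZ s c f : theta s (c *: f) = c *: theta s f.
Proof. by rewrite -!mul_mpolyC rmorphM /= thetaC. Qed.

Lemma theta_X0 s : theta s 'X_(lshift N ord0) = 'X_(lshift N ord0).
Proof.
elim: s => //= b s ih; case: insubP => [j _ _|_] //=.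
by rewrite ih specializeX (inj_eq (@lshift_inj _ _)).
Qed.

Lemma theta_XY s (j : 'I_n) : (size s <= n)%N ->
  theta s 'X_(lshift N (lift ord0 j)) =
  if (j < size s)%N then (nth 0 (rev s) j)%:MP else 'X_(lshift N (lift ord0 j)).
Proof.
elim: s => //= b s ih hs; have {}ih := ih (ltnW hs).
rewrite (insubT (fun k => k < n)%N hs) /= ih rev_cons nth_rcons size_rev ltnS.
case: (ltngtP j (size s)) => hj.
- by rewrite specializeC.
- rewrite specializeX (inj_eq (@lshift_inj _ _)) (inj_eq lift_inj) -val_eqE /=.
  by rewrite (gtn_eqF hj).
- by rewrite specializeX (inj_eq (@lshift_inj _ _)) (inj_eq lift_inj) -val_eqE /= hj eqxx.
Qed.

Lemma psub_weyl (j : 'I_n) b (f : weyl C N) :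
  psub (Yop (weyl C N)) j b f = ('X_(lshift N (lift ord0 j)) - b%:MP) * f.
Proof. by rewrite /psub /Yop valK /= /weyl_X mulrBl mul_mpolyC. Qed.

Lemma ptI_sub_theta s (f : S) : (size s <= n)%N ->
  ptI (Yop (weyl C N)) s (f - theta s f).
Proof.
elim: s => [|b s ih] hs; first by rewrite /= subrr.
pose j := Ordinal hs; rewrite (@theta_cons b s j) //.
have [g hg] := specialize_sub (lshift N (lift ord0 j)) b (theta s f).
apply: (@subB_trans _ _ _ (theta s f)); first by apply/add_im_l/ih/ltnW.
by rewrite hg -(psub_weyl j); apply: add_im_r.
Qed.

Lemma ptI_theta0 s (f : weyl C N) : (size s <= n)%N ->
  ptI (Yop (weyl C N)) s f -> theta s f = 0.
Proof.
elim: s f => [//|b s ih] f hs [w hw]; pose j := Ordinal hs.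
have e : (size s : nat) = j by [].
have := ih _ (ltnW hs) hw; rewrite [X in f - X](_ : _ = ('X_(lshift N (lift ord0 j)) - b%:MP) * w); last exact: (psub_weyl j).
rewrite rmorphB rmorphM rmorphB /= thetaC theta_XY ?(ltnW hs) // ltnn (theta_cons b f e) => /subr0_eq ->.
by rewrite rmorphM rmorphB /= specializeX eqxx specializeC subrr mul0r.
Qed.

Section FreePoint.
Variables (P : dmodule C N) (I : Type) (e : I -> P).
Hypothesis free_e : forall (M : dmodule C N) (v : I -> M),
  exists h : {linear P -> M},
    [/\ is_dhom h, forall i, h (e i) = v i
      & forall h' : {linear P -> M},
          is_dhom h' -> (forall i, h' (e i) = v i) -> h' =1 h].

(** The coordinates of p on a basis are symbols, written with the functions on the
    left; hence membership in the sum of the images of the Y_k - b_k is tested by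
    substituting the b_k in them. *)
Lemma ptI_freeP s p : (size s <= n)%N ->
  (forall i, theta s (free_coord free_e i p) = 0) <-> ptI (Yop P) s p.
Proof.
move=> hs; split=> [h|h i]; last first.
  apply: ptI_theta0 => //; apply: ptI_map h => k v.
  exact/Yop_dhom/free_coord_dhom.
have [r ->] := free_decomp free_e p; apply: sub_sum => i _.
have := ptI_sub_theta (free_coord free_e i p) hs; rewrite h subr0.
pose ev : {linear weyl C N -> P} := opactl (wl P) (e i).
by apply: (ptI_map (f := ev)) => k v; apply: Yop_dhom => t w; apply: wop_dop.
Qed.

(** Shifted by constants, the coordinates other than the first one form a regular
    sequence on a free module, because {mpoly C[m]} has no zero divisors. *)
Lemma free_regular s b w : (size s < n)%N ->
  ptI (Yop P) s (psub (Yop P) (size s) b w) -> ptI (Yop P) s w.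
Proof.
move=> hs /(ptI_freeP _ (ltnW hs)) h; apply/(ptI_freeP _ (ltnW hs)) => i.
have := h i; pose j := Ordinal hs.
have -> : free_coord free_e i (psub (Yop P) (size s) b w) =
    psub (Yop (weyl C N)) (size s) b (free_coord free_e i w).
  rewrite /psub linearB linearZ /= (Yop_dhom _ _ (free_coord_dhom free_e i)).
  by [].
have ej : (size s : nat) = j by [].
rewrite ej psub_weyl rmorphM rmorphB /= thetaC theta_XY ?(ltnW hs) // ltnn.
move/eqP; rewrite mulf_eq0 => /orP[] /eqP // /(congr1 (mcoeff U_(lshift N (lift ord0 j)))).
rewrite mcoeffB mcoeffXU eqxx mcoeffC mcoeff0 mnm1_eq0 mulr0 subr0 => /eqP.
by rewrite oner_eq0.
Qed.
End FreePoint.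
End Point.

(** ** The pull-back of a free module to a line *)

Section TensorKernel.
Variables (C : fieldType) (n : nat).
Local Notation N := n.+1.
Local Notation F := {fraction {mpoly C[N + N]}}.
Variables (K : comUnitAlgType C) (io : {rmorphism K -> F}).
Hypothesis ioC : forall c, io c%:A = tofrac (c%:MP : {mpoly C[N + N]}).
Variables (P : dmodule C N) (g h : 'M[C]_N) (hgh : g *m h = 1%:M).
Variables (phi : 'I_N -> K) (s : seq C).
Hypothesis io_phi : forall i, io (phi i) = tofrac (theta n s (\sum_k h i k *: 'X_(lshift N k))).

(** The coordinates of p, restricted to the line, define a balanced map into a
    field, so they vanish when 1 (x) p does. *)
Lemma tensor_kernel (T : zmodType) (t : K -> P -> T) p :
  is_free P -> size s = n -> is_tensor (fun i u => phi i * u) (dX P) t ->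
  t 1 p = 0 -> ptI (Yop (twist P hgh)) s p.
Proof.
move=> hP hs [[tD _ _ _] ht] tp0.
have [I [e free_e]] := twist_free hgh hP.
apply/(ptI_freeP free_e); first by rewrite hs.
move=> i; pose la := free_coord free_e i; pose b (u : K) (q : P) : F := io u * tofrac (theta n s (la q)).
have hb : balanced (fun i u => phi i * u) (dX P) b.
  split=> [u u' v|u v v'|c u v|k u v]; rewrite /b.
  - by rewrite rmorphD mulrDl.
  - by rewrite [la _]linearD !rmorphD mulrDr.
  - have laZ : la (c *: v) = c *: la v by rewrite linearZ.
    rewrite -mulr_algl rmorphM /= ioC laZ thetaZ -mul_mpolyC rmorphM /=.
    by rewrite mulrCA mulrA.
  rewrite rmorphM /= io_phi mulrAC mulrC; congr (_ * _).
  rewrite -tofracM -rmorphM /=; congr (tofrac (theta n s _)).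
  rewrite -(lcomb_comp (dX P) _ _ (mulmx1C hgh)) linear_sum mulr_suml.
  apply: eq_bigr => l _; rewrite linearZ -scalerAl; congr (_ *: _).
  by rewrite (free_coord_dhom free_e i (inl l)).
have [f [hf _]] := ht _ _ hb.
have : f (t 1 p) = 0 by rewrite tp0 raddf0.
rewrite hf /b rmorph1 mul1r => /eqP; rewrite tofrac_eq0 => /eqP.
exact.
Qed.
End TensorKernel.

(** * The projective line and the exponential at infinity *)

Lemma frac_exists (R : idomainType) (x : {fraction R}) :
  exists a b : R, b != 0 /\ x = tofrac a / tofrac b.
Proof.
elim/quotW: x => x; exists \n_x, \d_x; split; first exact: denom_ratioP.
apply: (canRL (mulfK _)); first by rewrite tofrac_eq0 denom_ratioP.
rewrite -[LHS]/(FracField.mul _ _) /tofrac; unlock FracField.tofrac.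
rewrite -[LHS]FracField.pi_mul; apply/eqmodP; rewrite /= FracField.equivfE /FracField.mulf.
by rewrite !numden_Ratio ?mulf_neq0 ?oner_eq0 ?denom_ratioP // !mulr1 mulrC.
Qed.

Lemma quotient_rule_field (F : fieldType) (a b n d a' b' n' d' : F) :
  b != 0 -> d != 0 -> a * d = n * b -> a' * d + a * d' = n' * b + n * b' ->
  (n' * d - n * d') / d ^+ 2 = (a' * b - a * b') / b ^+ 2.
Proof.
move=> b0 d0 e1 e2; have e3 : a' * d = n' * b + n * b' - a * d' by rewrite -e2 addrK.
have h1 : (n' * d - n * d') * b ^+ 2 = (a' * b - a * b') * d ^+ 2.
  have -> : (a' * b - a * b') * d ^+ 2 = (a' * d) * b * d - (a * d) * b' * d by ring.
  have -> : a' * d * b * d = (n' * b + n * b') * b * d - (a * d) * d' * b by rewrite e3; ring.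
  by rewrite e1; ring.
apply: (mulfI (mulf_neq0 (expf_neq0 2 d0) (expf_neq0 2 b0))).
transitivity ((n' * d - n * d') * b ^+ 2); first by field.
by rewrite h1; field.
Qed.

Lemma size_sub_lead (F : fieldType) (p q : {poly F}) :
  (size p <= size q)%N -> q != 0 -> (size (p - (p`_(size q).-1 / lead_coef q)%:P * q)%R <= (size q).-1)%N.
Proof.
move=> hpq q0; have hq : (0 < size q)%N by rewrite size_poly_gt0.
apply/leq_sizeP => j; rewrite leq_eqVlt coefB coefCM => /orP[/eqP <-|hj].
  by rewrite -/(lead_coef q) divfK ?lead_coef_eq0 // subrr.
have hj' : (size q <= j)%N by rewrite -(prednK hq).
by rewrite (nth_default 0 hj') mulr0 subr0 nth_default // (leq_trans hpq).
Qed.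

Section RatFun.
Variable C : fieldType.

(** The field of rational functions, kept opaque so that unification never
    unfolds its construction. *)
Fact ratfun_sig : {F : fieldType & {f : {rmorphism {poly C} -> F} |
  injective f /\ forall h, exists a b, b != 0 /\ h = f a / f b}}.
Proof.
exists {fraction {poly C}}, (@tofrac {poly C}); split; last exact: frac_exists.
by move=> p q /eqP; rewrite tofrac_eq => /eqP.
Qed.

Definition ratfun : Type := projT1 ratfun_sig.
HB.instance Definition _ := GRing.Field.on ratfun.

Definition emb : {rmorphism {poly C} -> ratfun} := sval (projT2 ratfun_sig).

Lemma emb_inj : injective emb.
Proof. exact: (svalP (projT2 ratfun_sig)).1. Qed.
Lemma emb_eq0 p : (emb p == 0) = (p == 0).
Proof. by rewrite -(rmorph0 emb) (inj_eq emb_inj). Qed.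

Definition rscale (c : C) (h : ratfun) : ratfun := emb c%:P * h.
Fact rscaleA a b h : rscale a (rscale b h) = rscale (a * b) h.
Proof. by rewrite /rscale mulrA -rmorphM -polyCM. Qed.
Fact rscale1 : left_id 1 rscale.
Proof. by move=> h; rewrite /rscale rmorph1 mul1r. Qed.
Fact rscaleDr : right_distributive rscale +%R.
Proof. by move=> c x y; rewrite /rscale mulrDr. Qed.
Fact rscaleDl h : {morph rscale^~ h : a b / a + b}.
Proof. by move=> a b; rewrite /rscale polyCD rmorphD mulrDl. Qed.
HB.instance Definition _ :=
  GRing.Zmodule_isLmodule.Build C ratfun rscaleA rscale1 rscaleDr rscaleDl.
Fact rscaleAl (a : C) (x y : ratfun) : a *: (x * y) = (a *: x) * y.
Proof. by rewrite -[LHS]/(_ * _) mulrA. Qed.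
HB.instance Definition _ := GRing.Lmodule_isLalgebra.Build C ratfun rscaleAl.
HB.instance Definition _ := GRing.Lalgebra_isComAlgebra.Build C ratfun.

Lemma rscaleE (c : C) (h : ratfun) : c *: h = emb c%:P * h.
Proof. by []. Qed.

Lemma ratfun_frac (h : ratfun) : exists a b, b != 0 /\ h = emb a / emb b.
Proof. exact: (svalP (projT2 ratfun_sig)).2. Qed.

Definition rfn (h : ratfun) : {poly C} := sval (cid (ratfun_frac h)).
Definition rfd (h : ratfun) : {poly C} := sval (cid (svalP (cid (ratfun_frac h)))).
Lemma rfdP h : rfd h != 0 /\ h = emb (rfn h) / emb (rfd h).
Proof. exact: (svalP (cid (svalP (cid (ratfun_frac h))))). Qed.

Definition rder (h : ratfun) : ratfun :=
  let a := rfn h in let b := rfd h in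
  (emb a^`() * emb b - emb a * emb b^`()) / emb b ^+ 2.

Lemma quotient_rule a b n d : b != 0 -> d != 0 -> emb a / emb b = emb n / emb d ->
  (emb n^`() * emb d - emb n * emb d^`()) / emb d ^+ 2 =
  (emb a^`() * emb b - emb a * emb b^`()) / emb b ^+ 2.
Proof.
move=> b0 d0 e.
have db0 : emb b != 0 by rewrite emb_eq0.
have dd0 : emb d != 0 by rewrite emb_eq0.
have e1 : a * d = n * b.
  by apply: emb_inj; rewrite !rmorphM -(divfK db0 (emb a)) e mulrAC divfK.
have := congr1 (fun p => emb p^`()) e1; rewrite /= !derivM !rmorphD !rmorphM => e2.
have {}e1 : emb a * emb d = emb n * emb b by rewrite -!rmorphM e1.
exact: (@quotient_rule_field ratfun (emb a) (emb b) (emb n) (emb d) (emb a^`()) (emb b^`()) (emb n^`()) (emb d^`()) db0 dd0 e1 e2).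
Qed.

Lemma rder_frac a b : b != 0 ->
  rder (emb a / emb b) = (emb a^`() * emb b - emb a * emb b^`()) / emb b ^+ 2.
Proof.
by move=> b0; have [d0 e] := rfdP (emb a / emb b); apply: quotient_rule.
Qed.

Lemma rder_linear : linear rder.
Proof.
move=> c x y; have [a [b [b0 ->]]] := ratfun_frac x; have [a' [b' [b'0 ->]]] := ratfun_frac y.
have B0 : emb b != 0 by rewrite emb_eq0.
have B0' : emb b' != 0 by rewrite emb_eq0.
have -> : c *: (emb a / emb b) + emb a' / emb b' = emb (c%:P * a * b' + a' * b) / emb (b * b').
  by rewrite rscaleE !(rmorphD, rmorphM) /=; field; apply/andP.
rewrite !rder_frac ?mulf_neq0 // rscaleE !derivE !(rmorphD, rmorphM, rmorph0) /=.
by field; apply/andP.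
Qed.
HB.instance Definition _ := GRing.isLinear.Build C ratfun ratfun _ rder rder_linear.

Lemma rder_leibniz g h : rder (g * h) = rder g * h + g * rder h.
Proof.
have [a [b [b0 ->]]] := ratfun_frac g; have [a' [b' [b'0 ->]]] := ratfun_frac h.
have B0 : emb b != 0 by rewrite emb_eq0.
have B0' : emb b' != 0 by rewrite emb_eq0.
have -> : (emb a / emb b) * (emb a' / emb b') = emb (a * a') / emb (b * b').
  by rewrite !rmorphM; field; apply/andP.
rewrite !rder_frac ?mulf_neq0 // !derivE !(rmorphD, rmorphM) /=.
by field; apply/andP.
Qed.

Definition rt : ratfun := emb 'X.

Lemma rder_emb p : rder (emb p) = emb p^`().
Proof.
rewrite -[emb p]divr1 -(rmorph1 emb) rder_frac ?oner_eq0 //.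
by rewrite rmorph1 expr1n divr1 mulr1 -[1]/(1%:P) derivC rmorph0 mulr0 subr0.
Qed.
Lemma rder_t : rder rt = 1.
Proof. by rewrite rder_emb derivX rmorph1. Qed.

Lemma horner_ratfun p : horner_alg rt p = emb p.
Proof.
elim/poly_ind: p => [|p c ih]; first by rewrite !rmorph0.
rewrite !rmorphD !rmorphM /= ih horner_algX horner_algC rscaleE mulr1.
by [].
Qed.

Fact ratfun_transc p : horner_alg rt p = 0 -> p = 0.
Proof. by rewrite horner_ratfun => /eqP; rewrite emb_eq0 => /eqP. Qed.

Fact ratfun_finite : exists (r : nat) (e : 'I_r -> ratfun), forall h,
  exists (q : {poly C}) (p : 'I_r -> {poly C}),
    q != 0 /\ horner_alg rt q * h = \sum_i horner_alg rt (p i) * e i.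
Proof.
exists 1%N, (fun=> 1) => h; have [d0 e] := rfdP h.
exists (rfd h), (fun=> rfn h); split=> //.
by rewrite big_ord1 mulr1 !horner_ratfun {2}e mulrC divfK // emb_eq0.
Qed.

Fact ratfun_field : GRing.field_axiom ratfun.
Proof. by move=> x; rewrite unitfE. Qed.

Definition affine_line : curve C := @Curve C ratfun ratfun_field rt ratfun_transc
  ratfun_finite rder rder_leibniz rder_t.

(** The local ring of the projective line at infinity, in terms of degrees. *)
Definition at_inf (h : ratfun) : Prop :=
  exists a b, [/\ b != 0, h = emb a / emb b & (size a <= size b)%N].

Lemma infC c : at_inf c%:A.
Proof.
exists c%:P, 1; rewrite oner_eq0 rmorph1 divr1 size_poly1 size_polyC_leq1.
by rewrite rscaleE mulr1.
Qed.
Lemma inf0 : at_inf 0.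
Proof. by rewrite -(scale0r 1); apply: infC. Qed.
Lemma inf1 : at_inf 1.
Proof. by rewrite -(scale1r 1); apply: infC. Qed.

Lemma infM g h : at_inf g -> at_inf h -> at_inf (g * h).
Proof.
move=> [a [b [b0 -> ab]]] [c [d [d0 -> cd]]]; exists (a * c), (b * d).
split; [by rewrite mulf_neq0 | by rewrite !rmorphM invfM mulrACA |].
apply: leq_trans (size_polyMleq _ _) _; rewrite size_mul //.
by move: ab cd; move: (size a) (size b) (size c) (size d); lia.
Qed.

Lemma infB g h : at_inf g -> at_inf h -> at_inf (g - h).
Proof.
move=> [a [b [b0 -> ab]]] [c [d [d0 -> cd]]]; exists (a * d - c * b), (b * d).
have B0 : emb b != 0 by rewrite emb_eq0.
have D0 : emb d != 0 by rewrite emb_eq0.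
split; [by rewrite mulf_neq0 | by rewrite rmorphB !rmorphM; field; apply/andP |].
apply: leq_trans (size_polyD _ _) _; rewrite size_polyN geq_max (size_mul b0 d0).
apply/andP; split; apply: leq_trans (size_polyMleq _ _) _; move: ab cd.
  by move: (size a) (size b) (size c) (size d); lia.
by move: (size a) (size b) (size c) (size d); lia.
Qed.
Lemma infN g : at_inf g -> at_inf (- g).
Proof. by rewrite -sub0r; apply: infB; apply: inf0. Qed.
Lemma infD g h : at_inf g -> at_inf h -> at_inf (g + h).
Proof. by move=> hg hh; rewrite -[h]opprK; apply: infB => //; apply: infN. Qed.
Lemma inf_sum I (r : seq I) (F : I -> ratfun) :
  (forall i, at_inf (F i)) -> at_inf (\sum_(i <- r) F i).
Proof. by move=> h; elim/big_ind: _ => //; [exact: inf0 | exact: infD]. Qed.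

Lemma rt_neq0 : rt != 0.
Proof. by rewrite emb_eq0 polyX_eq0. Qed.

(** The pole order at infinity is a difference of degrees. *)
Lemma inf_pole (k : nat) a b : a != 0 -> b != 0 -> at_inf (rt ^+ k * (emb a / emb b)) ->
  (k + size a <= size b)%N.
Proof.
move=> a0 b0 [c [d [d0 e cd]]].
have B0 : emb b != 0 by rewrite emb_eq0.
have D0 : emb d != 0 by rewrite emb_eq0.
have {}e : 'X^k * a * d = c * b.
  apply: emb_inj; rewrite !rmorphM rmorphXn -[emb 'X]/rt -(divfK D0 (emb c)) -e.
  by field.
have c0 : c != 0.
  by apply: contraTneq isT => c0; move/eqP: e; rewrite c0 mul0r !mulf_eq0 expf_eq0 polyX_eq0 andbF (negbTE a0) (negbTE d0).
have := congr1 (fun p : {poly C} => size p) e.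
rewrite /= -mulrA size_mul ?mulf_neq0 ?expf_neq0 ?polyX_eq0 // size_polyXn !size_mul //.
have := size_poly_gt0 a; have := size_poly_gt0 d; have := size_poly_gt0 c; have := size_poly_gt0 b.
rewrite a0 b0 c0 d0; move: cd; move: (size a) (size b) (size c) (size d).
move=> sa sb sc sd; lia.
Qed.

Lemma inf_t : ~ at_inf rt.
Proof.
move=> h; have := @inf_pole 1 1 1 (oner_neq0 _) (oner_neq0 _).
by rewrite rmorph1 divr1 mulr1 expr1 size_poly1 => /(_ h).
Qed.

Lemma inf_total h : h != 0 -> at_inf h \/ at_inf h^-1.
Proof.
move=> h0; have [a [b [b0 e]]] := ratfun_frac h; subst h.
have a0 : a != 0 by apply: contraNneq h0 => ->; rewrite rmorph0 mul0r.
case: (leqP (size a) (size b)) => hs; first by left; exists a, b.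
by right; exists b, a; rewrite invf_div; split=> //; apply: ltnW.
Qed.

Lemma at_inf_place : is_place (K := affine_line) at_inf.
Proof.
split; [exact: infC | by move=> g h hg hh; split; [exact: infB | exact: infM] | exact: inf_total |].
by exists rt; exact: inf_t.
Qed.

Lemma inf_tV : at_inf rt^-1.
Proof.
exists 1, 'X; rewrite polyX_eq0 rmorph1 mul1r size_poly1 size_polyX.
by split.
Qed.

Lemma inf_tVX k : at_inf (rt ^+ k)^-1.
Proof.
elim: k => [|k ih]; first by rewrite expr0 invr1; apply: inf1.
by rewrite exprS invfM; apply: infM => //; apply: inf_tV.
Qed.

Lemma inf_tder h : at_inf h -> at_inf (rt * rder h).
Proof.
move=> [a [b [b0 -> ab]]]; rewrite rder_frac //.
exists ('X * (a^`() * b - a * b^`())), (b ^+ 2); split.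
- by rewrite expf_neq0.
- by rewrite rmorphXn rmorphM rmorphB !rmorphM mulrA.
have hb : (0 < size b)%N by rewrite size_poly_gt0.
apply: leq_trans (size_polyMleq _ _) _; rewrite size_polyX /= expr2 size_mul //.
have h1 : (size (a^`() * b - a * b^`())%R <= (size b + size b).-2)%N.
  have sd (p : {poly C}) : (size (p^`())%R <= (size p).-1)%N.
    case: (eqVneq p 0) => [->|p0]; first by rewrite -[0]/(0%:P) derivC size_poly0.
    by have := lt_size_deriv p0; move: (size _) (size p); lia.
  apply: leq_trans (size_polyD _ _) _; rewrite size_polyN geq_max.
  apply/andP; split; apply: leq_trans (size_polyMleq _ _) _.
    by have := sd a; move: ab hb; move: (size _) (size _) (size _); lia.
  by have := sd b; move: ab hb; move: (size _) (size _) (size _); lia.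
by move: h1 hb; move: (size b) (size _); lia.
Qed.

(** The value at infinity is the quotient of the leading coefficients, for
    numerators padded to the degree of the denominator. *)
Lemma inf_value h : at_inf h -> exists c : C, at_inf (rt * (h - c%:A)).
Proof.
move=> [a [b [b0 -> ab]]].
pose c := a`_(size b).-1 / lead_coef b; exists c.
have B0 : emb b != 0 by rewrite emb_eq0.
exists ('X * (a - c%:P * b)), b; split=> //.
  by rewrite rmorphM rmorphB rmorphM rscaleE mulr1 -[emb 'X]/rt; field.
have hb : (0 < size b)%N by rewrite size_poly_gt0.
have h1 : (size (a - c%:P * b)%R <= (size b).-1)%N by apply: size_sub_lead.
apply: leq_trans (size_polyMleq _ _) _; rewrite size_polyX /=.
by move: h1 hb; move: (size b) (size _); lia.
Qed.

Lemma rder_C (c : C) : rder (c%:A) = 0.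
Proof. by rewrite rscaleE mulr1 rder_emb derivC rmorph0. Qed.

(** A function regular at infinity is a constant plus a multiple of 1 / t, so that
    its derivative vanishes to order two there. *)
Lemma inf_t2der h : at_inf h -> at_inf (rt ^+ 2 * rder h).
Proof.
move=> /inf_value [c hc]; have := inf_tder hc.
rewrite rder_leibniz rder_t mul1r linearB /= rder_C subr0 mulrDr mulrA -expr2.
by move=> /infB -/(_ _ hc); rewrite addrAC subrr add0r.
Qed.

(** A uniformizer at infinity is 1 / t up to a unit. *)
Lemma inf_uniformizer s : is_uniformizer (K := affine_line) at_inf s ->
  [/\ s != 0, at_inf (rt * s) & at_inf (rt * s)^-1].
Proof.
move=> [hs s0 nV hu]; split=> //; last first.
  rewrite invfM; apply: (hu rt^-1); first exact: inf_tV.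
  by rewrite invrK; exact: inf_t.
have [a [b [b0 e]]] := ratfun_frac s; subst s.
have a0 : a != 0 by apply: contraNneq s0 => ->; rewrite rmorph0 mul0r.
have hab : (size a < size b)%N.
  rewrite ltnNge; apply/negP => hba; apply: nV; exists b, a.
  by rewrite invf_div.
exists ('X * a), b; split=> //; first by rewrite rmorphM mulrA.
by rewrite size_mul ?polyX_eq0 // size_polyX.
Qed.

(** Hence s d/ds and t d/dt differ by a unit at infinity. *)
Lemma inf_log_der s : is_uniformizer (K := affine_line) at_inf s ->
  rder s != 0 /\ at_inf (rt * (rder s / s)).
Proof.
move=> /inf_uniformizer [s0 hw hwV]; have t0 := rt_neq0.
have e : rt * (rder s / s) = rt * rder (rt * s) / (rt * s) - 1.
  by rewrite rder_leibniz rder_t; field; apply/andP.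
split; last first.
  by rewrite e; apply: infB; [apply: infM => //; apply: inf_tder | apply: inf1].
apply/negP => /eqP d0; apply: inf_t.
have := infM (inf_t2der hw) hwV.
rewrite rder_leibniz rder_t d0 mulr0 addr0 mul1r.
by have -> : rt ^+ 2 * s / (rt * s) = rt by field; apply/andP.
Qed.
End RatFun.

(** ** Exponentials are irregular at infinity *)

Section Irregular.
Variables (C : fieldType) (E : lmodType (ratfun C)).
Local Notation rt := (@rt C).

Lemma inf_decay (h : ratfun C) : (forall k, at_inf (rt ^+ k * h)) -> h = 0.
Proof.
have [a [b [b0 ->]]] := ratfun_frac h => hk.
case: (eqVneq a 0) => [->|a0]; first by rewrite rmorph0 mul0r.
have := inf_pole a0 b0 (hk (size b)).
by have := size_poly_gt0 a; rewrite a0; move: (size a) (size b); lia.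
Qed.

Lemma inf_bounded r (c : 'I_r -> ratfun C) :
  exists K, forall k i, (K <= k)%N -> at_inf (c i / rt ^+ k).
Proof.
have bd (h : ratfun C) : exists K, at_inf (h / rt ^+ K).
  have [a [b [b0 ->]]] := ratfun_frac h; exists (size a), a, (b * 'X^(size a)).
  split; first by rewrite mulf_neq0 // expf_neq0 // polyX_eq0.
    by rewrite rmorphM rmorphXn invfM mulrA.
  rewrite size_mul ?expf_neq0 ?polyX_eq0 // size_polyXn.
  by have := size_poly_gt0 b; rewrite b0; move: (size a) (size b); lia.
pose K i := sval (cid (bd (c i))); exists (\max_i K i) => k i hk.
have hi : (K i <= k)%N by apply: leq_trans hk; apply: leq_bigmax.
have -> : c i / rt ^+ k = c i / rt ^+ (K i) * (rt ^+ (k - K i))^-1.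
  by rewrite -mulrA -invfM -exprD addnC subnK.
by apply: infM; [rewrite /K; case: cid | apply: inf_tVX].
Qed.

(** Induction on the number of generators. If they are independent, then the
    coefficients do not depend on k, so they vanish to every order; otherwise one
    generator is eliminated, at the cost of a bounded pole. *)
Lemma lattice_separated r (e : 'I_r -> E) x :
  (forall k, exists c : 'I_r -> ratfun C,
     x = \sum_i c i *: e i /\ forall i, at_inf (rt ^+ k * c i)) -> x = 0.
Proof.
elim: r e x => [|r ih] e x hx.
  by have [c [-> _]] := hx 0%N; rewrite big_ord0.
case: (pselect (forall c, \sum_i c i *: e i = 0 -> forall i, c i = 0)) => [ind|].
  have [c [e0 _]] := hx 0%N; rewrite e0 big1 // => i _.
  suff -> : c i = 0 by rewrite scale0r.
  apply: inf_decay => k; have [c' [e1 h1]] := hx k.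
  suff -> : c i = c' i by [].
  apply/eqP; rewrite -subr_eq0; apply/eqP; apply: (ind (fun i => c i - c' i)).
  by under eq_bigr do rewrite scalerBl; rewrite sumrB -e0 -e1 subrr.
move=> /existsNP [a /not_implyP [ea /existsNP [i0 /eqP a0]]].
pose f j := a (lift i0 j) / a i0.
have ei0 : e i0 = - \sum_j f j *: e (lift i0 j).
  apply: (scalerI a0); rewrite scalerN scaler_sumr.
  rewrite (bigD1_ord i0) //= in ea; move/eqP: ea; rewrite addr_eq0 => /eqP ->.
  by congr (- _); apply: eq_bigr => j _; rewrite scalerA /f mulrC divfK.
have [K hK] := inf_bounded f; have hK' i := hK K i (leqnn K).
apply: (ih (fun j => e (lift i0 j))) => k; have [c [ex hc]] := hx (k + K)%N.
exists (fun j => c (lift i0 j) - c i0 * f j); split.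
  rewrite ex (bigD1_ord i0) //= ei0 scalerN scaler_sumr addrC -sumrB.
  by apply: eq_bigr => j _; rewrite scalerBl scalerA.
have tK0 : rt ^+ K != 0 by rewrite expf_neq0 // rt_neq0.
move=> j; have -> : rt ^+ k * (c (lift i0 j) - c i0 * f j) =
    rt ^+ (k + K) * c (lift i0 j) * (rt ^+ K)^-1 -
    rt ^+ (k + K) * c i0 * (f j / rt ^+ K) by rewrite exprD; field.
by apply: infB; apply: infM => //; apply: inf_tVX.
Qed.

Variable nabla : E -> E.
Hypothesis nablaD : forall x y, nabla (x + y) = nabla x + nabla y.
Hypothesis nablaZ : forall g x, nabla (g *: x) = rder g *: x + g *: nabla x.

Lemma nabla_sum r (F : 'I_r -> E) : nabla (\sum_i F i) = \sum_i nabla (F i).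
Proof.
have n0 : nabla 0 = 0 by apply: (addrI (nabla 0)); rewrite -nablaD !addr0.
by apply: (big_morph nabla nablaD n0).
Qed.

(** On a lattice stable under s d/ds, the operator t d/dt does not create poles;
    an exponential section x satisfies t d/dt x = c t x, so that it lies in
    all the multiples of the lattice. *)
Lemma exponential_irregular (c : C) x : c != 0 ->
  regular_at (K := affine_line C) (@at_inf C) nabla -> nabla x = (c%:A : ratfun C) *: x -> x = 0.
Proof.
move=> c0 [s [us [r [e [egen ecl]]]]] hx.
have [s'0 hlog] := inf_log_der us; have [s0 _ _] := inf_uniformizer us.
have t0 := rt_neq0 C.
have cA0 : (c%:A : ratfun C) != 0 by rewrite scaler_eq0 negb_or c0 oner_eq0.
have [m [mV me]] : exists m : 'I_r -> 'I_r -> ratfun C,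
    (forall i j, at_inf (m i j)) /\ forall i, rt *: nabla (e i) = \sum_j m i j *: e j.
  exists (fun i j => rt * (rder s / s) * sval (cid (ecl i)) j); split=> [i j|i].
    by apply: infM => //; case: cid => m [].
  case: cid => m [_ /= hm]; under eq_bigr do rewrite -scalerA.
  by rewrite -scaler_sumr -hm scalerA; congr (_ *: _); field; apply/andP.
have [c1 ec1] := egen x; have [K hK] := inf_bounded c1.
have lder k : exists a : C, rt * rder (rt ^+ k / rt ^+ K) = a%:A * (rt ^+ k / rt ^+ K).
  have ld l : rt * rder (rt ^+ l) = (l%:R)%:A * rt ^+ l.
    elim: l => [|l ihl]; first by rewrite expr0 -(scale1r 1) rder_C mulr0 scale0r mul0r.
    rewrite exprS rder_leibniz rder_t mul1r mulrDr mulrCA ihl -[l.+1%:R]natr1 scalerDl scale1r.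
    by rewrite mulrDl mul1r addrC; congr (_ + _); rewrite mulrCA.
  have tK0 : rt ^+ K != 0 by rewrite expf_neq0.
  exists (k%:R - K%:R); set G := _ / _.
  have e1 : rt * rder (G * rt ^+ K) = (k%:R)%:A * (G * rt ^+ K) by rewrite divfK.
  have e2 : rt * (G * rder (rt ^+ K)) = G * ((K%:R)%:A * rt ^+ K) by rewrite mulrCA ld.
  rewrite rder_leibniz mulrDr e2 in e1.
  apply: (mulIf tK0); rewrite scalerBl; move: (k%:R%:A) (K%:R%:A) e1 => x1 x2 e1.
  have -> : rt * rder G * rt ^+ K = x1 * (G * rt ^+ K) - G * (x2 * rt ^+ K).
    by rewrite -e1; ring.
  by ring.
suff main k : exists d : 'I_r -> ratfun C, x = \sum_i d i *: e i /\
    forall i, at_inf (rt ^+ k / rt ^+ K * d i).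
  apply: lattice_separated (e) _ _ => k; have [d [ed hd]] := main (k + K)%N.
  exists d; split=> // i; have := hd i; rewrite exprD mulfK //.
  by rewrite expf_neq0.
elim: k => [|k [d [ed hd]]].
  by exists c1; split=> // i; rewrite expr0 mul1r mulrC; apply: hK.
(* The coefficients of (t c)^-1 t nabla x, which is x. *)
exists (fun j => (rt * c%:A)^-1 * (rt * rder (d j) + \sum_i d i * m i j)); split.
  have tx : (rt * c%:A) *: x = \sum_j (rt * rder (d j) + \sum_i d i * m i j) *: e j.
    rewrite -scalerA -hx {1}ed nabla_sum scaler_sumr.
    transitivity (\sum_i ((rt * rder (d i)) *: e i + d i *: \sum_j m i j *: e j)).
      apply: eq_bigr => i _; rewrite nablaZ scalerDr -me !scalerA.
      by rewrite (mulrC rt (d i)).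
    rewrite big_split; under [RHS]eq_bigr do rewrite scalerDl.
    rewrite big_split; congr (_ + _) => /=.
    under eq_bigr do rewrite scaler_sumr; rewrite exchange_big; apply: eq_bigr => j _ /=.
    by rewrite scaler_suml; apply: eq_bigr => i _; rewrite scalerA.
  rewrite -[LHS](scalerK (mulf_neq0 t0 cA0)) tx scaler_sumr.
  by apply: eq_bigr => j _; rewrite scalerA.
move=> j; have [a ha] := lder k; set G := rt ^+ k / rt ^+ K in ha hd *.
have -> : rt ^+ k.+1 / rt ^+ K * ((rt * c%:A)^-1 * (rt * rder (d j) + \sum_i d i * m i j)) =
   (c^-1)%:A * ((rt * rder (G * d j) - a%:A * (G * d j)) + \sum_i G * d i * m i j).
  have -> : (c^-1)%:A = (c%:A)^-1 :> ratfun C.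
    by apply: (mulfI cA0); rewrite mulfV // -scalerAl mul1r scalerA mulfV // scale1r.
  have -> : rt * rder (G * d j) - a%:A * (G * d j) = G * (rt * rder (d j)).
    by rewrite rder_leibniz mulrDr mulrA ha; ring.
  have -> : \sum_i G * d i * m i j = G * \sum_i d i * m i j.
    by rewrite mulr_sumr; apply: eq_bigr => i _; rewrite mulrA.
  rewrite /G exprS; move: (\sum_i _) (rder _) (c%:A) cA0 => S D A A0.
  by field; rewrite t0 A0 expf_neq0.
apply: infM; first exact: infC.
apply: infD; last by apply: inf_sum => i; apply: infM.
by apply: infB; [apply: inf_tder | apply: infM => //; apply: infC].
Qed.
End Irregular.

(** * Regular holonomic modules have no exponential sections *)

Section Uncountable.
Variable R : realType.

Lemma avoid_finite (s : seq R) (a b : R) : a < b ->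
  exists a' b', [/\ a <= a', a' < b', b' <= b & forall y, y \in s -> ~~ (a' <= y <= b')].
Proof.
elim: s a b => [|y s ih] a b ab; first by exists a, b.
have [u [w [au uw wb hy]]] : exists u w, [/\ a <= u, u < w, w <= b & ~~ (u <= y <= w)].
  case: (lerP ((a + b) / 2) y) => hy.
    by exists a, (a + (b - a) / 4); split; rewrite ?negb_and -?ltNge; try (apply/orP; right); lra.
  by exists ((a + b) / 2), b; split; rewrite ?negb_and -?ltNge; try (apply/orP; left); lra.
have [a' [b' [h1 h2 h3 h4]]] := ih _ _ uw; exists a', b'; split=> //.
- exact: le_trans h1.
- exact: le_trans wb.
move=> z; rewrite inE => /orP[/eqP ->|]; last exact: h4.
apply: contra hy => /andP[h5 h6]; apply/andP; split; first exact: le_trans h5.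
exact: le_trans h3.
Qed.

(** Nested intervals, each of which avoids one of the finite sets. *)
Lemma real_uncountable (g : nat -> seq R) : exists x, forall k, x \notin g k.
Proof.
pose I := {p : R * R | p.1 < p.2}.
have step (k : nat) (p : I) : {q : I | [/\ (sval p).1 <= (sval q).1, (sval q).2 <= (sval p).2
    & forall y, y \in g k -> ~~ ((sval q).1 <= y <= (sval q).2)]}.
  apply: cid; have [a' [b' [h1 h2 h3 h4]]] := avoid_finite (g k) (svalP p).
  by exists (exist _ (a', b') h2).
pose p0 : I := exist _ (0 : R, 1 : R) (ltr01 : (0, 1).1 < (0, 1).2).
pose F := fix F k : I := if k is k'.+1 then sval (step k' (F k')) else p0.
have FP k : [/\ (sval (F k)).1 <= (sval (F k.+1)).1, (sval (F k.+1)).2 <= (sval (F k)).2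
    & forall y, y \in g k -> ~~ ((sval (F k.+1)).1 <= y <= (sval (F k.+1)).2)].
  exact: svalP (step k (F k)).
have mono k l : (k <= l)%N -> (sval (F k)).1 <= (sval (F l)).1 /\ (sval (F l)).2 <= (sval (F k)).2.
  move=> /subnK <-; elim: (l - k)%N => [//|j [h1 h2]]; have [h3 h4 _] := FP (j + k)%N.
  by rewrite addSn; split; [exact: le_trans h3 | exact: le_trans h2].
have cross k l : (sval (F k)).1 <= (sval (F l)).2.
  have [h1 _] := mono _ _ (leq_maxl k l); have [_ h2] := mono _ _ (leq_maxr k l).
  apply: le_trans h1 (le_trans _ h2); exact/ltW/(svalP (F (maxn k l))).
pose A : classical_sets.set R := fun x => exists k, x = (sval (F k)).1.
have supA : classical_sets.has_sup A.
  by split; [exists (sval (F 0%N)).1, 0%N | exists (sval (F 0%N)).2 => x [k ->]].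
have supk k : (sval (F k)).1 <= sup A <= (sval (F k)).2.
  apply/andP; split; first by apply: (sup_upper_bound supA); exists k.
  by apply: ge_sup; [exists (sval (F 0%N)).1, 0%N | move=> x [l ->]].
exists (sup A) => k; apply: contraTN (supk k.+1) => hk.
by have [_ _ h] := FP k; apply: h.
Qed.

Lemma complex_uncountable (g : nat -> seq R[i]) : exists x, forall k, x \notin g k.
Proof.
have [x hx] := real_uncountable (fun k => map (@complex.Re R) (g k)).
exists (x%:C)%C => k; apply: contra (hx k) => h.
by apply/mapP; exists (x%:C)%C.
Qed.
End Uncountable.

(** ** Rational functions of the first coordinate *)

Section Extend.
Variables (C : fieldType) (F : fieldType) (j : {rmorphism {poly C} -> F}).
Hypothesis j_inj : injective j.

(** The extension of j to the field of fractions. *)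
Definition rext_of (hj : injective j) (h : ratfun C) : F := j (rfn h) / j (rfd h).
Local Notation rext := (rext_of j_inj).

Lemma rext_frac a b : b != 0 -> rext (emb C a / emb C b) = j a / j b.
Proof.
move=> b0; rewrite /rext_of; have [d0 e] := rfdP (emb C a / emb C b).
move: (rfn _) (rfd _) d0 e => n d d0 e.
have j0 (p : {poly C}) : p != 0 -> j p != 0 by move=> p0; rewrite -(rmorph0 j) (inj_eq j_inj).
have e1 : a * d = n * b.
  apply: (@emb_inj C); rewrite !rmorphM.
  have B0 : emb C b != 0 by rewrite emb_eq0.
  have D0 : emb C d != 0 by rewrite emb_eq0.
  by rewrite -(divfK B0 (emb C a)) e mulrAC divfK.
by apply/eqP; rewrite eqr_div ?j0 // -!rmorphM e1.
Qed.

Fact rext_zmod : {morph rext : x y / x - y}.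
Proof.
move=> x y; have [a [b [b0 ->]]] := ratfun_frac x; have [c [d [d0 ->]]] := ratfun_frac y.
have j0 (p : {poly C}) : p != 0 -> j p != 0 by move=> p0; rewrite -(rmorph0 j) (inj_eq j_inj).
have B0 : emb C b != 0 by rewrite emb_eq0.
have D0 : emb C d != 0 by rewrite emb_eq0.
rewrite -mulNr -(rmorphN (emb C)) addf_div // -!rmorphM -rmorphD !rext_frac ?mulf_neq0 //.
by rewrite -[in RHS]mulNr addf_div ?j0 // !(rmorphD, rmorphM, rmorphN).
Qed.
Fact rext_monoid : monoid_morphism rext.
Proof.
split=> [|x y].
  by rewrite -[1]divr1 -(rmorph1 (emb C)) rext_frac ?oner_eq0 // rmorph1 divr1.
have [a [b [b0 ->]]] := ratfun_frac x; have [c [d [d0 ->]]] := ratfun_frac y.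
by rewrite mulf_div -!rmorphM !rext_frac ?mulf_neq0 // !rmorphM mulf_div.
Qed.
HB.instance Definition _ := GRing.isZmodMorphism.Build (ratfun C) F rext rext_zmod.
HB.instance Definition _ := GRing.isMonoidMorphism.Build (ratfun C) F rext rext_monoid.

Lemma rext_emb p : rext (emb C p) = j p.
Proof. by rewrite -[emb C p]divr1 -(rmorph1 (emb C)) rext_frac ?oner_eq0 // rmorph1 divr1. Qed.
End Extend.

Lemma horner_alg_mpoly (C : fieldType) m (k : 'I_m) (p : {poly C}) i :
  (horner_alg ('X_k : {mpoly C[m]}) p)@_(U_(k) *+ i) = p`_i.
Proof.
have hX l : horner_alg ('X_k : {mpoly C[m]}) (p`_l *: 'X^l) = p`_l *: 'X_[U_(k) *+ l].
  by rewrite linearZ /= rmorphXn /= horner_algX mpolyXn -scalerAl mul1r.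
rewrite -[p in LHS]coefK poly_def linear_sum raddf_sum /=.
under eq_bigr do rewrite hX mcoeffZ mcoeffX.
case: (ltnP i (size p)) => hi.
  rewrite (bigD1 (Ordinal hi)) //= eqxx mulr1 big1 ?addr0 // => l hl.
  case: eqP => [/(congr1 (fun m : 'X_{1.._} => m k))|_]; last by rewrite mulr0.
  rewrite !mulmnE mnm1E eqxx !mul1n => e; case/eqP: hl; exact: val_inj.
rewrite nth_default // big1 // => l _.
case: eqP => [/(congr1 (fun m : 'X_{1.._} => m k))|_]; last by rewrite mulr0.
rewrite !mulmnE mnm1E eqxx !mul1n => e.
by have := ltn_ord l; rewrite e ltnNge hi.
Qed.

Section FirstCoordinate.
Variables (C : fieldType) (n : nat).
Local Notation S := {mpoly C[n.+1 + n.+1]}.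

Definition poly_x0 : {rmorphism {poly C} -> {fraction S}} :=
  (@tofrac S) \o (horner_alg ('X_(lshift n.+1 ord0) : S)).

Lemma poly_x0_inj : injective poly_x0.
Proof.
move=> p q /eqP; rewrite /= tofrac_eq => /eqP e; apply/polyP => i.
pose k := lshift n.+1 (ord0 : 'I_n.+1).
by rewrite -(horner_alg_mpoly k p) -(horner_alg_mpoly k q) e.
Qed.

(** Functions on the affine line, as functions of the first coordinate. *)
Definition io : {rmorphism ratfun C -> {fraction S}} := rext_of poly_x0_inj.

Lemma io_t : io (rt C) = tofrac ('X_(lshift n.+1 ord0) : S).
Proof. by rewrite /io /= rext_emb /= horner_algX. Qed.

Lemma io_C c : io c%:A = tofrac (c%:MP : S).
Proof.
by rewrite /io /= rscaleE mulr1 rext_emb /= horner_algC -[c%:A]mul_mpolyC mulr1.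
Qed.
End FirstCoordinate.

Section NoTorsion.
Variables (C : numFieldType) (V : lmodType C) (A B : {linear V -> V}).
Hypothesis AB : forall v, B (A v) = A (B v) + v.

Lemma pact_der f v : B (pact A f v) = pact A f (B v) + pact A f^`() v.
Proof.
have pD f1 f2 w : pact A (f1 + f2) w = pact A f1 w + pact A f2 w.
  by rewrite -[f1]scale1r pactP !scale1r.
have p0 w : pact A 0 w = 0 by rewrite -[0]/(0%:P) pactC scale0r.
elim/poly_ind: f => [|f a ih]; first by rewrite deriv0 !p0 linear0 addr0.
rewrite derivD derivM derivX derivC mulr1 addr0 !pD !(mulrC _ 'X) !pactMX !pactC.
rewrite linearD linearZ /= AB ih linearD /= -!addrA; congr (_ + _).
by rewrite addrA addrC.
Qed.

(** The analogue, for operators with [B, A] = 1, of the fact that a polynomial that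
    kills a function is zero where the function does not vanish: if B v is in S,
    then with f also its derivative maps v into S. *)
Lemma no_torsion (S : subspace V) f v :
  (forall w, S w -> S (A w)) -> (forall w, S w -> S (B w)) ->
  f != 0 -> S (B v) -> S (pact A f v) -> S v.
Proof.
move=> SA SB; have [k] := ubnP (size f); elim: k f => // k ih f hf f0 hB hv.
case: (leqP (size f) 1) => h1.
  have ef := size1_polyC h1; rewrite ef pactC in hv.
  have a0 : f`_0 != 0 by move: f0; rewrite ef polyC_eq0 coefC eqxx.
  by have := subZ (f`_0)^-1 hv; rewrite scalerA mulVf // scale1r.
have d0 : f^`() != 0.
  apply: contraTneq isT => /(congr1 (fun p : {poly C} => p`_(size f).-2)).
  rewrite coef_deriv coef0 -[(size f).-2.+1](_ : (size f).-1 = _); last by case: (size f) h1 => [|[]].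
  move/eqP; rewrite mulrn_eq0 -/(lead_coef f) lead_coef_eq0 (negbTE f0) orbF.
  by case: (size f) h1 => [|[]].
apply: (ih f^`()) => //; first by apply: leq_trans (lt_size_deriv f0) _.
have := SB _ hv; rewrite pact_der addrC => h.
rewrite -(addrK (pact A f (B v)) (pact A f^`() v)); apply: subB => //.
exact: pact_sub.
Qed.
End NoTorsion.

Section TopClass.
Variables (C : numClosedFieldType) (n : nat) (M : dmodule C n.+1).
Variables (g h : 'M[C]_n.+1) (hgh : g *m h = 1%:M) (c : C).
Local Notation tw P l := (twist (res P l) hgh).

(** The operator D_0 - c. *)
Definition dsub (N : dmodule C n.+1) : {linear N -> N} := psub (fun=> dD N ord0) 0%N c.
Lemma dsubE (N : dmodule C n.+1) m : dsub N m = dD N ord0 m - c *: m.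
Proof. by []. Qed.

Lemma dsub_dhom (N N' : dmodule C n.+1) (f : {linear N -> N'}) m :
  is_dhom f -> f (dsub N m) = dsub N' (f m).
Proof. by move=> hf; rewrite !dsubE linearB linearZ /= (hf (inr ord0)). Qed.
Lemma dsub_Y (N : dmodule C n.+1) k m : dsub N (Yop N k m) = Yop N k (dsub N m).
Proof. by rewrite !dsubE Yop_D0 [RHS]linearB [Yop N k (c *: m)]linearZ. Qed.

Section Resolution.
Variable P : free_resolution M.
Definition tcyc l s := @cyc C (fun l => dcarrier (tw P l)) (res_d P) (fun l => Yop (tw P l)) l s.
Definition tbnd l s := @bnd C (fun l => dcarrier (tw P l)) (res_d P) (fun l => Yop (tw P l)) l s.

Lemma res_Y l k p : res_d P l (Yop (tw P l.+1) k p) = Yop (tw P l) k (res_d P l p).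
Proof.
exact: (@Yop_dhom _ _ (tw P l.+1) (tw P l) (res_d P l) k p (@twist_dhom _ _ _ _ hgh _ _ _ (@res_dhom _ _ _ P l))).
Qed.
Lemma res_E l p : res_d P l (dsub (tw P l.+1) p) = dsub (tw P l) (res_d P l p).
Proof.
by have := @dsub_dhom (tw P l.+1) (tw P l) (res_d P l) p (@twist_dhom _ _ _ _ hgh _ _ _ (@res_dhom _ _ _ P l)).
Qed.

Lemma tbnd_E l s p : tbnd l s p -> tbnd l s (dsub (tw P l) p).
Proof.
apply: (@bnd_E _ (fun l => dcarrier (tw P l)) _ _ (fun l => dsub (tw P l))) => [k q|k j q].
  exact: res_E.
exact: dsub_Y.
Qed.

Lemma tbnd_X0 l s p : tbnd l s p -> tbnd l s (dX (tw P l) ord0 p).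
Proof.
apply: (@bnd_E _ (fun l => dcarrier (tw P l)) _ _ (fun l => dX (tw P l) ord0)) => [k q|k j q].
  by have := @twist_dhom _ _ _ _ hgh _ _ _ (@res_dhom _ _ _ P k) (inl ord0) q.
rewrite /Yop; case: insub => [i|]; first exact: (@dXX _ _ (tw P k)).
exact: (linear0 (dX (tw P k) ord0)).
Qed.

Hypothesis uncountable : forall u : nat -> seq C, exists b, forall k, b \notin u k.
Hypothesis Mctbl : ctbl (fun=> True) (zero_sub M).

(** A section of M with exponential growth along the first coordinate gives, at
    a suitable point of the other coordinates, a nonzero class with the same
    property in the homology of the restriction to the line. *)
Lemma top_class (m : M) : m <> 0 -> dsub (twist M hgh) m = 0 ->
  exists s r p, [/\ size s = n, tcyc r s p, ~ tbnd r s p & tbnd r s (dsub (tw P r) p)].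
Proof.
move=> m0 hm.
have h0 : @state C (fun l => dcarrier (tw P l)) (res_d P) (fun l => Yop (tw P l))
    (fun l => dsub (tw P l)) [::] 0%N.
  have b0 (p : P 0%N) : res_aug P p = 0 -> tbnd 0 [::] p.
    by move=> /res_exact0 [p' ->]; exists p'; rewrite /= subrr.
  have bk k p : (0 < k)%N -> tcyc k [::] p -> tbnd k [::] p.
    by case: k p => // k p _ /= /res_exact [p' ->]; exists p'; rewrite /= subrr.
  split=> [k p hk|| [|k]]; first exact: bk.
  - have [p hp] := res_aug_surj P m; exists p; split=> //.
      move=> [w /= /subr0_eq e]; apply: m0; rewrite -hp e; exact: aug_d.
    apply: b0; have -> : res_aug P (dsub (tw P 0%N) p) = dsub (twist M hgh) (res_aug P p).
      by have := @dsub_dhom (tw P 0%N) (twist M hgh) (res_aug P) p (@twist_dhom _ _ _ _ hgh _ _ _ (@res_aughom _ _ _ P)).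
    by rewrite hp.
  - have [e he] := Mctbl.
    pose e' i := sval (cid (res_aug_surj P (e i))).
    have eP i : res_aug P (e' i) = e i by rewrite /e'; case: cid.
    exists e' => z _; have [k [a /= ha]] := he (res_aug P z) I.
    exists k, a; apply: b0; rewrite linearB /= -[RHS]ha; congr (_ - _).
    by rewrite /comb linear_sum; apply: eq_bigr => i _; rewrite linearZ /= eP.
  by exists (fun=> 0) => z hz; exists 0%N, (fun=> 0); rewrite /comb big_ord0 subr0; apply: bk.
have hreg l (s : seq C) (b : C) (w : P l) : (size s < n)%N ->
    ptI (Yop (tw P l)) s (psub (Yop (tw P l)) (size s) b w) -> ptI (Yop (tw P l)) s w.
  have [I [e he]] := twist_free hgh (res_free P l); exact: (free_regular he).
have [s [r [hs [_ [p [h1 h2 h3]] _]]]] := @state_full C (fun l => dcarrier (tw P l)) (res_d P)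
  (fun l => Yop (tw P l)) (fun l => dsub (tw P l)) (@res_dd _ _ _ P) res_Y
  (fun l => @Yop_comm _ _ (tw P l)) res_E (fun l => @dsub_Y (tw P l)) n hreg uncountable 0%N h0.
by exists s, r, p.
Qed.
End Resolution.

(** Chain maps between two resolutions are homotopy inverse to each other, and
    they commute with the operators of D. *)
Lemma top_class_indep (P P' : free_resolution M) s r (p : P r) :
  tcyc P _ s p -> ~ tbnd P _ s p -> tbnd P _ s (dsub (tw P r) p) ->
  exists p' : P' r, [/\ tcyc P' _ s p', ~ tbnd P' _ s p'
    & tbnd P' _ s (dsub (tw P' r) p')].
Proof.
move=> h1 h2 h3.
have [f [hf fa fd]] := chain_map_exists P P'.
have [f' [hf' fa' fd']] := chain_map_exists P' P.
have inI_hom (Q Q' : dmodule C n.+1) (u : {linear Q -> Q'}) q : is_dhom u ->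
    ptI (Yop (twist Q hgh)) s q -> ptI (Yop (twist Q' hgh)) s (u q).
  by move=> hu; apply: ptI_map => k v; apply: (@Yop_dhom _ _ (twist Q hgh) (twist Q' hgh) u k v (@twist_dhom _ _ _ _ hgh _ _ _ hu)).
have bnd_hom (Q Q' : free_resolution M) (u : forall l, {linear Q l -> Q' l}) l q :
    (forall l, is_dhom (u l)) -> (forall l p, res_d Q' l (u l.+1 p) = u l (res_d Q l p)) ->
    tbnd Q _ s q -> tbnd Q' _ s (u l q).
  move=> hu ud [w hw]; exists (u l.+1 w); rewrite ud -linearB.
  exact: inI_hom.
exists (f r p); split.
- case: r p h1 {h2 h3} => //= l p h1; rewrite fd; exact: inI_hom.
- move=> hb; apply: h2.
  have := bnd_hom _ _ f' _ _ hf' fd' hb => h4.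
  pose u l : {linear P l -> P l} := (f' l \o f l) \- idfun.
  have [|||k [hk k0 ks]] := @homotopy_exists _ _ _ P u.
  - by move=> l t m /=; rewrite hf hf' linearB.
  - by move=> q; rewrite /= linearB fa' fa subrr.
  - by move=> l q; rewrite /= linearB fd' fd.
  suff h5 : tbnd P _ s (u r p).
    by apply: subBK h4; rewrite -opprB; apply: subN.
  case: r p {h3 hb h4} h1 => [|l] p h1.
    by rewrite k0; apply: add_im_r.
  rewrite ks; apply: subD; first exact: add_im_r.
  by apply: add_im_l; apply: inI_hom.
have -> : dsub (tw P' r) (f r p) = f r (dsub (tw P r) p).
  by apply/esym/(dsub_dhom _ (@twist_dhom _ _ _ _ hgh _ _ _ (hf r))).
exact: bnd_hom.
Qed.
End TopClass.

Section LineTensor.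
Variables (C : numClosedFieldType) (n : nat) (M : dmodule C n.+1).
Variables (g h : 'M[C]_n.+1) (hgh : g *m h = 1%:M) (c : C) (s : seq C).
Hypothesis hs : size s = n.
Local Notation K := (ratfun C).
Local Notation tw P l := (twist (res P l) hgh).

(** The line through the point s in the direction of the first coordinate. *)
Definition line_coord (k : 'I_n.+1) : K :=
  if unlift ord0 k is Some j then (nth 0 (rev s) j)%:A else rt C.
(** The line in the original coordinates. *)
Definition line_map (i : 'I_n.+1) : K := \sum_k h i k *: line_coord k.

Lemma line_map_inv l : \sum_i g l i *: line_map i = line_coord l.
Proof.
under eq_bigr do rewrite scaler_sumr; rewrite exchange_big /=.
rewrite -(sum_delta line_coord l); apply: eq_bigr => k _.
have -> : (l == k)%:R = (g *m h) l k by rewrite hgh mxE.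
by rewrite mxE scaler_suml; apply: eq_bigr => i _; rewrite scalerA.
Qed.

Lemma line_map_der i : rder (line_map i) = (h i ord0)%:A.
Proof.
rewrite linear_sum (bigD1 ord0) //= linearZ /= /line_coord unlift_none rder_t.
rewrite big1 ?addr0 // => k; case: (unliftP ord0 k) => [j ->|->] // _.
by rewrite linearZ /= rder_C scaler0.
Qed.

Lemma io_line_map i :
  io C n (line_map i) = tofrac (theta n s (\sum_k h i k *: 'X_(lshift n.+1 k))).
Proof.
rewrite !rmorph_sum; apply: eq_bigr => k _ /=.
rewrite -[h i k *: line_coord k]mulr_algl rmorphM io_C thetaZ -mul_mpolyC rmorphM /=.
congr (_ * _); rewrite /line_coord; case: (unliftP ord0 k) => [j ->|->] /=.
  by rewrite io_C theta_XY ?hs // ltn_ord.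
by rewrite io_t theta_X0.
Qed.

Section Tensor.
Variables (P : dmodule C n.+1) (T : lmodType K) (t : K -> P -> T).
Hypothesis ht : is_tensor (fun i u => line_map i * u) (dX P) t.
Hypothesis tK : forall u v p, u *: t v p = t (u * v) p.

Lemma tDl u u' p : t (u + u') p = t u p + t u' p.
Proof. by case: ht => -[]. Qed.
Lemma tDr u p p' : t u (p + p') = t u p + t u p'.
Proof. by case: ht => -[]. Qed.
Lemma tZ (a : C) u p : t u (a *: p) = t (a *: u) p.
Proof. by case: ht => -[]. Qed.
Lemma tXi i u p : t u (dX P i p) = t (line_map i * u) p.
Proof. by case: ht => -[]. Qed.
Lemma t0r u : t u 0 = 0.
Proof. by apply: (addrI (t u 0)); rewrite -tDr !addr0. Qed.
Lemma t0l p : t 0 p = 0.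
Proof. by apply: (addrI (t 0 p)); rewrite -tDl !addr0. Qed.
Lemma t_sumr I (r : seq I) u (F : I -> P) : t u (\sum_(i <- r) F i) = \sum_(i <- r) t u (F i).
Proof. exact: (big_morph (t u) (tDr u) (t0r u)). Qed.
Lemma t_suml I (r : seq I) (F : I -> K) p : t (\sum_(i <- r) F i) p = \sum_(i <- r) t (F i) p.
Proof. exact: (big_morph (t^~ p) (fun u u' => tDl u u' p) (t0l p)). Qed.
Lemma tNr u p : t u (- p) = - t u p.
Proof. by apply: (addrI (t u p)); rewrite -tDr !subrr t0r. Qed.
Lemma t1 u p : t u p = u *: t 1 p.
Proof. by rewrite tK mulr1. Qed.
Lemma t1Z (a : C) p : t 1 (a *: p) = a%:A *: t 1 p.
Proof. by rewrite tZ t1. Qed.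

Lemma t_twX l u p : t u (dX (twist P hgh) l p) = t (line_coord l * u) p.
Proof.
rewrite t_sumr -line_map_inv mulr_suml t_suml; apply: eq_bigr => i _.
by rewrite tZ tXi -scalerAl scalerAr.
Qed.

Lemma t_ptI p : ptI (Yop (twist P hgh)) s p -> t 1 p = 0.
Proof.
suff H r s' q : s = r ++ s' -> ptI (Yop (twist P hgh)) s' q -> t 1 q = 0 by apply: (H [::]).
elim: s' r q => [|b s' ih] r q es; first by move=> /= ->; rewrite t0r.
move=> [w hw]; have := ih (rcons r b) _ _ hw; rewrite cat_rcons => /(_ es).
rewrite tDr tNr => /subr0_eq ->.
have hs' : (size s' < n)%N by rewrite -hs es size_cat /= addnS ltnS leq_addl.
rewrite /= /psub /Yop (insubT (fun k => k < n)%N hs') tDr tNr t_twX mulr1 t1Z.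
rewrite t1 /line_coord liftK es rev_cat nth_cat size_rev /= ltnSn.
by rewrite rev_cons nth_rcons size_rev ltnn eqxx subrr.
Qed.

Lemma t_pact (f : {poly C}) p : t 1 (pact (dX (twist P hgh) ord0) f p) = emb C f *: t 1 p.
Proof.
have pD f1 f2 w : pact (dX (twist P hgh) ord0) (f1 + f2) w =
    pact (dX (twist P hgh) ord0) f1 w + pact (dX (twist P hgh) ord0) f2 w.
  by rewrite -[f1]scale1r pactP !scale1r.
elim/poly_ind: f => [|f a ih].
  by rewrite rmorph0 scale0r -[0]/(0%:P) pactC scale0r t0r.
rewrite pD tDr mulrC pactMX pactC t_twX mulr1 t1 ih t1Z scalerA -scalerDl.
by rewrite /line_coord unlift_none rmorphD rmorphM /= -/(rt C) rscaleE mulr1.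
Qed.

(** Denominators can be cleared because multiplication by t is the action of the
    first coordinate on P. *)
Lemma t_common_denominator x : exists f p, f != 0 /\ emb C f *: x = t 1 p.
Proof.
pose Q (x : T) := exists f p, f != 0 /\ emb C f *: x = t 1 p.
have Q0 : Q 0 by exists 1, 0; rewrite oner_eq0 scaler0 t0r.
have Qlin u x1 x2 : Q x1 -> Q x2 -> Q (u *: x1 + x2).
  move=> [f1 [p1 [f10 e1]]] [f2 [p2 [f20 e2]]]; have [a [b [b0 ->]]] := ratfun_frac u.
  exists (b * f1 * f2), (pact (dX (twist P hgh) ord0) (a * f2) p1
    + pact (dX (twist P hgh) ord0) (b * f1) p2).
  split; first by rewrite !mulf_neq0.
  have B0 : emb C b != 0 by rewrite emb_eq0.
  rewrite tDr !t_pact -e1 -e2 scalerDr !scalerA !rmorphM; congr (_ *: _ + _).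
  by field.
apply: (tensor_span (S := Subspace Q0 Qlin) ht) => u p.
have [a [b [b0 ->]]] := ratfun_frac u.
exists b, (pact (dX (twist P hgh) ord0) a p); split=> //.
by rewrite t_pact tK t1 mulrC divfK // emb_eq0.
Qed.

Lemma t_zero p : is_free P -> t 1 p = 0 -> ptI (Yop (twist P hgh)) s p.
Proof. move=> fP; exact: (tensor_kernel (@io_C C n) hgh io_line_map fP hs ht). Qed.
End Tensor.

(** The class of p on the line is an exponential section of the connection, hence
    zero. So 1 (x) p is a boundary over the field of rational functions, and up
    to a nonzero polynomial f(t) already over C. This polynomial is removed by
    [no_torsion]. *)
Lemma no_exponential_class (P : free_resolution M) (T : nat -> lmodType K)
  (t : forall l, K -> P l -> T l) (delta : forall l, {linear T l.+1 -> T l})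
  (nablaT : forall l, {additive T l -> T l}) k (E : lmodType K) (nabla : E -> E)
  (q : T k -> E) p :
  c != 0 ->
  (forall l, [/\
        is_tensor (fun i u => line_map i * u) (dX (P l)) (t l),
        forall u v p, u *: t l v p = t l (u * v) p,
        forall u p, delta l (t l.+1 u p) = t l u (res_d P l p)
      & forall u p, nablaT l (t l u p) =
          t l (rder u) p + \sum_i t l (u * rder (line_map i)) (dD (P l) i p)]) ->
  is_homology delta q ->
  (forall x, is_cycle delta x -> q (nablaT k x) = nabla (q x)) ->
  regular_at (K := affine_line C) (@at_inf C) nabla ->
  tcyc hgh P k s p -> tbnd hgh P k s (dsub c (tw P k) p) -> tbnd hgh P k s p.
Proof.
move=> c0 hT [qlin qsurj qker] qnabla hreg hcyc hE.
have ht l : is_tensor (fun i u => line_map i * u) (dX (P l)) (t l) by case: (hT l).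
have tK l u v p' : u *: t l v p' = t l (u * v) p' by case: (hT l).
have td l u p' : delta l (t l.+1 u p') = t l u (res_d P l p') by case: (hT l).
have tn l u p' : nablaT l (t l u p') =
    t l (rder u) p' + \sum_i t l (u * rder (line_map i)) (dD (P l) i p') by case: (hT l).
have leib l : forall x u, nablaT l (u *: x) = rder u *: x + u *: nablaT l x.
  pose Q (x : T l) := forall u, nablaT l (u *: x) = rder u *: x + u *: nablaT l x.
  have Q0 : Q 0 by move=> u; rewrite !scaler0 raddf0 scaler0 addr0.
  have Qlin v x1 x2 : Q x1 -> Q x2 -> Q (v *: x1 + x2).
    move=> h1 h2 u; rewrite scalerDr scalerA !raddfD /= h1 h2 h1 rder_leibniz.
    by rewrite scalerDl !scalerDr !scalerA !addrA [RHS](ACl (1*3*4*2*5)).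
  apply: (tensor_span (S := Subspace Q0 Qlin) (ht l)) => u p' v.
  rewrite tK !tn rder_leibniz (tDl (ht l)) -addrA tK; congr (_ + _).
  rewrite scalerDr tK scaler_sumr; congr (_ + _); apply: eq_bigr => i _.
  by rewrite tK -mulrA.
have dn l : forall x, delta l (nablaT l.+1 x) = nablaT l (delta l x).
  pose Q (x : T l.+1) := delta l (nablaT l.+1 x) = nablaT l (delta l x).
  have Q0 : Q 0 by rewrite /Q !raddf0.
  have Qlin v x1 x2 : Q x1 -> Q x2 -> Q (v *: x1 + x2).
    by rewrite /Q => h1 h2; rewrite raddfD leib !linearD !linearZ /= raddfD leib h1 h2.
  apply: (tensor_span (S := Subspace Q0 Qlin) (ht l.+1)) => u p'.
  rewrite /= /Q tn linearD linear_sum td td tn; congr (_ + _); apply: eq_bigr => i _.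
  by rewrite /= td; congr (t l _ _); exact: (@res_dhom _ _ _ P l (inr i)).
have cyc_n l (x : T l) : is_cycle delta x -> is_cycle delta (nablaT l x).
  by case: l x => //= l x e; rewrite dn e raddf0.
have cyc_lin l u (x y : T l) : is_cycle delta x -> is_cycle delta y -> is_cycle delta (u *: x + y).
  by case: l x y => //= l x y e1 e2; rewrite linearP e1 e2 scaler0 addr0.
have cyc0 l : is_cycle delta (0 : T l) by case: l => //= l; rewrite linear0.
have qD x y : is_cycle delta x -> is_cycle delta y -> q (x + y) = q x + q y.
  by move=> h1 h2; rewrite -[x]scale1r qlin // !scale1r.
have q0 : q 0 = 0 by have := qD 0 0 (cyc0 k) (cyc0 k); rewrite addr0 => /(canLR (addrK _)); rewrite subrr.
have qZ u x : is_cycle delta x -> q (u *: x) = u *: q x.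
  by move=> h1; rewrite -[u *: x]addr0 qlin // q0 addr0.
have nD x y : nabla (x + y) = nabla x + nabla y.
  have [x' cx <-] := qsurj x; have [y' cy <-] := qsurj y.
  rewrite -qD // -!qnabla // ?raddfD ?qD //; try exact: cyc_n.
  by rewrite -[x']scale1r; apply: cyc_lin.
have nZ u x : nabla (u *: x) = rder u *: x + u *: nabla x.
  have [x' cx <-] := qsurj x; rewrite -qZ // -!qnabla //.
    by rewrite leib qlin ?qZ //; [exact: cyc_n | rewrite -[_ *: _]addr0; apply: cyc_lin => //; apply: cyc_n].
  by rewrite -[_ *: _]addr0; apply: cyc_lin.
pose z := t k 1 p.
have cz : is_cycle delta z.
  rewrite /z; case: (k) (p) hcyc => //= l p' hc; rewrite td; exact: (t_ptI (ht l) (tK l) hc).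
have [w hw] := hE.
have ew : t k 1 (dsub c (tw P k) p) = delta k (t k.+1 1 w).
  by apply/eqP; rewrite td -subr_eq0 -(tNr (ht k)) -(tDr (ht k)); apply/eqP/(t_ptI (ht k) (tK k) hw).
have nz : nablaT k z = (c%:A : K) *: z + delta k (t k.+1 1 w).
  rewrite -ew dsubE (tDr (ht k)) (tNr (ht k)) (t1Z (ht k) (tK k)) addrCA subrr addr0.
  rewrite /z tn -(scale1r 1) rder_C (t0l (ht k)) add0r scale1r /=.
  rewrite (t_sumr (ht k)); apply: eq_bigr => i _.
  by rewrite (tZ (ht k)) line_map_der mul1r mxE.
have ddT l : forall x, delta l (delta l.+1 x) = 0.
  pose S := ker_sub (delta l \o delta l.+1 : {linear T l.+2 -> T l}).
  apply: (tensor_span (S := S) (ht l.+2)) => u p'.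
  by rewrite /S /= !td res_dd (t0r (ht l)).
have cd l (x : T l.+1) : is_cycle delta (delta l x) by case: l x => //= l x; apply: ddT.
have qd x : q (delta k x) = 0 by apply/(qker _ (cd k x)); exists x.
have ez : q z = 0.
  apply: (exponential_irregular nD nZ c0 hreg).
  by rewrite -qnabla // nz qlin // qd addr0.
have [y ey] : exists y, z = delta k y by apply/(qker _ cz).
have [f [w' [f0 ef]]] := t_common_denominator (ht k.+1) (tK k.+1) y.
have h1 : ptI (Yop (tw P k)) s (pact (dX (tw P k) ord0) f p - res_d P k w').
  apply: (t_zero (ht k) (res_free P k)).
  rewrite (tDr (ht k)) (tNr (ht k)) (t_pact (ht k) (tK k)) -td -ef linearZ /= -ey.
  by rewrite subrr.
apply: (no_torsion (A := dX (tw P k) ord0) (B := dsub c (tw P k)) _ _ _ f0 hE).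
- move=> v; rewrite !dsubE dDX scale1r [dX _ _ (_ - _)]linearB.
  by rewrite [dX _ _ (c *: v)]linearZ addrAC.
- by move=> v; apply: tbnd_X0.
- by move=> v; apply: tbnd_E.
by exists w'.
Qed.
End LineTensor.

Section CombSpan.
Variables (C : fieldType) (V : lmodType C) (e : nat -> V).

Lemma comb_gen j : exists k c, e j = comb e k c.
Proof.
exists j.+1, (fun i => (i == j)%:R); rewrite /comb big_ord_recr /= eqxx scale1r.
rewrite big1 ?add0r // => i _.
by rewrite (ltn_eqF (ltn_ord i)) scale0r.
Qed.

Lemma comb_lin a k c l d : exists m f, a *: comb e k c + comb e l d = comb e m f.
Proof.
rewrite (comb_widen e c (leq_maxl k l)) (comb_widen e d (leq_maxr k l)).
exists (maxn k l), (fun i => a * (if (i < k)%N then c i else 0) + (if (i < l)%N then d i else 0)).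
rewrite /comb scaler_sumr -big_split; apply: eq_bigr => i _.
by rewrite scalerDl scalerA.
Qed.

Lemma comb_sum I (r : seq I) (a : I -> C) (f : I -> nat) :
  exists k c, \sum_(i <- r) a i *: e (f i) = comb e k c.
Proof.
elim: r => [|i r [k [c ih]]].
  by exists 0%N, (fun=> 0); rewrite big_nil /comb big_ord0.
have [l [d ed]] := comb_gen (f i); rewrite big_cons ih ed; exact: comb_lin.
Qed.
End CombSpan.

(** There are only countably many words in the letters. *)
Lemma finitely_generated_ctbl (C : fieldType) n (M : dmodule C n) r (v : 'I_r -> M) :
  (forall m, exists k, bernstein_filt v k m) -> ctbl (fun=> True) (zero_sub M).
Proof.
move=> hv; pose e j := if unpickle j is Some u then dword (M := M) u.1 (v u.2) else 0.
exists e => m _; have [k [s [_ ->]]] := hv m.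
have [l [c ec]] := comb_sum e s (fun u => u.1.1) (fun u => pickle (u.1.2, u.2)).
exists l, c; rewrite -ec /= -sumrB big1 // => u _.
by rewrite /e pickleK subrr.
Qed.

(** The D-module generated by an exponential section would restrict, on a
    suitable line, to a connection with an irregular singularity at infinity. *)
Theorem no_exponential_section (R : realType) (n : nat) (M : dmodule R[i] n.+1)
  (g h : 'M[R[i]]_n.+1) (hgh : g *m h = 1%:M) (c : R[i]) (m : M) :
  regular_holonomic M -> c != 0 -> dD (twist M hgh) ord0 m = c *: m -> m = 0.
Proof.
move=> [[r [v [hv _]]] hreg] c0 hm; apply: contrapT => m0.
(* A constant map of the line serves to get hold of some free resolution. *)
have [_ [_ [[P _] _]]] := hreg (affine_line R[i]) (fun=> 0) 0%N.
have hm' : dsub c (twist M hgh) m = 0 by rewrite dsubE hm subrr.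
have [s [k [p [hs h1 h2 h3]]]] := top_class P (@complex_uncountable R)
  (finitely_generated_ctbl hv) m0 hm'.
have [E [nabla [[P' [T [t [delta [nablaT [hT [q [hq hqn]]]]]]]] hreg']]] :=
  hreg (affine_line R[i]) (line_map h s) k.
have [p' [h1' h2' h3']] := top_class_indep P' h1 h2 h3.
apply: h2'.
exact: (no_exponential_class hs c0 hT hq hqn (hreg' _ (at_inf_place _)) h1' h3').
Qed.

(** * Eventually polynomial functions *)

Definition evpoly (f : nat -> nat) :=
  exists (p : {poly rat}) (k0 : nat), forall k, (k0 <= k)%N -> (f k)%:R = p.[k%:R].

Lemma evpoly_eq f f' k1 : (forall k, (k1 <= k)%N -> f k = f' k) -> evpoly f' -> evpoly f.
Proof.
move=> e [p [k0 h]]; exists p, (maxn k0 k1) => k; rewrite geq_max => /andP[h0 h1].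
by rewrite e // h.
Qed.

Lemma evpoly_const a : evpoly (fun=> a).
Proof. by exists (a%:R)%:P, 0%N => k _; rewrite hornerC. Qed.

Lemma evpoly_add f f' : evpoly f -> evpoly f' -> evpoly (fun k => f k + f' k)%N.
Proof.
move=> [p [k0 h]] [p' [k1 h']]; exists (p + p'), (maxn k0 k1) => k.
by rewrite geq_max => /andP[h0 h1]; rewrite natrD hornerD h // h'.
Qed.

Lemma evpoly_sum n (f : 'I_n -> nat -> nat) :
  (forall i, evpoly (f i)) -> evpoly (fun k => \sum_(i < n) f i k)%N.
Proof.
elim: n f => [|n ih] f hf.
  by apply: (@evpoly_eq _ (fun=> 0%N) 0) (evpoly_const 0) => k _; rewrite big_ord0.
apply: (@evpoly_eq _ _ 0) (evpoly_add (ih (fun i => f (widen_ord (leqnSn n) i)) _) (hf ord_max)) => //.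
by move=> k _; rewrite big_ord_recr.
Qed.

Lemma evpoly_shift f j : evpoly f -> evpoly (fun k => f (k - j)%N).
Proof.
move=> [p [k0 h]]; exists (p \Po ('X - j%:R%:P)), (k0 + j)%N => k hk.
have hj : (j <= k)%N by apply: leq_trans hk; apply: leq_addl.
by rewrite horner_comp !hornerE -natrB // h // leq_subRL // addnC.
Qed.

(** Discrete antiderivatives: the falling factorials B_n = X (X - 1) .. (X - n + 1)
    satisfy B_(n+1)(x + 1) - B_(n+1)(x) = (n + 1) B_n(x). *)
Lemma poly_antidifference (p : {poly rat}) :
  exists q : {poly rat}, forall k : nat, \sum_(i < k) p.[i%:R] = q.[k%:R].
Proof.
pose B n : {poly rat} := \prod_(i < n) ('X - (i%:R)%:P).
have BE n x : (B n).[x] = \prod_(i < n) (x - i%:R).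
  by rewrite horner_prod; apply: eq_bigr => i _; rewrite !hornerE.
have BS n (x : rat) : (B n.+1).[x + 1] - (B n.+1).[x] = n.+1%:R * (B n).[x].
  rewrite !BE big_ord_recl [in X in _ - X]big_ord_recr /= subr0.
  rewrite (eq_bigr (fun i : 'I_n => x - i%:R)) => [|i _]; last first.
    by rewrite /bump /= natrD; ring.
  rewrite -natr1; set P := \prod_(i < n) _; ring.
have Bs n : size (B n) = n.+1.
  by rewrite /B -(big_mkord xpredT (fun i => 'X - (i%:R)%:P)) size_prod_XsubC size_iota subn0.
have Bm n : B n != 0 by rewrite -size_poly_gt0 Bs.
have [k] := ubnP (size p); elim: k p => // k ih p hp.
case: (eqVneq p 0) => [->|p0].
  by exists 0 => l; rewrite big1 ?hornerE // => i _; rewrite hornerE.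
have sp : (0 < size p)%N by rewrite size_poly_gt0.
set n := (size p).-1; have en : size p = n.+1 by rewrite prednK.
pose c := p`_n / lead_coef (B n).
have [|q hq] := ih (p - c%:P * B n).
  have := @size_sub_lead _ p (B n); rewrite Bs en /= -/c leqnn => /(_ isT (Bm n)) h.
  by apply: leq_ltn_trans h _; move: hp; rewrite en.
exists (q + (c / n.+1%:R)%:P * B n.+1) => l.
have -> : \sum_(i < l) p.[i%:R] = \sum_(i < l) (p - c%:P * B n).[i%:R] + \sum_(i < l) c * (B n).[i%:R].
  by rewrite -big_split; apply: eq_bigr => i _ /=; rewrite !hornerE subrK.
rewrite hq hornerD hornerM hornerC; congr (_ + _).
elim: l => [|l ihl].
  by rewrite big_ord0 BE big_ord_recl subrr mul0r mulr0.
rewrite big_ord_recr /= ihl -[l.+1%:R]natr1.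
have n0 : n.+1%:R != 0 :> rat by rewrite pnatr_eq0.
have -> : (B n.+1).[l%:R + 1] = (B n.+1).[l%:R] + n.+1%:R * (B n).[l%:R] by rewrite -BS addrCA subrr addr0.
by field; rewrite addrC natr1.
Qed.

Lemma evpoly_cumul f : evpoly f -> evpoly (fun k => \sum_(i < k.+1) f i)%N.
Proof.
move=> [p [k0 h]]; have [q hq] := poly_antidifference p.
exists ((q \Po ('X + 1%:P)) + (\sum_(i < k0) ((f i)%:R - p.[i%:R]))%:P), k0 => k hk.
rewrite hornerD horner_comp !hornerE natr1 -hq natr_sum.
rewrite -(big_mkord xpredT (fun i => (f i)%:R)) -(big_mkord xpredT (fun i => p.[i%:R])).
rewrite !(big_cat_nat (leq0n k0) (leqW hk)) /= sumrB !big_mkord.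
rewrite (eq_big_nat _ _ (F2 := fun i => p.[i%:R])) => [|i /andP[hi _]]; last exact: h.
by rewrite addrAC [X in _ = X + _]addrCA subrr addr0 addrC.
Qed.

(** ** Counting the elements of bounded degree of an order ideal of N^m *)

Fixpoint multidegs (m k : nat) : seq (seq nat) :=
  if m is m'.+1 then flatten [seq map (cons j) (multidegs m' (k - j)%N) | j <- iota 0 k.+1]
  else [:: [::]].

Lemma multidegsS m k : multidegs m.+1 k =
  flatten [seq map (cons j) (multidegs m (k - j)%N) | j <- iota 0 k.+1].
Proof. by []. Qed.

Lemma mem_multidegs m k s : (s \in multidegs m k) = (size s == m) && (sumn s <= k)%N.
Proof.
elim: m k s => [|m ih] k s; first by rewrite inE; case: s.
rewrite multidegsS; apply/flatten_mapP/andP => [[j]|].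
  rewrite mem_iota add0n ltnS => hj /mapP[t]; rewrite ih => /andP[/eqP st ht] ->.
  by rewrite /= st eqxx -leq_subRL.
case: s => [|j s] [] //= /eqP[ss] hs; have hj : (j <= k)%N by apply: leq_trans hs; apply: leq_addr.
exists j; first by rewrite -[0%N :: _]/(iota 0 k.+1) mem_iota ltnS.
by apply/mapP; exists s => //; rewrite ih ss eqxx leq_subRL.
Qed.

Lemma multidegs_uniq m k : uniq (multidegs m k).
Proof.
elim: m k => // m ih k; rewrite multidegsS; apply: allpairs_uniq_dep => //.
- exact: iota_uniq.
- move=> [j s] [j' s'] _ _ /= [-> es].
  by rewrite es.
Qed.

Definition order_ideal m (S : seq nat -> bool) :=
  forall s s', size s = m -> all2 leq s' s -> S s -> S s'.

Lemma all2_leq_refl s : all2 leq s s.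
Proof. by elim: s => //= j s ->; rewrite leqnn. Qed.

(** Noetherianity of N^m, by induction on m: the diagonal slices are stationary
    from some J0 on, and so is each of the finitely many slices below J0. *)
Lemma order_ideals_stationary m (S : nat -> seq nat -> bool) :
  (forall j, order_ideal m (S j)) -> (forall j s, size s = m -> S j.+1 s -> S j s) ->
  exists J, forall j s, (J <= j)%N -> size s = m -> S j s = S J s.
Proof.
elim: m S => [|m ih] S hS hd.
  case: (pselect (exists j, ~~ S j [::])) => [[J hJ]|no].
    exists J => j s hj /size0nil ->; rewrite (negbTE hJ).
    rewrite -(subnK hj); elim: (j - J)%N => [|l ihl]; first exact: negbTE.
    by apply/negP => /(hd _ [::] erefl); rewrite ihl.
  exists 0%N => j s _ /size0nil ->; have a i : S i [::].
    by apply: contrapT => h; apply: no; exists i; apply/negP.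
  by rewrite !a.
have mono i j s : (i <= j)%N -> size s = m.+1 -> S j s -> S i s.
  by move=> /subnK <- ss; elim: (j - i)%N => // l ihl /(hd _ _ ss)/ihl.
have down j i i' s : (i <= i')%N -> size s = m -> S j (i' :: s) -> S j (i :: s).
  by move=> hi ss; apply: hS; rewrite /= ?ss // hi all2_leq_refl.
have [j s s' ss ls||J0 hJ0] := ih (fun i s => S i (i :: s)).
- by apply: (hS j (j :: s) (j :: s')); rewrite /= ?ss // leqnn.
- by move=> j s ss /(down _ _ _ _ (leqnSn j) ss); apply: hd; rewrite /= ss.
have sl i : exists J, forall j s, (J <= j)%N -> size s = m -> S j (i :: s) = S J (i :: s).
  apply: (ih (fun j s => S j (i :: s))) => [j s s' ss ls|j s ss].
    by apply: (hS j (i :: s) (i :: s')); rewrite /= ?ss // leqnn.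
  by apply: hd; rewrite /= ss.
pose Ji i := sval (cid (sl i)).
have JiP i j s : (Ji i <= j)%N -> size s = m -> S j (i :: s) = S (Ji i) (i :: s).
  by rewrite /Ji; case: cid => J h; apply: h.
(* A slice with i >= J0 is compared with the diagonal slice at J0. *)
exists (maxn J0 (\max_(i < J0) Ji i)) => j [//|i s] hj [ss].
case: (ltnP i J0) => hi.
  have h1 : (Ji i <= maxn J0 (\max_(i < J0) Ji i))%N.
    by rewrite leq_max (leq_bigmax (Ordinal hi)) orbT.
  by rewrite !JiP // (leq_trans h1).
set J := maxn _ _ in hj *; have hJ : (J0 <= J)%N by apply: leq_maxl.
have main l : (J0 <= l)%N -> S l (i :: s) = S J0 (J0 :: s).
  move=> hl; apply/idP/idP => h.
    by apply: mono hl _ (down _ _ _ _ hi ss h); rewrite /= ss.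
  have : S (maxn l i) (maxn l i :: s) by rewrite hJ0 // leq_max hl.
  move=> /(down _ _ _ _ (leq_maxr l i) ss); apply: mono; rewrite ?leq_maxl //= ss.
  by [].
by rewrite !main // (leq_trans hJ).
Qed.

Lemma count_multidegs m S k : count S (multidegs m.+1 k) =
  (\sum_(j < k.+1) count (fun s => S (nat_of_ord j :: s)) (multidegs m (k - j)%N))%N.
Proof.
rewrite multidegsS count_flatten -map_comp sumnE big_map.
rewrite -[RHS](big_mkord xpredT (fun j => count (fun s => S (j :: s)) (multidegs m (k - j)%N))).
by rewrite /index_iota subn0; apply: eq_bigr => j _; rewrite /= count_map.
Qed.

(** The slices of S by the first coordinate are eventually constant. *)
Lemma order_ideal_evpoly m S : order_ideal m S -> evpoly (fun k => count S (multidegs m k)).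
Proof.
elim: m S => [|m ih] S hS; first exact: evpoly_const.
pose Sl j s := S (j :: s).
have hSl j : order_ideal m (Sl j).
  by move=> s s' ss ls; apply: hS; rewrite /= ?ss // leqnn.
have [|J hJ] := order_ideals_stationary hSl.
  by move=> j s ss; apply: hS; rewrite /= ?ss // leqnSn all2_leq_refl.
have e k : (J <= k)%N -> count S (multidegs m.+1 k) =
   ((\sum_(j < J) count (Sl j) (multidegs m (k - j)%N)) +
    \sum_(i < (k - J).+1) count (Sl J) (multidegs m i))%N.
  move=> hk; rewrite count_multidegs.
  rewrite -[LHS](big_mkord xpredT (fun j => count (Sl j) (multidegs m (k - j)%N))).
  rewrite (big_cat_nat (leq0n J) (leqW hk)) /= big_mkord; congr (_ + _)%N.
  rewrite -{1}[J]add0n big_addn subSn // big_mkord [RHS](reindex_inj rev_ord_inj) /=.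
  apply: eq_bigr => i _; rewrite subSS -subnDA addnC.
  apply: eq_in_count => s; rewrite mem_multidegs => /andP[/eqP ss _].
  by rewrite hJ // ?leq_addl ?leq_addr.
apply: (evpoly_eq e); apply: evpoly_add.
  by apply: evpoly_sum => j; apply: (evpoly_shift j (ih _ (hSl j))).
exact: (evpoly_shift J (evpoly_cumul (ih _ (hSl J)))).
Qed.

(** * Bernstein's inequality and modules of minimal growth *)

Section BernsteinFiltration.
Variables (C : fieldType) (n : nat) (M : dmodule C n) (r : nat) (v : 'I_r -> M).

Fact bf0 k : bernstein_filt v k 0.
Proof. by exists [::]; rewrite big_nil. Qed.
Fact bf_lin k c x y : bernstein_filt v k x -> bernstein_filt v k y -> bernstein_filt v k (c *: x + y).
Proof.
move=> [s [hs ->]] [s' [hs' ->]].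
exists (map (fun u => (c * u.1.1, u.1.2, u.2)) s ++ s'); split.
  by rewrite all_cat hs' andbT all_map.
rewrite big_cat big_map scaler_sumr; congr (_ + _); apply: eq_bigr => u _.
by rewrite scalerA.
Qed.
Definition bf k : subspace M := Subspace (bf0 k) (@bf_lin k).

Lemma bf_mono k l x : (k <= l)%N -> bf k x -> bf l x.
Proof.
move=> kl [s [hs ->]]; exists s; split=> //; apply: sub_all hs => u hu.
exact: leq_trans kl.
Qed.

Lemma bf_word k w i : (size w <= k)%N -> bf k (dword w (v i)).
Proof. by move=> hw; exists [:: (1, w, i)]; rewrite big_seq1 scale1r /= hw. Qed.

Lemma bf_dop k s x : bf k x -> bf k.+1 (dop s x).
Proof.
move=> [l [hl ->]]; rewrite linear_sum; rewrite big_seq; apply: sub_sum => u hu.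
rewrite linearZ; apply: subZ.
by apply: (@bf_word _ (s :: u.1.2) u.2); rewrite /= ltnS; apply: (allP hl).
Qed.

Lemma bf_least (F : nat -> subspace M) k x :
  (forall k x, F k x -> F k.+1 x) -> (forall k s x, F k x -> F k.+1 (dop s x)) ->
  (forall i, F 0%N (v i)) -> bf k x -> F k x.
Proof.
move=> Fm Fd Fv [l [hl ->]]; rewrite big_seq; apply: sub_sum => u hu; apply: subZ.
have mono i j y : (i <= j)%N -> F i y -> F j y.
  by move=> /subnK <- h; elim: (j - i)%N => //= p; apply: Fm.
apply: (mono (size u.1.2)); first exact: (allP hl).
by elim: (u.1.2) => //= s w; apply: Fd.
Qed.
End BernsteinFiltration.

Section Bernstein.
Variables (C : numFieldType) (n : nat) (Q : dmodule C n).
Local Notation W := {mpoly C[n + n]}.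

Definition Dstable (S : subspace Q) := forall s m, S m -> S (dop s m).

Lemma wop_stable S (f : W) m : Dstable S -> S m -> S (wop f m).
Proof.
move=> hS hm; apply: opact_sub hm => i w hw; case: (split_ordP i) => j ->.
  by rewrite wl_l; apply: (hS (inl j)).
by rewrite wl_r; apply: (hS (inr j)).
Qed.

(** Up to sign, the commutators with the letters are the derivatives of the symbol. *)
Lemma wop_comm v (f : W) : exists s, forall x : Q,
  wop (mderiv v f) x = dop s (wop f x) - wop f (dop s x) \/
  wop (mderiv v f) x = - (dop s (wop f x) - wop f (dop s x)).
Proof.
case: (split_ordP v) => i ->.
  exists (inr i) => x; left.
  pose ka (k : 'I_(n + n)) : C := if split k is inl j then (i == j)%:R else 0.
  have kal j : ka (lshift n j) = (i == j)%:R by rewrite /ka (unsplitK (inl j)).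
  have kar j : ka (rshift n j) = 0 by rewrite /ka (unsplitK (inr j)).
  rewrite /wop /= (opact_comm (ka := ka)) => [|j w]; last first.
    case: (split_ordP j) => k ->; rewrite ?wl_l ?wl_r ?kal ?kar ?dDX //.
    by rewrite scale0r addr0 dDD.
  rewrite addrAC subrr add0r big_split_ord /= [X in _ + X]big1 ?addr0; last first.
    by move=> j _; rewrite kar scale0r.
  by under eq_bigr do rewrite kal; rewrite sum_delta.
exists (inl i) => x; right.
pose ka (k : 'I_(n + n)) : C := if split k is inr j then - (i == j)%:R else 0.
have kal j : ka (lshift n j) = 0 by rewrite /ka (unsplitK (inl j)).
have kar j : ka (rshift n j) = - (i == j)%:R by rewrite /ka (unsplitK (inr j)).
rewrite /wop /= (opact_comm (ka := ka)) => [|j w]; last first.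
  case: (split_ordP j) => k ->; rewrite ?wl_l ?wl_r ?kal ?kar.
    by rewrite scale0r addr0 dXX.
  by rewrite dDX eq_sym scaleNr addrK.
rewrite addrAC subrr add0r big_split_ord /= big1 ?add0r => [|j _]; last by rewrite kal scale0r.
under eq_bigr do rewrite kar scaleNr; rewrite sumrN opprK sum_delta.
by [].
Qed.

Section Cyclic.
Variable m : Q.

Definition cycf k (x : Q) := exists f : W, (msize f <= k.+1)%N /\ x = wop f m.
Fact cycf0 k : cycf k 0.
Proof. by exists 0; rewrite mmeasure0 /wop opact0. Qed.
Fact cycf_lin k c x y : cycf k x -> cycf k y -> cycf k (c *: x + y).
Proof.
move=> [f [hf ->]] [g [hg ->]]; exists (c *: f + g); split; last by rewrite /wop opactP.
apply: leq_trans (msizeD_le _ _) _; rewrite geq_max hg andbT.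
exact: leq_trans (msizeZ_le _ _) hf.
Qed.
Definition cyc_filt k : subspace Q := Subspace (cycf0 k) (@cycf_lin k).

Lemma cyc_filt_mono k l x : (k <= l)%N -> cyc_filt k x -> cyc_filt l x.
Proof. by move=> kl [f [hf ->]]; exists f; split=> //; apply: leq_trans hf _. Qed.

Lemma cyc_m k : cyc_filt k m.
Proof. by exists 1; split; [rewrite msize1 | rewrite /wop opact1]. Qed.

Lemma cyc_dop k s x : cyc_filt k x -> cyc_filt k.+1 (dop s x).
Proof.
move=> [f [hf ->]]; exists (dop s (f : weyl C n)); rewrite wop_dop; split=> //.
by apply: leq_trans (msize_dop s f) _.
Qed.

Lemma cyc_wop k l (f : W) x : (msize f <= l.+1)%N -> cyc_filt k x -> cyc_filt (k + l) (wop f x).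
Proof.
move=> hf hx; rewrite /wop /opact big_seq; apply: sub_sum => al hal; apply: subZ.
apply: (cyc_filt_mono (k := k + mdeg al)).
  by rewrite leq_add2l -ltnS; apply: leq_trans hf; apply: msize_mdeg_lt.
apply: (mon_filt (F := fun k => cyc_filt k)) => // i j w hw.
case: (split_ordP i) => i' ->; rewrite ?wl_l ?wl_r.
  exact: (cyc_dop (inl i')).
exact: (cyc_dop (inr i')).
Qed.

Lemma cyc_finite k : exists e (w : 'I_e -> Q), forall S x, cyc_filt k x -> span_mod S w x.
Proof.
exists #|{: bmultinom (n + n) k.+1}|, (fun i => mon (wl Q) (bmnm (enum_val i)) m) => S x [f [hf ->]].
rewrite /wop (opactwE _ _ hf); apply: sub_sum => al _; apply: subZ.
rewrite -(enum_rankK al); exact: (span_gen S (fun i => mon (wl Q) (bmnm (enum_val i)) m)).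
Qed.

(** A nonzero operator of order k cannot send the order k part of a nonzero
    module to zero: its commutators with the letters have lower order. *)
Lemma wop_faithful (S : subspace Q) k (f : W) : Dstable S -> ~ S m ->
  (msize f <= k.+1)%N -> (forall x, cyc_filt k x -> S (wop f x)) -> f = 0.
Proof.
move=> hS nm; have const (g : W) : (msize g <= 1)%N -> S (wop g m) -> g = 0.
  move=> /msize1_polyC ->; rewrite /wop opactC => h; case: (eqVneq g@_0 0) => [->|c0].
    by rewrite mpolyC0.
  by case: nm; have := subZ (g@_0)^-1 h; rewrite scalerA mulVf // scale1r.
elim: k f => [|k ih] f hf hk; first by apply: const => //; apply/hk/cyc_m.
have d0 v : mderiv v f = 0.
  apply: ih; first exact: msize_mderiv.
  move=> x hx; have [s hs] := wop_comm v f.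
  have h1 : S (dop s (wop f x) - wop f (dop s x)).
    apply: subB; last by apply/hk/cyc_dop.
    by apply/hS/hk/(cyc_filt_mono (leqnSn k)).
  by case: (hs x) => ->; [|apply: subN].
apply: const; last exact/hk/cyc_m.
apply/msize_leP => al /mdeg_gt0_var [i hi].
have := congr1 (mcoeff (al - U_(i))) (d0 i); rewrite mcoeff_deriv mcoeff0.
rewrite addmC -mnm_split //.
by move/eqP; rewrite mulrn_eq0 => /eqP.
Qed.

Definition box_mon l (a : {ffun 'I_(n + n) -> 'I_l.+1}) : 'X_{1..n + n} :=
  [multinom (a i : nat) | i < n + n].

(** The space spanned by the box of monomials with all exponents at most l maps
    injectively, by [wop_faithful], to the linear maps from the k-th to the 2k-th
    step of the filtration modulo S. *)
Lemma bernstein_inequality (S : subspace Q) l d (u : 'I_d -> Q) e (w : 'I_e -> Q) :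
  Dstable S -> ~ S m -> let k := ((n + n) * l)%N in
  (forall i, cyc_filt k (u i)) -> (forall x, cyc_filt k x -> span_mod S u x) ->
  (forall x, cyc_filt (k + k) x -> span_mod S w x) -> (l.+1 ^ (n + n) <= d * e)%N.
Proof.
move=> hS nm k hu ku kw; rewrite leqNgt; apply/negP => lt.
have bk a : (mdeg (@box_mon l a) <= k)%N.
  rewrite mdegE /k -[X in (_ <= X * _)%N]card_ord -sum_nat_const leq_sum // => i _.
  by rewrite mnmE -ltnS ltn_ord.
have hb b i : cyc_filt (k + k) (wop 'X_[@box_mon l b] (u i)).
  by apply: cyc_wop (hu i); rewrite mmeasureX ltnS; apply: bk.
pose a b (p : 'I_d * 'I_e) : C := sval (cid (kw _ (hb b p.1))) p.2.
have [|c [[b0 cb0] hc]] := @underdetermined C {ffun 'I_(n + n) -> 'I_l.+1} ('I_d * 'I_e)%type a.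
  by rewrite card_prod card_ffun !card_ord.
pose f : W := \sum_b c b *: 'X_[box_mon b].
have fk : (msize f <= k.+1)%N.
  apply: leq_trans (msize_sum _ _ _) _; apply/bigmax_leqP => b _.
  by apply: leq_trans (msizeZ_le _ _) _; rewrite mmeasureX ltnS; apply: bk.
have f0 : f = 0.
  apply: (wop_faithful hS nm fk) => x /ku [y hy].
  rewrite -(subrK (\sum_i y i *: u i) x) linearD; apply: subD; first exact: wop_stable.
  rewrite linear_sum; apply: sub_sum => i _; rewrite linearZ /=; apply: subZ.
  rewrite /wop /f opact_sum.
  have -> : \sum_b opact (wl Q) (c b *: 'X_[box_mon b]) (u i) =
     \sum_b c b *: (wop 'X_[box_mon b] (u i) - \sum_j a b (i, j) *: w j).
    under [RHS]eq_bigr do rewrite scalerBr; rewrite sumrB.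
    rewrite [X in _ - X](_ : _ = 0) ?subr0.
      by apply: eq_bigr => b _; rewrite opactZ.
    under eq_bigr do rewrite scaler_sumr; rewrite exchange_big big1 // => j _ /=.
    under eq_bigr do rewrite scalerA; rewrite -scaler_suml hc scale0r.
    by [].
  apply: sub_sum => b _; apply: subZ; rewrite /a /=; by case: cid.
have := congr1 (mcoeff (box_mon b0)) f0; rewrite mcoeff0 raddf_sum (bigD1 b0) //=.
rewrite mcoeffZ mcoeffX eqxx mulr1 big1 ?addr0 => [/eqP|b nb]; first by rewrite (negbTE cb0).
rewrite mcoeffZ mcoeffX; case: eqP => [e1|_]; last by rewrite mulr0.
case/eqP: nb; apply/ffunP => i; apply: val_inj.
by have := congr1 (fun z : 'X_{1..n + n} => z i) e1; rewrite !mnmE.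
Qed.
End Cyclic.
End Bernstein.

(** ** Modules with a filtration of minimal growth *)

Section MinimalGrowth.
Variables (C : numFieldType) (n : nat) (Q : dmodule C n).

Definition gen (ms : seq Q) (x : Q) :=
  forall S : subspace Q, Dstable S -> (forall m, m \in ms -> S m) -> S x.
Fact gen0 ms : gen ms 0.
Proof. by move=> S _ _; apply: sub0. Qed.
Fact gen_lin ms c x y : gen ms x -> gen ms y -> gen ms (c *: x + y).
Proof. by move=> hx hy S h1 h2; apply: sub_lin; [apply: hx | apply: hy]. Qed.
Definition gen_sub ms : subspace Q := Subspace (@gen0 ms) (@gen_lin ms).

Lemma gen_stable ms : Dstable (gen_sub ms).
Proof. by move=> s m hm S h1 h2; apply: (h1); apply: hm. Qed.
Lemma gen_mem ms m : m \in ms -> gen_sub ms m.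
Proof. by move=> hm S _; apply. Qed.
Lemma gen_mono ms m x : gen_sub ms x -> gen_sub (m :: ms) x.
Proof. by move=> hx S h1 h2; apply: hx => // y hy; apply: h2; rewrite inE hy orbT. Qed.

Fixpoint strict_chain (ms : seq Q) : Prop :=
  if ms is m :: ms' then ~ gen_sub ms' m /\ strict_chain ms' else True.

Variables (G : nat -> subspace Q) (A : nat).
Hypothesis Gmono : forall k x, G k x -> G k.+1 x.
Hypothesis Gdop : forall k s x, G k x -> G k.+1 (dop s x).
Hypothesis Gexh : forall x, exists k, G k x.
Hypothesis Ggrowth : forall k d (u : 'I_d -> Q), (forall i, G k (u i)) ->
  indep (zero_sub Q) u -> (d <= A * k.+1 ^ n)%N.

Lemma G_mono k l x : (k <= l)%N -> G k x -> G l x.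
Proof. by move=> /subnK <- h; elim: (l - k)%N => //= p; apply: Gmono. Qed.

Lemma cyc_G m K k x : G K m -> cyc_filt m k x -> G (K + k)%N x.
Proof.
move=> hm [f [hf ->]]; rewrite /wop /opact big_seq; apply: sub_sum => al hal; apply: subZ.
apply: (G_mono (k := (K + mdeg al)%N)).
  by rewrite leq_add2l -ltnS; apply: leq_trans hf; apply: msize_mdeg_lt.
apply: (mon_filt (F := fun k => G k)) => // i j w hw.
case: (split_ordP i) => i' ->; rewrite ?wl_l ?wl_r.
  exact: (Gdop (inl i')).
exact: (Gdop (inr i')).
Qed.

(** Each step of a chain of submodules contributes at least its share, given by
    Bernstein's inequality, to the growth of the filtration. *)
Lemma chain_growth K l ms : strict_chain ms -> (forall m, m \in ms -> G K m) ->
  let k := ((n + n) * l)%N in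
  exists d (u : 'I_d -> Q), [/\ forall i, G (K + k)%N (u i), forall i, gen_sub ms (u i),
    indep (zero_sub Q) u & (size ms * l.+1 ^ (n + n) <= d * (A * (K + (k + k)).+1 ^ n))%N].
Proof.
move=> + + k; elim: ms => [|m ms ih] /=.
  by move=> _ _; exists 0%N, (fun=> 0); split=> [[]|[]|c _ []|].
move=> [nm hms] hG; have [|d [u [uG ugen iu hd]]] := ih hms.
  by move=> x hx; apply: hG; rewrite inE hx orbT.
have hm : G K m by apply: hG; rewrite mem_head.
have [e0 [w0 hw0]] := cyc_finite m k; have [e1 [w1 hw1]] := cyc_finite m (k + k).
have [d' [u' [u'k iu' su']]] := basis_exists (hw0 (gen_sub ms)).
have [e [w [wk iw sw]]] := basis_exists (hw1 (gen_sub ms)).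
have hB := bernstein_inequality (@gen_stable ms) nm u'k su' sw.
have he : (e <= A * (K + (k + k)).+1 ^ n)%N.
  by apply: (Ggrowth (u := w)) (indep_zero iw) => i; apply: (cyc_G hm).
exists (d' + d)%N, (fun i : 'I_(d' + d) => match split i with inl j => u' j | inr j => u j end).
split.
- by move=> i; case: (split i) => j //; apply: (cyc_G hm).
- move=> i; case: (split i) => j; last exact: gen_mono.
  have [f [_ ->]] := u'k j; apply: (@wop_stable _ _ _ (gen_sub (m :: ms))); first exact: gen_stable.
  by apply: gen_mem; rewrite mem_head.
- exact: (indep_cat iu').
rewrite mulSn mulnDl leq_add //; apply: leq_trans hB _.
by rewrite leq_mul2l he orbT.
Qed.

(** For l = K all terms are of the order of K^(2n), up to constants that do not
    depend on K. *)
Lemma chain_bounded ms : strict_chain ms -> (size ms <= A * A * (4 * n).+1 ^ (n + n))%N.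
Proof.
move=> hms; have [K hK] : exists K, forall m, m \in ms -> G K m.
  elim: ms {hms} => [|m ms [K hK]]; first by exists 0%N.
  have [k hk] := Gexh m; exists (maxn k K) => x; rewrite inE => /orP[/eqP ->|/hK hx].
    by apply: G_mono hk; apply: leq_maxl.
  by apply: G_mono hx; apply: leq_maxr.
have [d [u [uG _ iu hd]]] := chain_growth K hms hK.
have {}iu := Ggrowth uG iu; set k := ((n + n) * K)%N in iu hd.
(* As k = 2nK, the steps K + k and K + 2k are at most (4n + 1)(K + 1). *)
have b1 : ((K + k).+1 <= (4 * n).+1 * K.+1)%N by rewrite /k; nia.
have b2 : ((K + (k + k)).+1 <= (4 * n).+1 * K.+1)%N by rewrite /k; nia.
have hX : (0 < K.+1 ^ (n + n))%N by rewrite expn_gt0.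
rewrite -(leq_pmul2r hX); apply: leq_trans hd _; apply: leq_trans (leq_mul iu (leqnn _)) _.
rewrite mulnACA -(mulnA (A * A)) leq_mul2l; apply/orP; right.
have ex a b : (a <= b)%N -> (a ^ n <= b ^ n)%N by case: (n) => // n'; rewrite leq_exp2r.
by rewrite -[X in (_ <= X)%N]expnMn expnD leq_mul // ex.
Qed.

(** Otherwise there would be strict chains of any length. *)
Lemma finitely_generated : exists ms : seq Q, forall x, gen_sub ms x.
Proof.
apply: contrapT => no.
have h r : exists ms, size ms = r /\ strict_chain ms.
  elim: r => [|r [ms [sm hms]]]; first by exists [::].
  have [x nx] : exists x, ~ gen_sub ms x.
    by apply: contrapT => h; apply: no; exists ms => x; apply: contrapT => nx; apply: h; exists x.
  by exists (x :: ms); rewrite /= sm.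
have [ms [sm hms]] := h (A * A * (4 * n).+1 ^ (n + n)).+1.
by have := chain_bounded hms; rewrite sm ltnn.
Qed.

(** The generators lie in some step of G, and the letters raise G by one step. *)
Lemma finitely_generated_bf : exists r (v : 'I_r -> Q),
  (forall x, exists k, bernstein_filt v k x) /\
  exists K, forall k x, bernstein_filt v k x -> G (K + k)%N x.
Proof.
have [ms hms] := finitely_generated.
exists (size ms), (fun i => nth 0 ms i); set v := fun i => _; split.
  have S0 : exists k, bf v k 0 by exists 0%N; apply: sub0.
  have Slin c x y : (exists k, bf v k x) -> (exists k, bf v k y) -> exists k, bf v k (c *: x + y).
    move=> [k hk] [l hl]; exists (maxn k l); apply: sub_lin.
      by apply: bf_mono hk; apply: leq_maxl.
    by apply: bf_mono hl; apply: leq_maxr.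
  move=> x; apply: (hms x (Subspace S0 Slin)) => /=.
    by move=> s m [k hk]; exists k.+1; apply: bf_dop.
  move=> m /(nthP 0) [i hi <-]; exists 0%N.
  by have := @bf_word _ _ _ _ v 0 [::] (Ordinal hi) isT.
have [K hK] : exists K, forall i, G K (v i).
  have hi i := Gexh (v i); pose Ki i := sval (cid (hi i)).
  exists (\max_i Ki i) => i; apply: (G_mono (leq_bigmax i)).
  by rewrite /Ki; case: cid.
exists K => k x hx; apply: (bf_least (F := fun k => G (K + k)%N) (v := v)) hx.
- by move=> j y hy; rewrite addnS; apply: Gmono.
- by move=> j s y hy; rewrite addnS; apply: Gdop.
by move=> i; rewrite addn0.
Qed.
End MinimalGrowth.

(** * Hilbert functions *)

Section Hilbert.
Variables (C : fieldType) (n : nat) (M : dmodule C n) (r : nat) (v : 'I_r -> M).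
Local Notation mnm := 'X_{1..n + n}.
Implicit Types u w : mnm * 'I_r.

Definition emon u : M := mon (wl M) u.1 (v u.2).

(** Graded lexicographic order on monomials, refined by the generators. *)
Definition plt u w := (u.1 < w.1)%O || ((u.1 == w.1) && (u.2 < w.2)%N).

Lemma plt_trans w u u' : plt u w -> plt w u' -> plt u u'.
Proof.
rewrite /plt => /orP[h1|/andP[/eqP e1 h1]] /orP[h2|/andP[/eqP e2 h2]].
- by rewrite (lt_trans h1 h2).
- by rewrite -e2 h1.
- by rewrite e1 h2.
by rewrite e1 e2 eqxx (ltn_trans h1 h2) orbT.
Qed.

Lemma plt_total u w : u != w -> plt u w || plt w u.
Proof.
case: u w => [a i] [b j] /=; rewrite /plt /= => ne; case: (ltgtP a b) => //= e.
by move: ne; rewrite e xpair_eqE eqxx /= -val_eqE neq_ltn => /orP[->|->]; rewrite ?orbT.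
Qed.

Lemma plt_wf (P : mnm * 'I_r -> Prop) :
  (forall w, (forall u, plt u w -> P u) -> P w) -> forall w, P w.
Proof.
move=> h [al i]; elim/(well_founded_ind (@ltom_wf (n + n))): al i => al ih i.
have [k] := ubnP i; elim: k i => // k ihk i hi; apply: h => -[be j] /orP[/ih//|/andP[/= /eqP -> hj]].
by apply: ihk; apply: leq_trans hj _.
Qed.

Lemma plt_max (s : seq (mnm * 'I_r)) : s != [::] ->
  exists2 w, w \in s & forall u, u \in s -> u != w -> plt u w.
Proof.
elim: s => // x [|y s] ih _; first by exists x; rewrite ?mem_head // => u; rewrite inE => /eqP ->; rewrite eqxx.
have [w hw hmax] := ih isT; case: (boolP (plt w x)) => hx.
  exists x; first exact: mem_head.
  move=> u; rewrite inE => /orP[/eqP ->|hu _]; first by rewrite eqxx.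
  by case: (eqVneq u w) => [->//|nu]; apply: plt_trans hx; apply: hmax.
exists w; first by rewrite inE hw orbT.
move=> u; rewrite inE => /orP[/eqP -> nx|/hmax]; last exact.
by have := plt_total nx; rewrite (negbTE hx) orbF.
Qed.

Definition mspan (P : mnm * 'I_r -> Prop) (x : M) :=
  exists s : seq (C * (mnm * 'I_r)), (forall t, t \in s -> P t.2) /\ x = \sum_(t <- s) t.1 *: emon t.2.
Fact mspan0 P : mspan P 0.
Proof. by exists [::]; rewrite big_nil. Qed.
Fact mspan_lin P c x y : mspan P x -> mspan P y -> mspan P (c *: x + y).
Proof.
move=> [s [hs ->]] [s' [hs' ->]]; exists (map (fun t => (c * t.1, t.2)) s ++ s'); split.
  by move=> t; rewrite mem_cat => /orP[/mapP[t' /hs ht ->]|/hs'].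
rewrite big_cat big_map scaler_sumr; congr (_ + _); apply: eq_bigr => t _.
by rewrite scalerA.
Qed.
Definition msp P : subspace M := Subspace (@mspan0 P) (@mspan_lin P).

Lemma msp_gen (P : mnm * 'I_r -> Prop) u : P u -> msp P (emon u).
Proof.
move=> h; exists [:: (1, u)]; rewrite big_seq1 scale1r; split=> // t.
by rewrite inE => /eqP ->.
Qed.

Lemma msp_le (P : mnm * 'I_r -> Prop) (S : subspace M) x :
  (forall u, P u -> S (emon u)) -> msp P x -> S x.
Proof.
move=> h [s [hs ->]]; rewrite big_seq; apply: sub_sum => t ht; apply: subZ.
by apply/h/hs.
Qed.

Lemma msp_mono (P P' : mnm * 'I_r -> Prop) x : (forall u, P u -> P' u) -> msp P x -> msp P' x.
Proof. by move=> h; apply: msp_le => u /h; apply: msp_gen. Qed.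

Lemma wop_msp (f : {mpoly C[n + n]}) k i : (msize f <= k)%N ->
  msp (fun u => (mdeg u.1 < k)%N) (wop f (v i)).
Proof.
move=> hf; rewrite /wop /opact big_seq; apply: sub_sum => al hal; apply: subZ.
apply: (@msp_gen _ (al, i)) => /=; apply: leq_trans hf; exact: msize_mdeg_lt.
Qed.

Lemma bf_msp k x : bf v k x <-> msp (fun u => (mdeg u.1 <= k)%N) x.
Proof.
split; last first.
  apply: msp_le => -[al i] /= hal; apply: (bf_mono hal).
  apply: (mon_filt (F := fun k => bf v k) (k := 0%N)); last first.
    by have := @bf_word _ _ _ _ v 0 [::] i isT.
  move=> j l w hw; case: (split_ordP j) => j' ->; rewrite ?wl_l ?wl_r.
    exact: (bf_dop (inl j')).
  exact: (bf_dop (inr j')).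
move=> [s [hs ->]]; rewrite big_seq; apply: sub_sum => t ht; apply: subZ.
have h (w : seq ('I_n + 'I_n)) i : exists f : {mpoly C[n + n]},
    (msize f <= (size w).+1)%N /\ dword w (v i) = wop f (v i).
  elim: w => [|a w [f [hf e]]] /=; first by exists 1; rewrite msize1 wop1.
  exists (dop a (f : weyl C n)); rewrite wop_dop -e; split=> //.
  exact: leq_trans (msize_dop a f) _.
have [f [hf ->]] := h t.1.2 t.2; apply: (@wop_msp f k.+1 t.2).
by apply: leq_trans hf _; rewrite ltnS; apply: (allP hs).
Qed.

Definition below w : subspace M := msp (fun u => plt u w).
Definition reducible w : Prop := below w (emon w).
Definition standard w : Prop := ~ reducible w.
Definition shift j w := ((w.1 + U_(j))%MM, w.2).

Lemma plt_shift j u w : plt u w -> plt (shift j u) (shift j w).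
Proof.
rewrite /plt /= => /orP[h|/andP[/eqP -> ->]]; last by rewrite eqxx orbT.
by rewrite ![(_ + U_(j))%MM]addmC lemc_lt_add.
Qed.

Lemma plt_mdeg u w : plt u w -> (mdeg u.1 <= mdeg w.1)%N.
Proof. by move=> /orP[/ltW/lemc_mdeg|/andP[/eqP ->]]. Qed.

(** Modulo lower order, a letter acts on monomials by a shift. *)
Lemma letter_emon j u : msp (fun u' => (mdeg u'.1 <= mdeg u.1)%N) (wl M j (emon u) - emon (shift j u)).
Proof.
have e f i : wl M j (wop f (v i)) =
    wop (dop (match split j with inl a => inl a | inr b => inr b end) (f : weyl C n)) (v i).
  by rewrite wop_dop; case: (split_ordP j) => a ->; rewrite ?wl_l ?wl_r.
rewrite /emon -(opactX (wl M) u.1) -(opactX (wl M) (shift j u).1) -/(wop _ _) e -/(wop _ _).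
rewrite /wop -opactN -opactD -/(wop _ _) /=.
apply: (msp_mono (P := fun u' => (mdeg u'.1 < (mdeg u.1).+1)%N)) => //.
apply: wop_msp; rewrite addmC mpolyXD.
case: (split_ordP j) => a -> /=; rewrite /weyl_X /weyl_D ?subrr ?mmeasure0 //.
rewrite addrK; apply/leqW/msize_mderiv; by rewrite mmeasureX.
Qed.

(** Both sides of the relation are shifted by a letter, up to lower order. *)
Lemma reducible_shift j w : reducible w -> reducible (shift j w).
Proof.
move=> [s [hs e]].
have low u x : (mdeg u.1 <= mdeg w.1)%N ->
    msp (fun u' => (mdeg u'.1 <= mdeg u.1)%N) x -> below (shift j w) x.
  move=> hu; apply: msp_mono => u' hu'; apply/orP; left; apply: lt_mdeg_ltmc.
  by rewrite /= mdegD mdeg1 addn1 ltnS (leq_trans hu').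
have h1 := low w _ (leqnn _) (letter_emon j w).
apply: (subBK (subBC h1)).
rewrite e linear_sum big_seq; apply: sub_sum => t /hs ht; rewrite linearZ; apply: subZ.
apply: (subBK (low t.2 _ (plt_mdeg ht) (letter_emon j t.2))).
exact/msp_gen/plt_shift.
Qed.

Lemma reducible_add (d : mnm) al i : reducible (al, i) -> reducible ((al + d)%MM, i).
Proof.
have [k] := ubnP (mdeg d); elim: k d al => // k ih d al hd h.
case: (posnP (mdeg d)) => [/eqP|hp]; first by rewrite mdeg_eq0 => /eqP ->; rewrite addm0.
have [j hj] := mdeg_gt0_var hp; have ed := mnm_split hj.
rewrite ed addmA; apply: ih; last exact: (reducible_shift j h).
by move: hd; rewrite {1}ed mdegD mdeg1 add1n ltnS.
Qed.

(** Reducible monomials are rewritten in terms of lower ones, which terminates, *)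
Lemma standard_span w : msp (fun u => standard u /\ (mdeg u.1 <= mdeg w.1)%N) (emon w).
Proof.
elim/plt_wf: w => w ih; case: (pselect (standard w)) => [hw|/contrapT hw].
  by apply: msp_gen.
apply: (msp_le _ hw) => u hu; apply: msp_mono (ih u hu) => u' [h1 h2]; split=> //.
exact: leq_trans h2 (plt_mdeg hu).
Qed.

(** and the largest term of a linear relation is reducible. *)
Lemma standard_indep (s : seq (mnm * 'I_r)) (c : mnm * 'I_r -> C) :
  uniq s -> (forall u, u \in s -> standard u) -> \sum_(u <- s) c u *: emon u = 0 ->
  forall u, u \in s -> c u = 0.
Proof.
move=> us hs h0 u hu; apply/eqP; apply: contraT => cu.
have [|w] := @plt_max [seq u <- s | c u != 0].
  by apply/eqP => e; have : u \in [seq u <- s | c u != 0]; [rewrite mem_filter cu | rewrite e].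
rewrite mem_filter => /andP[cw hw] hmax; case: (hs _ hw); rewrite /reducible.
move: h0; rewrite (big_rem w) //= => /eqP; rewrite addr_eq0 => /eqP e.
have -> : emon w = (c w)^-1 *: - \sum_(y <- rem w s) c y *: emon y.
  by rewrite -e scalerA mulVf // scale1r.
apply: (@subZ _ _ (below w)); apply: subN.
rewrite big_seq; apply: sub_sum => u'.
rewrite mem_rem_uniq // inE => /andP[nu hu']; case: (eqVneq (c u') 0) => [->|cu'].
  by rewrite scale0r; apply: sub0.
by apply: subZ; apply: msp_gen; apply: hmax => //; rewrite mem_filter cu'.
Qed.

(** Multidegrees as sequences, to count the standard monomials. *)
Definition mn (s : seq nat) : mnm := [multinom nth 0%N s i | i < n + n].
Definition std i (s : seq nat) := `[< standard (mn s, i) >].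

Lemma all2_leq_nth s s' i : all2 leq s' s -> (nth 0%N s' i <= nth 0%N s i)%N.
Proof.
elim: s s' i => [|x s ih] [|y s'] //= i.
by move=> /andP[xy h]; case: i => //= i; apply: ih.
Qed.

Lemma std_ideal i : order_ideal (n + n) (std i).
Proof.
move=> s s' ss ls /asboolP h; apply/asboolP => h'; apply: h.
have -> : mn s = (mn s' + (mn s - mn s'))%MM; last exact: reducible_add.
by apply/mnmP => j; rewrite mnmDE mnmBE !mnmE addnC subnK // all2_leq_nth.
Qed.

Lemma mdeg_mn s : size s = (n + n)%N -> mdeg (mn s) = sumn s.
Proof.
move=> ss; rewrite mdegE sumnE (big_nth 0%N) big_mkord ss.
by apply: eq_bigr => j _; rewrite mnmE.
Qed.

Lemma mn_surj al : exists2 s, size s = (n + n)%N & mn s = al.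
Proof.
exists [seq al j | j <- enum 'I_(n + n)]; first by rewrite size_map size_enum_ord.
apply/mnmP => j; rewrite mnmE (nth_map j) ?size_enum_ord // nth_ord_enum.
by [].
Qed.

Definition std_list k := [seq (mn s, i) | i <- enum 'I_r, s <- filter (std i) (multidegs (n + n) k)].

Lemma mem_std_list k u : u \in std_list k <-> standard u /\ (mdeg u.1 <= k)%N.
Proof.
split=> [/allpairsPdep[i [s [_ hs ->]]]|].
  move: hs; rewrite mem_filter mem_multidegs => /andP[/asboolP h1 /andP[/eqP h2 h3]].
  by rewrite /= mdeg_mn.
case: u => al i [/= h1 h2]; have [s ss es] := mn_surj al.
apply/allpairsPdep; exists i, s; rewrite mem_enum mem_filter mem_multidegs ss eqxx es.
by rewrite -mdeg_mn // es h2; split=> //; rewrite andTb andbT /std es; apply/asboolP.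
Qed.

Lemma std_list_uniq k : uniq (std_list k).
Proof.
apply: allpairs_uniq_dep; rewrite ?enum_uniq //.
  by move=> i _; rewrite filter_uniq // multidegs_uniq.
move=> [i s] [j s'] /allpairsPdep[i1 [s1 [_ h1 [-> ->]]]] /allpairsPdep[i2 [s2 [_ h2 [-> ->]]]].
move: h1 h2; rewrite !mem_filter !mem_multidegs => /and3P[_ /eqP ss1 _] /and3P[_ /eqP ss2 _] /=.
move=> e; have e1 : mn s1 = mn s2 by case: e => e _; apply: val_inj; apply: val_inj.
case: e => _ ->; congr existT; apply: (@eq_from_nth _ 0%N); rewrite ss1 ?ss2 // => l hl.
by have := congr1 (fun z : mnm => z (Ordinal hl)) e1; rewrite !mnmE.
Qed.

(** The standard monomials of degree at most k are a basis of the k-th step, and by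
    [reducible_add] they form an order ideal for each generator. *)
Theorem hilbert_function : exists f : nat -> nat, evpoly f /\
  forall k, has_dim (bernstein_filt v k) (f k).
Proof.
exists (fun k => size (std_list k)); split.
  apply: (@evpoly_eq _ (fun k => \sum_(j < r) count (std j) (multidegs (n + n) k))%N 0).
    move=> k _; rewrite size_allpairs_dep sumnE big_map big_enum.
    by apply: eq_bigr => i _; rewrite size_filter.
  by apply: evpoly_sum => i; apply: order_ideal_evpoly; apply: std_ideal.
move=> k; set s := std_list k.
pose b (i : 'I_(size s)) := emon (tnth (in_tuple s) i).
have sum_b (c : mnm * 'I_r -> C) :
    \sum_(u <- s) c u *: emon u = \sum_i c (tnth (in_tuple s) i) *: b i.
  by rewrite big_tnth.
have us : uniq s by apply: std_list_uniq.
exists b; split.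
- move=> i; have /mem_std_list [_ h] : tnth (in_tuple s) i \in s by apply: mem_tnth.
  by apply/bf_msp/msp_gen.
- move=> c hc i.
  pose c' u := oapp c 0 (insub (index u s)).
  have c'E j : c' (tnth (in_tuple s) j) = c j.
    rewrite /c' (tnth_nth (tnth (in_tuple s) j)) /= index_uniq // valK.
    by [].
  rewrite -c'E; apply: (standard_indep us _ _ (mem_tnth i (in_tuple s))).
    by move=> u /mem_std_list [].
  by rewrite sum_b -[RHS]hc; apply: eq_bigr => j _; rewrite c'E.
move=> x /bf_msp hx.
pose Sp (y : M) := exists c : mnm * 'I_r -> C, y = \sum_(u <- s) c u *: emon u.
have S0 : Sp 0 by exists (fun=> 0); rewrite big1 // => u _; rewrite scale0r.
have Sl a y z : Sp y -> Sp z -> Sp (a *: y + z).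
  move=> [c ->] [d ->]; exists (fun u => a * c u + d u).
  by rewrite scaler_sumr -big_split; apply: eq_bigr => u _; rewrite scalerDl scalerA.
have gens u : u \in s -> Sp (emon u).
  move=> hu; exists (fun u' => (u' == u)%:R); rewrite (big_rem u) //= eqxx scale1r.
  rewrite big_seq big1 ?addr0 // => u'; rewrite mem_rem_uniq // inE => /andP[/negbTE -> _].
  by rewrite scale0r.
have [c ->] : Sp x.
  apply: (msp_le (S := Subspace S0 Sl) _ hx) => w hw.
  apply: (msp_le (S := Subspace S0 Sl) _ (standard_span w)) => u [h1 h2].
  by apply: gens; apply/mem_std_list; split=> //; apply: leq_trans hw.
by exists (fun i => c (tnth (in_tuple s) i)); rewrite sum_b.
Qed.
End Hilbert.

(** * Holonomic quotients *)

Lemma norm_sum_exp_le (F : realFieldType) (s m : nat) (c : nat -> F) (x : F) :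
  1 <= x -> (s <= m.+1)%N -> `|\sum_(i < s) c i * x ^+ i| <= (\sum_(i < s) `|c i|) * x ^+ m.
Proof.
move=> x1 hs; apply: le_trans (ler_norm_sum _ _ _) _; rewrite mulr_suml; apply: ler_sum => i _.
rewrite normrM normrX (ger0_norm (le_trans ler01 x1)); apply: ler_wpM2l => //.
by apply: ler_weXn2l => //; rewrite -ltnS (leq_trans (ltn_ord i)).
Qed.

Lemma nat_bound (x : rat) : exists A : nat, x <= A%:R.
Proof.
exists (Num.bound `|x|); apply: le_trans (ler_norm _) _.
exact/ltW/archi_boundP.
Qed.

(** By the factorisation of a difference of powers. *)
Lemma exp_step_le (F : realFieldType) (i : nat) (x : F) : 0 <= x ->
  `|(x + 1) ^+ i - x ^+ i| <= i%:R * (x + 1) ^+ i.-1.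
Proof.
move=> x0; have y0 : 0 <= x + 1 by rewrite addr_ge0.
have xy : x <= x + 1 by rewrite lerDl.
rewrite ger0_norm; last by rewrite subr_ge0 lerXn2r.
rewrite subrXX addrC addKr mul1r -[i%:R]/(i%:R) mulr_natl -[X in _ *+ X]card_ord -sumr_const.
apply: ler_sum => j _; have hj := ltn_ord j.
have -> : i.-1 = (i - j.+1 + j)%N by rewrite -[in LHS](subnK hj) addnS.
by rewrite exprD addnK; apply: ler_pM; rewrite ?exprn_ge0 // lerXn2r. 
Qed.

(** Taking differences lowers the growth by one degree, *)
Lemma poly_step_le (p : {poly rat}) n : (size p <= n.+2)%N ->
  exists A : nat, forall k : nat, p.[k.+1%:R] - p.[k%:R] <= (A * k.+1 ^ n)%:R.
Proof.
move=> hp; have [A hA] := nat_bound (\sum_(i < size p) `|p`_i| * i%:R).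
exists A => k; apply: le_trans (ler_norm _) _; rewrite !horner_coef -sumrB.
apply: le_trans (ler_norm_sum _ _ _) _; rewrite natrM; apply: le_trans (ler_wpM2r _ hA); last first.
  exact: ler0n.
rewrite mulr_suml; apply: ler_sum => i _; rewrite -mulrBr normrM -mulrA; apply: ler_wpM2l => //.
rewrite -natr1; apply: le_trans (exp_step_le _ _) _; first exact: ler0n.
apply: ler_wpM2l => //; rewrite natr1 natrX; apply: ler_weXn2l; first by rewrite ler1n.
by have := leq_trans (ltn_ord i) hp; case: (nat_of_ord i).
Qed.

(** while the leading term of a polynomial cannot be outgrown by the others. *)
Lemma poly_growth_size (p : {poly rat}) n A k0 :
  (forall k, (k0 <= k)%N -> 0 <= p.[k%:R] <= (A * k.+1 ^ n)%:R) -> (size p <= n.+1)%N.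
Proof.
move=> hp; rewrite leqNgt; apply/negP => hs.
have sp : size p = (size p).-2.+2 by case: (size p) hs => [|[]].
set s := (size p).-2 in sp; have ns : (n <= s)%N by move: hs; rewrite sp.
have a0 : 0 < `|p`_s.+1|.
  by rewrite normr_gt0 -[s.+1]/(s.+2.-1) -sp lead_coef_eq0 -size_poly_gt0 sp.
pose B := (A%:R + \sum_(i < s.+1) `|p`_i|) * 2 ^+ s : rat.
have [m hm] := nat_bound (B / `|p`_s.+1|).
pose k := (maxn k0 m).+1; have k1 : 1 <= k%:R :> rat by rewrite ler1n.
have /andP[p0 pA] : 0 <= p.[k%:R] <= (A * k.+1 ^ n)%:R.
  by apply: hp; rewrite /k ltnW // ltnS leq_maxl.
have k2 : k.+1%:R <= 2 * k%:R :> rat by rewrite -natr1; lra.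
have hk : k.+1%:R ^+ n <= 2 ^+ s * k%:R ^+ s :> rat.
  apply: (@le_trans _ _ (k.+1%:R ^+ s)); first by apply: ler_weXn2l; rewrite ?ler1n.
  by rewrite -exprMn; apply: lerXn2r; rewrite ?nnegrE ?mulr_ge0 ?ler0n.
have up : `|p`_s.+1| * k%:R ^+ s.+1 <= B * k%:R ^+ s.
  have -> : `|p`_s.+1| * k%:R ^+ s.+1 = `|p.[k%:R] - \sum_(i < s.+1) p`_i * k%:R ^+ i|.
    rewrite horner_coef sp big_ord_recr /= addrAC subrr add0r normrM (ger0_norm (exprn_ge0 _ _)) //.
  apply: le_trans (ler_normB _ _) _; rewrite /B mulrDl mulrDl; apply: lerD.
    rewrite (ger0_norm p0) -mulrA; apply: le_trans pA _.
    by rewrite natrM natrX; apply: ler_wpM2l.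
  apply: le_trans (norm_sum_exp_le _ k1 (leqnn _)) _; apply: ler_wpM2r; first exact: exprn_ge0.
  rewrite ler_peMr ?exprn_ege1 ?ler1n //; exact: sumr_ge0.
move: up; rewrite exprS mulrA ler_pM2r ?exprn_gt0 ?(lt_le_trans ltr01) // mulrC.
rewrite -ler_pdivlMr // => up; have := le_trans up hm.
by rewrite ler_nat /k leqNgt ltnS leq_maxr.
Qed.

Lemma has_dim_spanned (C : fieldType) n (M : dmodule C n) r (v : 'I_r -> M) k d :
  has_dim (bernstein_filt v k) d ->
  exists b : 'I_d -> M, [/\ forall i, bf v k (b i), indep (zero_sub M) b &
    forall x, bf v k x -> span_mod (zero_sub M) b x].
Proof.
move=> [b [h1 h2 h3]]; exists b; split=> // x /h3 [c ->].
by exists c; rewrite /= subrr.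
Qed.

Definition raises (C : fieldType) n (M : dmodule C n) (L : M -> M) :=
  forall r (v : 'I_r -> M) k x, bf v k x -> bf v k.+1 (L x).

(** The image of the Bernstein filtration under pi exhausts H and its k-th step
    has dimension at most p(k) - p(k - 1), as it is killed by the image of an
    injective operator of order one; this is the growth of a holonomic module in
    one dimension less. *)
Lemma holonomic_quotient (C : numFieldType) n (M : dmodule C n.+1) (H : dmodule C n)
  (pi : {linear M -> H}) (D : {linear M -> M}) (L : 'I_n + 'I_n -> M -> M) :
  holonomic M -> (forall x, exists m, pi m = x) ->
  (forall m, D m = 0 -> m = 0) -> (forall m, pi (D m) = 0) -> raises D ->
  (forall s m, dop s (pi m) = pi (L s m)) -> (forall s, raises (L s)) ->
  holonomic H.
Proof.
move=> [r [v [hv [p [k0 [sp hp]]]]]] pisurj Dinj piD Draise piL Lraise.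
(* The shift by k0 + 1 brings both p(k) and p(k - 1) into the range where the
   Hilbert polynomial gives the dimension. *)
have G0 k : exists2 m, bf v (k0.+1 + k) m & pi m = 0 by exists 0; [apply: sub0 | rewrite linear0].
have Glin k c x y : (exists2 m, bf v (k0.+1 + k) m & pi m = x) ->
    (exists2 m, bf v (k0.+1 + k) m & pi m = y) ->
    exists2 m, bf v (k0.+1 + k) m & pi m = c *: x + y.
  by move=> [a ha <-] [b hb <-]; exists (c *: a + b); [apply: sub_lin | rewrite linearP].
pose G k := Subspace (G0 k) (@Glin k).
have Gmono k x : G k x -> G k.+1 x.
  by move=> [m hm <-]; exists m => //; apply: bf_mono hm; rewrite addnS.
have Gdop k s x : G k x -> G k.+1 (dop s x).
  by move=> [m hm <-]; exists (L s m); rewrite ?piL // addnS; apply: Lraise.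
have Gexh x : exists k, G k x.
  have [m <-] := pisurj x; have [k hk] := hv m; exists k, m => //.
  by apply: bf_mono hk; apply: leq_addl.
have [A hA] := poly_step_le sp.
have kle k : ((k0 + k).+1 <= k0.+1 * k.+1)%N by nia.
have Ggrowth k d (u : 'I_d -> H) : (forall i, G k (u i)) -> indep (zero_sub H) u ->
    (d <= A * k0.+1 ^ n * k.+1 ^ n)%N.
  move=> hu iu; pose x i := s2val (cid2 (hu i)).
  have xF i : bf v (k0 + k).+1 (x i) by rewrite /x; case: cid2.
  have xu i : pi (x i) = u i by rewrite /x; case: cid2.
  have [e [/has_dim_spanned [b [bF ib _]] he]] := hp (k0 + k)%N (leq_addr _ _).
  have [f [/has_dim_spanned [b' [_ _ sb']] hf]] := hp (k0 + k).+1 (leqW (leq_addr _ _)).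
  have ix : indep (ker_sub pi) x.
    move=> c /= hc; apply: (iu) => /=; rewrite -[RHS]hc linear_sum.
    by apply: eq_bigr => j _; rewrite linearZ xu.
  have iD : indep (zero_sub M) (fun j => D (b j)).
    move=> c /= hc; apply: (ib) => /=; apply: Dinj; rewrite -[RHS]hc linear_sum.
    by apply: eq_bigr => j _; rewrite linearZ.
  have iw := indep_cat ix (fun j => piD (b j)) iD.
  have hdf : (d + e <= f)%N.
    apply: (steinitz iw) => i; apply: sb'; case: (split i) => j //.
    exact: Draise.
  apply: (@leq_trans (A * (k0 + k).+1 ^ n)); last first.
    by rewrite -mulnA -expnMn leq_mul2l; apply/orP; right; case: (n) => // n'; rewrite leq_exp2r.
  rewrite -(ler_nat rat); apply: le_trans (hA _); rewrite -he -hf lerBrDr -natrD ler_nat.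
  exact: hdf.
have [r' [v' [hv' [K hK]]]] := finitely_generated_bf Gmono Gdop Gexh Ggrowth.
have [f [[q [k1 hq]] hf]] := hilbert_function v'.
exists r', v'; split=> //; exists q, k1; split; last by move=> k /hq e; exists (f k).
apply: (@poly_growth_size _ _ (A * k0.+1 ^ n * K.+1 ^ n) k1) => k /hq <-.
rewrite ler0n ler_nat.
have [b [bF ib _]] := has_dim_spanned (hf k).
apply: leq_trans (Ggrowth (K + k)%N _ b _ ib) _; first by move=> i; apply/hK/bF.
rewrite -[X in (_ <= X)%N]mulnA -expnMn leq_mul2l; apply/orP; right.
have : ((K + k).+1 <= K.+1 * k.+1)%N by nia.
by case: (n) => // n' ?; rewrite leq_exp2r.
Qed.

(** * The exponential twist *)

Section ExponentialTwist.
Variables (C : fieldType) (n : nat) (M Ma : dmodule C n) (a : 'cV[C]_n).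
Variables (t : M -> Oexp a -> Ma).
Hypothesis ht : is_Otensor t.

Let o : {mpoly C[n]} := 1.

Fact exp_section_linear : linear (fun m => t m o).
Proof.
case: ht => -[[hD _ _ _] _] hZ _ _ c x y.
by rewrite hD hZ.
Qed.
(** As O e^{-<z,a>} is free of rank one, m |-> m (x) e^{-<z,a>} is bijective. *)
Definition exp_section : {linear M -> Ma} := mklin exp_section_linear.

(** An inverse: m (x) e is sent to the action of the polynomial e on m. *)
Lemma exp_section_inj m : exp_section m = 0 -> m = 0.
Proof.
case: ht => -[_ hu] _ _ _; rewrite mklinE => h0.
pose b (m : M) (e : {mpoly C[n]}) := opact (dX M) e m.
have hb : balanced (dX M) (dX (Oexp a)) b.
  split.
  - by move=> u u' e; rewrite /b linearD.
  - by move=> u e e'; rewrite /b; apply: opactD.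
  - by move=> c u e; rewrite /b linearZ; symmetry; apply: opactZ.
  move=> i u e; rewrite /b; apply: (@opact_rletter _ _ _ (dX M) i e u) => j _ w.
  exact: dXX.
have [h [hh _]] := hu M b hb.
have := hh m o; rewrite h0 raddf0 => e; rewrite e /b.
by rewrite opact1.
Qed.

Lemma exp_section_surj x : exists m, exp_section m = x.
Proof.
case: (ht) => -[[hD hD' hb hf] hu] hZ _ _.
have S0 : exists m, exp_section m = 0 by exists 0; rewrite linear0.
have Slin c x1 y1 : (exists m, exp_section m = x1) -> (exists m, exp_section m = y1) ->
    exists m, exp_section m = c *: x1 + y1.
  by move=> [m <-] [m' <-]; exists (c *: m + m'); rewrite linearP.
pose S := Subspace S0 Slin; have [ht' _ _ _] := ht.
apply: (tensor_span (S := S) ht') => m e; rewrite /S /=.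
have t0 m' : t m' (0 : {mpoly C[n]}) = 0.
  by have := hD' m' (0 : {mpoly C[n]}) 0; rewrite addr0 => /eqP; rewrite -subr_eq subrr eq_sym => /eqP.
have R0 : forall m', exists m1, exp_section m1 = t m' (0 : {mpoly C[n]}).
  by move=> m'; rewrite t0.
have Rlin c (e1 e2 : {mpoly C[n]}) : (forall m', exists m1, exp_section m1 = t m' e1) ->
    (forall m', exists m1, exp_section m1 = t m' e2) ->
    forall m', exists m1, exp_section m1 = t m' (c *: e1 + e2).
  move=> h1 h2 m'; have [m1 e1'] := h1 (c *: m'); have [m2 e2'] := h2 m'.
  by exists (m1 + m2); rewrite linearD e1' e2' hb -hD'.
move: m; apply: (mpoly_gen (S := Subspace R0 Rlin) (E := fun _ _ => 0)) => [k f l _||k f hk m] /=.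
- by rewrite mmeasure0.
- by move=> m; exists m; rewrite mklinE.
by have [m1 hm1] := hk (dX M k m); exists m1; rewrite hm1 addr0 hf.
Qed.

Lemma exp_section_X i m : dX Ma i (exp_section m) = exp_section (dX M i m).
Proof. by case: ht => _ _ hX _; rewrite !mklinE hX. Qed.

Lemma exp_section_D i m : dD Ma i (exp_section m) = exp_section (dD M i m - a i 0 *: m).
Proof.
case: (ht) => -[[hD hD' hb _] _] hZ _ h; rewrite linearB linearZ !mklinE h.
congr (_ + _); rewrite /= /Oexp_D /o -[1]/(1%:MP) mderivC sub0r.
by rewrite -scaleNr -hb -hZ scaleNr.
Qed.
End ExponentialTwist.

(** * Direct images along linear projections *)

Section VariableSwap.
Variables (C : fieldType) (N n : nat).

(** Exchanges the blocks x and eta of variables of the transfer module, so that an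
    ordered operator polynomial has the letters for eta on the left. *)
Definition swap_ord (k : 'I_(N + n)) : 'I_(n + N) :=
  match split k with inl i => rshift n i | inr j => lshift N j end.
Lemma swap_ord_l i : swap_ord (lshift n i) = rshift n i.
Proof. by rewrite /swap_ord (unsplitK (inl i)). Qed.
Lemma swap_ord_r j : swap_ord (rshift N j) = lshift N j.
Proof. by rewrite /swap_ord (unsplitK (inr j)). Qed.

Definition swap_vars (b : {mpoly C[N + n]}) : {mpoly C[n + N]} :=
  b \mPo [tuple 'X_(swap_ord k) | k < N + n].

Fact swap_vars_linear : linear swap_vars.
Proof. by move=> c x y; rewrite /swap_vars linearP. Qed.
HB.instance Definition _ := GRing.isLinear.Build C _ _ _ swap_vars swap_vars_linear.

Lemma swap_varsXM k b : swap_vars ('X_k * b) = 'X_(swap_ord k) * swap_vars b.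
Proof. by rewrite /swap_vars rmorphM /= comp_mpolyXU -tnth_nth tnth_mktuple. Qed.

Lemma mderiv_swap_vars k b : mderiv (swap_ord k) (swap_vars b) = swap_vars (mderiv k b).
Proof.
have inj : injective swap_ord.
  move=> i j; case: (split_ordP i) => i' ->; case: (split_ordP j) => j' ->;
  rewrite ?swap_ord_l ?swap_ord_r => /eqP; rewrite ?eq_rlshift ?eq_lrshift //.
    by rewrite eq_rshift => /eqP ->.
  by rewrite eq_lshift => /eqP ->.
have S0 : mderiv (swap_ord k) (swap_vars 0) = swap_vars (mderiv k 0) by rewrite !linear0.
have Sl c x y : mderiv (swap_ord k) (swap_vars x) = swap_vars (mderiv k x) ->
    mderiv (swap_ord k) (swap_vars y) = swap_vars (mderiv k y) ->
    mderiv (swap_ord k) (swap_vars (c *: x + y)) = swap_vars (mderiv k (c *: x + y)).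
  by move=> hx hy; rewrite (linearP swap_vars) mderivD mderivZ hx hy mderivD mderivZ linearP.
apply: (mpoly_gen (S := Subspace S0 Sl) (E := fun _ _ => 0)) b => [j f l _||j f hf] /=.
- by rewrite mmeasure0.
- by rewrite /swap_vars rmorph1 -[1]/(1%:MP) -[1 in RHS]/(1%:MP) !mderivC rmorph0.
have {}hf : mderiv (swap_ord k) (swap_vars f) = swap_vars (mderiv k f) := hf.
by rewrite addr0 swap_varsXM !mderivXM linearD linearZ /= swap_varsXM hf (inj_eq inj).
Qed.
End VariableSwap.

Section TransferTensor.
Variables (C : fieldType) (n : nat) (rho : 'M[C]_(n, n.+1)) (g h : 'M[C]_n.+1).
Hypothesis hgh : g *m h = 1%:M.
Hypothesis g_rho : forall j i, g (lift ord0 j) i = rho j i.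
Variables (P : dmodule C n.+1) (T : dmodule C n) (t : transfer C n.+1 n -> P -> T).
Hypothesis ht : is_tensor (transfer_right rho) (@dop C n.+1 P) t.
Hypothesis htZ : forall (c : C) b p, c *: t b p = t (c *: b) p.
Hypothesis htl : forall s b p, dop s (t b p) = t (transfer_left rho s b) p.

Let P' := twist P hgh.
Let o : transfer C n.+1 n := (1 : {mpoly C[n.+1 + n]}).

Fact transfer_gen_linear : linear (t o : P' -> T).
Proof.
case: ht => -[_ hD hb _] _ c x y; rewrite hD; congr (_ + _).
by rewrite htZ; symmetry; apply: hb.
Qed.
Definition transfer_gen : {linear P' -> T} := mklin transfer_gen_linear.

Fact transfer_l_linear p : linear (fun b : {mpoly C[n.+1 + n]} => t b p).
Proof. by case: ht => -[hD _ _ _] _ c x y; rewrite hD htZ. Qed.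

Fact mderiv_o i : mderiv i (o : {mpoly C[n.+1 + n]}) = 0.
Proof. by rewrite /o -[1]/(1%:MP) mderivC. Qed.

Lemma rho_h j k : \sum_i h i k * rho j i = (lift ord0 j == k)%:R.
Proof.
have := congr1 (fun A : 'M_n.+1 => A (lift ord0 j) k) hgh; rewrite !mxE => <-.
by apply: eq_bigr => i _; rewrite g_rho mulrC.
Qed.

(** The letters of the base lift to P, in the coordinates g: in the transfer module
    z_j 1 is the combination of the 1 x_i given by rho, *)
Lemma transfer_gen_X j p : dX T j (transfer_gen p) = transfer_gen (dX P' (lift ord0 j) p).
Proof.
rewrite [RHS]linear_sum mklinE; transitivity (t (tr_rX rho j o) p); first exact: (htl (inl j) o p).
rewrite /tr_rX mderiv_o addr0 /o mulr1.
rewrite -[LHS]/(mklin (transfer_l_linear p) _) linear_sum; apply: eq_bigr => i _; rewrite !linearZ g_rho; congr (_ *: _).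
case: ht => -[_ _ _ hf] _; rewrite mklinE -[RHS](hf (inl i) o p) /= /tr_X /o.
by rewrite mulr1.
Qed.

(** In the directions of the dual basis the right action of the derivations on the
    transfer module is multiplication by one eta, or by none, up to derivatives
    of the coefficients. *)
Lemma transfer_dual_D k b p :
  \sum_i h i k *: t b (dD P i p) =
  - t (\sum_i h i k *: mderiv (lshift n i) (b : {mpoly C[n.+1 + n]}) + \sum_j (lift ord0 j == k)%:R *: ('X_(rshift n.+1 j) * b)) p.
Proof.
case: ht => -[_ _ _ hf] _.
have -> : \sum_i h i k *: t b (dD P i p) = t (\sum_i h i k *: (- tr_D rho i b)) p.
  rewrite -[RHS]/(mklin (transfer_l_linear p) _) linear_sum; apply: eq_bigr => i _; rewrite linearZ; congr (_ *: _).
  by rewrite -(hf (inr i) b p).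
have -> u : - t u p = t (- u) p by rewrite -[RHS]/(mklin (transfer_l_linear p) _) linearN.
congr t; rewrite -(eq_bigr _ (fun i _ => esym (scalerN _ _))) sumrN; congr (- _).
under eq_bigr do rewrite /tr_D scalerDr; rewrite big_split; congr (_ + _) => /=.
under eq_bigr do rewrite mulr_suml scaler_sumr; rewrite exchange_big /=.
apply: eq_bigr => j _; rewrite -rho_h scaler_suml; apply: eq_bigr => i _.
by rewrite -scalerAl scalerA.
Qed.

(** d_j 1 is the combination of the 1 d_i given by a section of rho, *)
Lemma transfer_gen_D j p : dD T j (transfer_gen p) = transfer_gen (dD P' (lift ord0 j) p).
Proof.
rewrite [RHS]linear_sum mklinE; transitivity (t (- tr_rD j o) p); first exact: (htl (inr j) o p).
rewrite /tr_rD.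
have e := transfer_dual_D (lift ord0 j) o p.
rewrite [X in - t (X + _) _]big1 in e; last by move=> i _; rewrite mderiv_o scaler0.
have ej : \sum_j0 (lift ord0 j0 == lift ord0 j)%:R *: ('X_(rshift n.+1 j0) * o) = tr_rD j o.
  rewrite -(sum_delta (fun j0 => tr_rD j0 o) j); apply: eq_bigr => j0 _.
  by rewrite (inj_eq lift_inj) eq_sym.
rewrite add0r ej in e; under eq_bigr do rewrite linearZ mklinE mxE.
by rewrite e -[LHS]/(mklin (transfer_l_linear p) _) linearN.
Qed.

(** and in the direction of the kernel of rho no eta occurs. *)
Lemma transfer_gen_fibre p : transfer_gen (dD P' ord0 p) = 0.
Proof.
rewrite linear_sum; under eq_bigr do rewrite linearZ mklinE mxE.
rewrite transfer_dual_D big1 => [|i _]; last by rewrite mderiv_o scaler0.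
rewrite add0r big1 => [|j _]; last by rewrite eq_sym eq_liftF scale0r.
by rewrite -[t _ _]/(mklin (transfer_l_linear p) _) linear0 oppr0.
Qed.

(** The transfer module is generated by 1 as a right module: the relation
    [transfer_dual_D] expresses multiplication by an eta through the action of
    derivations, up to lower order. *)
Lemma transfer_gen_surj x : exists p, transfer_gen p = x.
Proof.
have S0 : exists p, transfer_gen p = 0 by exists 0; rewrite linear0.
have Sl c x1 y1 : (exists p, transfer_gen p = x1) -> (exists p, transfer_gen p = y1) ->
    exists p, transfer_gen p = c *: x1 + y1.
  by move=> [p <-] [p' <-]; exists (c *: p + p'); rewrite linearP.
pose S := Subspace S0 Sl.
have B0 p : S (t (0 : {mpoly C[n.+1 + n]}) p).
  by rewrite -[t _ _]/(mklin (transfer_l_linear p) _) linear0; apply: sub0.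
have Bl c (b b' : {mpoly C[n.+1 + n]}) : (forall p, S (t b p)) -> (forall p, S (t b' p)) ->
    forall p, S (t (c *: b + b') p).
  move=> hb hb' p; rewrite -[t _ _]/(mklin (transfer_l_linear p) _) linearP.
  by apply: sub_lin; [apply: hb | apply: hb'].
pose E (k : 'I_(n.+1 + n)) (b : {mpoly C[n.+1 + n]}) := match split k with
  | inl _ => 0
  | inr j => \sum_i h i (lift ord0 j) *: mderiv (lshift n i) b end.
have El j b : E (lshift n j) b = 0 by rewrite /E (unsplitK (inl j)).
have Er j b : E (rshift n.+1 j) b = \sum_i h i (lift ord0 j) *: mderiv (lshift n i) b.
  by rewrite /E (unsplitK (inr j)).
apply: (tensor_span (S := S) ht) => b p; move: p.
apply: (mpoly_gen (S := Subspace B0 Bl) (E := E)) b => [k f l hf||k f hf p].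
- rewrite /E; case: split => j; first by rewrite mmeasure0.
  apply/msize_leP => al hal; rewrite raddf_sum big1 //= => i _.
  by rewrite mcoeffZ (iffLR (msize_leP _ _) (msize_mderiv (lshift n i) hf)) // mulr0.
- by move=> p; exists p; rewrite mklinE.
case: (split_ordP k) => j ->; last first.
  rewrite Er.
  have e := transfer_dual_D (lift ord0 j) f p.
  have ej : \sum_j0 (lift ord0 j0 == lift ord0 j)%:R *: ('X_(rshift n.+1 j0) * f) = tr_rD j f.
    rewrite -(sum_delta (fun j0 => tr_rD j0 f) j); apply: eq_bigr => j0 _.
    by rewrite (inj_eq lift_inj) eq_sym.
  rewrite ej in e; rewrite addrC -[t _ _]opprK -e; apply: subN; apply: sub_sum => i _.
  by apply: subZ; apply: hf.
have [[_ _ _ hf'] _] := ht; rewrite El addr0.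
have := hf (dX P j p); congr (S _); symmetry; exact: (hf' (inl j) f p).
Qed.

Let Df (p : P') : P' := dD P' ord0 p.

(** Nothing else is killed. The map b (x) p |-> Q_b p is balanced, where Q_b is the
    operator adjoint to b, with the derivations of the base, taken with a minus
    sign, on the left of the functions, and values in P / D_0 P; and Q_1 p = p. *)
Lemma transfer_gen_ker p : transfer_gen p = 0 -> exists p', p = dD P' ord0 p'.
Proof.
have S0 : exists p', 0 = Df p' by exists 0; rewrite /Df linear0.
have Sl c x y : (exists p', x = Df p') -> (exists p', y = Df p') -> exists p', c *: x + y = Df p'.
  by move=> [p1 ->] [p2 ->]; exists (c *: p1 + p2); rewrite /Df linearP.
pose S : subspace P := Subspace S0 Sl.
pose nD (j : 'I_n) : {linear P -> P} := GRing.opp_fun (dD P' (lift ord0 j)).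
pose A (k : 'I_(n + n.+1)) : {linear P -> P} :=
  match split k with inl j => nD j | inr i => dX P i end.
have Al j v : A (lshift n.+1 j) v = - dD P' (lift ord0 j) v by rewrite /A (unsplitK (inl j)).
have Ar i v : A (rshift n i) v = dX P i v by rewrite /A (unsplitK (inr i)).
pose Q (b : {mpoly C[n.+1 + n]}) := opact A (swap_vars b).
have QX i b v : Q ('X_(lshift n i) * b) v = Q b (dX P i v).
  rewrite /Q swap_varsXM swap_ord_l -(@opact_rletter _ _ _ A (rshift n i)) ?Ar //.
  move=> j hj w; case: (split_ordP j) hj => k -> /=; first by rewrite ltnNge (leq_trans (ltnW (ltn_ord k))) ?leq_addr.
  by move=> _; rewrite !Ar dXX.
have QD j b v : Q ('X_(rshift n.+1 j) * b) v = - dD P' (lift ord0 j) (Q b v).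
  rewrite /Q swap_varsXM swap_ord_r -(@opact_letter_comm _ _ _ A) ?Al //.
  move=> k hk w; case: (split_ordP k) hk => j' ->; last first.
    by rewrite /= ltnNge (leq_trans (ltnW (ltn_ord j))) ?leq_addr.
  by move=> _; rewrite !Al; congr (- _); rewrite !linearN; congr (- _); exact: (@dDD _ _ (twist P hgh)).
have Qc i b v : dD P i (Q b v) = Q b (dD P i v) + Q (mderiv (lshift n i) b) v.
  pose ka (k : 'I_(n + n.+1)) : C := if split k is inr i' then (i == i')%:R else 0.
  rewrite /Q (@opact_comm _ _ _ A (dD P i) ka) => [|k w].
    congr (_ + _); rewrite big_split_ord big1 /= ?add0r => [|j _].
      under eq_bigr do rewrite /ka (unsplitK (inr _)).
      by rewrite sum_delta -swap_ord_l mderiv_swap_vars.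
    by rewrite /ka (unsplitK (inl j)) scale0r.
  case: (split_ordP k) => j -> /=; rewrite ?Al ?Ar /ka.
    rewrite (unsplitK (inl j)) scale0r addr0 linearN; congr (- _).
    rewrite linear_sum; apply: eq_bigr => l _; by rewrite linearZ dDD.
  by rewrite (unsplitK (inr j)) dDX.
have Ql v : linear (fun b => Q b v) by move=> c x y; rewrite /Q linearP opactP.
pose B (b : transfer C n.+1 n) (v : P) : qspace S := qpi S (Q b v).
have hB : balanced (transfer_right rho) (@dop C n.+1 P) B.
  split.
  - by move=> u u' v; rewrite /B /Q linearD opactD linearD.
  - by move=> u v v'; rewrite /B /Q !linearD.
  - by move=> c u v; rewrite /B /Q linearZ opactZ [opact _ _ (c *: v)]linearZ.
  case=> i u v; first by rewrite /B [transfer_right _ _ _]/('X_(lshift n i) * u) QX.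
  (* d_i is the combination of D_0 and the lifted derivations of the base given
     by the i-th column of g. *)
  apply/qpi_eq; exists (g ord0 i *: - Q u v).
  rewrite /= /tr_D; have -> w : Q (- w) v = - Q w v by rewrite -[LHS]/(mklin (Ql v) _) linearN.
  have QDd x y : Q (x + y) v = Q x v + Q y v by rewrite -[LHS]/(mklin (Ql v) _) linearD.
  rewrite QDd mulr_suml.
  have -> : Q (\sum_j (rho j i *: 'X_(rshift n.+1 j) * u)) v =
      - \sum_j rho j i *: dD P' (lift ord0 j) (Q u v).
    rewrite -sumrN -[LHS]/(mklin (Ql v) _) linear_sum; apply: eq_bigr => j _.
    by rewrite -scalerAl linearZ /= mklinE QD scalerN.
  have e : dD P i (Q u v) = g ord0 i *: dD P' ord0 (Q u v) + \sum_j rho j i *: dD P' (lift ord0 j) (Q u v).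
    have hg : g^T *m h^T = 1%:M by rewrite -trmx_mul (mulmx1C hgh) trmx1.
    rewrite -(lcomb_comp (dD P) i (Q u v) hg) big_ord_recl mxE; congr (_ + _).
    by apply: eq_bigr => j _; rewrite mxE g_rho.
  have := Qc i u v; rewrite e => e1.
  have -> : Df (g ord0 i *: - Q u v) = - (g ord0 i *: dD P' ord0 (Q u v)).
    by rewrite /Df scalerN linearN linearZ.
  have -> : Q u (dD P i v) = g ord0 i *: dD P' ord0 (Q u v) + \sum_j rho j i *: dD P' (lift ord0 j) (Q u v) - Q (mderiv (lshift n i) u) v.
    by rewrite e1 addrK.
  move: (Q (mderiv _ _) v) (\sum_j _) (_ *: _) => x y z.
  by rewrite !opprD !opprK [- z - y + x]addrC addrACA addNr add0r addrCA subrr addr0.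
have [k [hk _]] := ht.2 _ _ hB.
move=> hp; have := hk o p; have -> : t o p = 0 by exact: hp.
rewrite raddf0 => /esym/qpi0; rewrite /Q /o /swap_vars rmorph1 opact1.
by [].
Qed.

(** D_i raises the degree of a nonzero symbol by one, *)
Lemma weyl_D_inj (i : 'I_n.+1) (f : weyl C n.+1) : dD (weyl C n.+1) i f = 0 -> f = 0.
Proof.
rewrite /= /weyl_D => /eqP; rewrite addrC addr_eq0 => /eqP e; apply/eqP; apply: contraT => f0.
have hs : msize (mderiv (lshift n.+1 i) (f : {mpoly C[n.+1 + n.+1]})) = (msize (f : {mpoly C[n.+1 + n.+1]})).+1.
  by rewrite -(msizeXM (rshift n.+1 i) f0) e msizeN.
by have := @msize_mderiv _ _ (lshift n.+1 i) (f : {mpoly C[n.+1 + n.+1]}) _ (leqnSn _); rewrite hs ltnn.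
Qed.

(** and it acts on the coordinates of an element of a free module separately. *)
Lemma free_D_inj : is_free P -> forall p, dD P' ord0 p = 0 -> p = 0.
Proof.
move=> /(twist_free hgh) [I [e he]] p hp; apply: (@free_coord_inj _ _ (twist P hgh) I e he p) => i.
apply: (@weyl_D_inj ord0); rewrite -[LHS](free_coord_dhom he i (inr ord0)) /=.
have -> : tw_D P h ord0 p = 0 by exact: hp.
by rewrite linear0.
Qed.
End TransferTensor.

Section DirectImage.
Variables (C : fieldType) (n : nat) (rho : 'M[C]_(n, n.+1)) (g h : 'M[C]_n.+1).
Hypothesis hgh : g *m h = 1%:M.
Hypothesis g_rho : forall j i, g (lift ord0 j) i = rho j i.
Variables (M : dmodule C n.+1) (P : free_resolution M) (T : nat -> dmodule C n).
Variables (t : forall l, transfer C n.+1 n -> P l -> T l)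
  (delta : forall l, {linear T l.+1 -> T l}).
Hypothesis ht : forall l, is_tensor (transfer_right rho) (@dop C n.+1 (P l)) (@t l).
Hypothesis htZ : forall l (c : C) b p, c *: @t l b p = @t l (c *: b) p.
Hypothesis htl : forall l s b p, dop s (@t l b p) = @t l (transfer_left rho s b) p.
Hypothesis htd : forall l b p, delta l (@t l.+1 b p) = @t l b (res_d P l p).

Definition tg l : P l -> T l := transfer_gen hgh (@ht l) (@htZ l).
Definition D0 (N : dmodule C n.+1) (p : N) : N := dD (twist N hgh) ord0 p.

Fact tg_linear l : linear (@tg l).
Proof. exact: (linearP (transfer_gen hgh (@ht l) (@htZ l))). Qed.
HB.instance Definition _ l := GRing.isLinear.Build C (P l) (T l) _ (@tg l) (@tg_linear l).

Fact D0_linear (N : dmodule C n.+1) : linear (@D0 N).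
Proof. exact: (linearP (dD (twist N hgh) ord0)). Qed.
HB.instance Definition _ (N : dmodule C n.+1) := GRing.isLinear.Build C N N _ (@D0 N) (@D0_linear N).

Lemma tg_d l p : delta l (tg p) = tg (res_d P l p).
Proof. exact: htd. Qed.
Lemma tg_D0 l (p : P l) : tg (D0 p) = 0.
Proof. exact: (transfer_gen_fibre g_rho). Qed.
Lemma tg_surj l x : exists p : P l, tg p = x.
Proof. exact: (transfer_gen_surj hgh g_rho). Qed.
Lemma tg_ker l (p : P l) : tg p = 0 -> exists p', p = D0 p'.
Proof. by move=> e; have [p' ->] := @transfer_gen_ker _ _ rho g h hgh g_rho (P l) (T l) (@t l) (@ht l) (@htZ l) p e; exists p'. Qed.
Lemma D0_free l (p : P l) : D0 p = 0 -> p = 0.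
Proof. by have := @free_D_inj _ _ g h hgh (P l) (res_free P l) p. Qed.
Lemma D0_dhom (N N' : dmodule C n.+1) (f : {linear N -> N'}) p : is_dhom f -> f (D0 p) = D0 (f p).
Proof. by move=> hf; have := @twist_dhom _ _ g h hgh N N' f hf (inr ord0) p. Qed.

(** As D_0 p1 = d p, the cycle d p1 is killed by D_0, which is injective: for l > 0
    because P_(l-1) is free, for l = 0 because d is then the augmentation. Hence
    p1 = d p2, and p - D_0 p2 is a cycle. *)
Lemma fibre_cycle l (p : P l.+1) p1 : (forall m : M, D0 m = 0 -> m = 0) ->
  res_d P l p = D0 p1 -> exists p2 p3, p = D0 p2 + res_d P l.+1 p3.
Proof.
move=> Minj e; suff [p2 e2] : exists p2, p1 = res_d P l p2.
  have /res_exact [p3 e3] : res_d P l (p - D0 p2) = 0.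
    by rewrite linearB D0_dhom -?e2 ?e ?subrr //; apply: res_dhom.
  by exists p2, p3; rewrite -e3 addrC subrK.
case: l p p1 e => [|l] p p1 e.
  apply/res_exact0/Minj; rewrite -D0_dhom -?e; last exact: res_aughom.
  by apply/res_exact0; exists p.
apply/res_exact/D0_free; rewrite -D0_dhom -?e; last exact: res_dhom.
by apply/res_exact; exists p.
Qed.

(** Every cycle has the form 1 (x) p, where d p is in the image of D_0. *)
Lemma direct_image_zero l (H : dmodule C n) (q : T l.+1 -> H) :
  @is_homology C (fun l => dcarrier (T l)) delta l.+1 H q ->
  (forall m : M, D0 m = 0 -> m = 0) -> forall x : H, x = 0.
Proof.
move=> [_ qs qk] Minj x; have [c hc <-] := qs x; apply/qk => //.
have [p ep] := tg_surj c; subst c.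
have /tg_ker [p1 e1] : tg (res_d P l p) = 0 by rewrite -tg_d.
have [p2 [p3 ->]] := fibre_cycle Minj e1.
by exists (tg p3); rewrite linearD /= tg_D0 add0r tg_d.
Qed.

(** The class of m is that of 1 (x) p for any p over m; p is unique up to the image
    of the differential, which is a boundary. *)
Lemma direct_image_quotient (H : dmodule C n) (q : T 0%N -> H) :
  @is_homology C (fun l => dcarrier (T l)) delta 0 H q ->
  (forall s c, q (dop s c) = dop s (q c)) ->
  exists pi : {linear M -> H}, [/\ forall x, exists m, pi m = x,
    forall m, pi (D0 m) = 0,
    forall j m, dX H j (pi m) = pi (dX (twist M hgh) (lift ord0 j) m)
    & forall j m, dD H j (pi m) = pi (dD (twist M hgh) (lift ord0 j) m)].
Proof.
move=> [ql qs qk] qdop.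
pose lf m := sval (cid (res_aug_surj P m)).
have lfP m : res_aug P (lf m) = m by rewrite /lf; case: cid.
have q0 : q 0 = 0 by apply/qk => //; exists 0; rewrite linear0.
have qlin : linear q by move=> c x y; apply: ql.
have qE p : q (tg (lf (res_aug P p))) = q (tg p).
  have /res_exact0 [p' e] : res_aug P (lf (res_aug P p) - p) = 0 by rewrite linearB lfP subrr.
  apply/eqP; rewrite -subr_eq0 -(linearB (mklin qlin)) mklinE -linearB e.
  by apply/eqP/qk => //; exists (tg p'); rewrite tg_d.
have pil : linear (fun m => q (tg (lf m))).
  move=> c x y; rewrite -qlin -linearP -[in RHS]qE linearP !lfP.
  by [].
have rX s m : res_aug P (dop (M := twist (P 0%N) hgh) s (lf m)) = dop (M := twist M hgh) s m.
  by have := @twist_dhom _ _ g h hgh (P 0%N) M (res_aug P) (@res_aughom _ _ M P) s (lf m); rewrite lfP.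
exists (mklin pil); split.
- move=> x; have [c _ <-] := qs x; have [p <-] := tg_surj c.
  by exists (res_aug P p); rewrite mklinE qE.
- by move=> m; rewrite mklinE -{1}(lfP m) -D0_dhom ?qE ?tg_D0 //; apply: res_aughom.
- move=> j m; rewrite !mklinE; transitivity (q (dX (T 0%N) j (tg (lf m)))).
    exact: (esym (qdop (inl j) _)).
  rewrite /tg (transfer_gen_X g_rho (@ht 0) (@htZ 0) (@htl 0)).
  rewrite -[RHS]/(q (tg (lf (dX (twist M hgh) (lift ord0 j) m)))).
  rewrite -[dX (twist M hgh) _ _]/(dop (M := twist M hgh) (inl (lift ord0 j)) m) -rX qE.
  by [].
move=> j m; rewrite !mklinE; transitivity (q (dD (T 0%N) j (tg (lf m)))).
  exact: (esym (qdop (inr j) _)).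
rewrite /tg (transfer_gen_D g_rho (@ht 0) (@htZ 0) (@htl 0)).
rewrite -[RHS]/(q (tg (lf (dD (twist M hgh) (lift ord0 j) m)))).
rewrite -[dD (twist M hgh) _ _]/(dop (M := twist M hgh) (inr (lift ord0 j)) m) -rX qE.
by [].
Qed.
End DirectImage.

Lemma holonomic_zero (C : fieldType) n (H : dmodule C n) : (forall x : H, x = 0) -> holonomic H.
Proof.
move=> h0; exists 0%N, (fun=> 0); split=> [m|].
  by exists 0%N; rewrite (h0 m); apply: bf0.
exists 0, 0%N; rewrite size_poly0; split=> // k _; exists 0%N; split; last by rewrite hornerE.
exists (fun=> 0); split=> [[]||m _] //; first by move=> c _ [].
by exists (fun=> 0); rewrite big_ord0.
Qed.

(** The rows of rho are independent and can be completed by a unit vector outside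
    their span. *)
Lemma projection_coordinates (C : fieldType) n (rho : 'M[C]_(n, n.+1)) :
  (forall z : 'cV[C]_n, exists x : 'cV[C]_n.+1, z = rho *m x) ->
  exists g h : 'M[C]_n.+1, g *m h = 1%:M /\ forall j i, g (lift ord0 j) i = rho j i.
Proof.
move=> hrho; have free : row_free rho.
  apply/row_freeP; pose x j := sval (cid (hrho (delta_mx j 0))).
  have xP j : delta_mx j 0 = rho *m x j by rewrite /x; case: cid.
  exists (\matrix_(i, j) x j i 0); apply/matrixP => i j; rewrite !mxE.
  have := congr1 (fun A : 'cV_n => A i 0) (xP j); rewrite !mxE eqxx andbT => ->.
  by apply: eq_bigr => k _; rewrite mxE.
have /row_subPn [i0 hi0] : ~~ ((1%:M : 'M[C]_n.+1) <= rho)%MS.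
  rewrite sub1mx; apply/negP => /eqP e; have := rank_leq_row rho.
  by rewrite e ltnn.
set w := row i0 1%:M in hi0.
pose g : 'M[C]_(1 + n, n.+1) := col_mx w rho.
have ug : (g : 'M_n.+1) \in unitmx.
  rewrite -row_free_unit; apply: (@inj_row_free _ (1 + n)) => v.
  rewrite -[v]hsubmxK mul_row_col => e.
  have e1 : lsubmx v = 0.
    apply/eqP; apply: contraNT hi0 => v0.
    have v00 : lsubmx v 0 0 != 0 by apply: contraNneq v0 => e0; apply/eqP/matrixP => i j; rewrite !ord1 e0 mxE.
    apply/submxP; exists (- (lsubmx v 0 0)^-1 *: rsubmx v).
    move/eqP: e; rewrite addrC addr_eq0 => /eqP e; rewrite -scalemxAl e.
    have -> : lsubmx v *m w = lsubmx v 0 0 *: w by rewrite {1}(mx11_scalar (lsubmx v)) mul_scalar_mx.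
    by rewrite scalerN scaleNr opprK scalerA mulVf // scale1r.
  move: e; rewrite e1 mul0mx add0r => e2; have -> : rsubmx v = 0.
    by apply: (row_free_inj free); rewrite e2 mul0mx.
  by rewrite row_mx0.
exists g, (invmx (g : 'M_n.+1)); split; first exact: mulmxV.
move=> j i; rewrite -[RHS](col_mxEd w rho); congr (_ _ i).
exact: val_inj.
Qed.

Theorem theorem1p4 (R : realType) (n : nat)
  (rho : 'M[R[i]]_(n, n.+1)) 
  (hrho : forall z : 'cV[R[i]]_n, exists x : 'cV[R[i]]_n.+1, z = rho *m x)
  (M : dmodule R[i] n.+1) (hM : regular_holonomic M)
  (a : 'cV[R[i]]_n.+1) (ha : ~ exists l : 'cV[R[i]]_n, a = rho^T *m l)
  (Ma : dmodule R[i] n.+1) (t : M -> Oexp a -> Ma) (hMa : is_Otensor t) :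
  forall (k : nat) (H : dmodule R[i] n), is_direct_image rho Ma k H ->
    holonomic H /\ (k <> 0%N -> forall h : H, h = 0).
Proof.
have [g [h [hgh g_rho]]] := projection_coordinates hrho.
pose ca k := \sum_i h i k * a i 0.
(* In the coordinates g, the components of a are the ca k; if the first one were
   zero, a would be a combination of the rows of rho. *)
have c0 : ca ord0 != 0.
  apply/eqP => ca0; apply: ha; exists (\col_j ca (lift ord0 j)).
  apply/colP => i; have e : (g^T *m (h^T *m a)) i 0 = a i 0.
    by rewrite mulmxA -trmx_mul (mulmx1C hgh) trmx1 mul1mx.
  rewrite -e mxE big_ord_recl [X in X + _](_ : _ = 0) ?add0r; last first.
    have e0 : (h^T *m a) ord0 0 = ca ord0 by rewrite mxE; apply: eq_bigr => j _; rewrite mxE.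
    by rewrite e0 ca0 mulr0.
  rewrite [RHS]mxE; apply: eq_bigr => j _; rewrite !mxE g_rho; congr (_ * _).
  by apply: eq_bigr => l _; rewrite mxE.
pose psi := exp_section hMa.
have psiX j m : dX (twist Ma hgh) j (psi m) = psi (dX (twist M hgh) j m).
  symmetry; apply: (@lcomb_comm _ M Ma _ (g j) (dX M) (dX Ma) psi) => k.
  exact: (esym (exp_section_X hMa k m)).
have psiD j m : dD (twist Ma hgh) j (psi m) = psi (dD (twist M hgh) j m - ca j *: m).
  transitivity (\sum_k h^T j k *: dD Ma k (psi m)); first by [].
  have e : psi (dD (twist M hgh) j m) = \sum_k h^T j k *: psi (dD M k m).
    rewrite [LHS]linear_sum; apply: eq_bigr => k _; exact: linearZ.
  have -> : psi (dD (twist M hgh) j m - ca j *: m) =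
      psi (dD (twist M hgh) j m) - ca j *: psi m by rewrite linearB [psi (_ *: m)]linearZ.
  rewrite e scaler_suml -sumrB; apply: eq_bigr => k _; rewrite -scalerA mxE -scalerBr; congr (_ *: _).
  by rewrite [LHS](exp_section_D hMa) linearB [exp_section _ (_ *: m)]linearZ.
pose D m := dD (twist M hgh) ord0 m - ca ord0 *: m.
have Dinj m : D m = 0 -> m = 0.
  by move=> /eqP; rewrite subr_eq0 => /eqP; apply: no_exponential_section.
have Mainj m : dD (twist Ma hgh) ord0 m = 0 -> m = 0.
  have [m' <-] := exp_section_surj hMa m.
  by rewrite psiD => e; rewrite (Dinj _ (exp_section_inj (ht := hMa) e)) linear0.
move=> k H [P [T [t' [delta [hT [q [hq hqd]]]]]]].
have ht l : is_tensor (transfer_right rho) (@dop _ n.+1 (P l)) (@t' l) by case: (hT l).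
have htZ l c b p : c *: @t' l b p = @t' l (c *: b) p by case: (hT l).
have htl l s b p : dop s (@t' l b p) = @t' l (transfer_left rho s b) p by case: (hT l).
have htd l b p : delta l (@t' l.+1 b p) = @t' l b (res_d P l p) by case: (hT l).
case: k q hq hqd => [|k] q hq hqd; last first.
  have H0 := direct_image_zero (hgh := hgh) g_rho ht htZ htd hq Mainj.
  by split=> //; apply: holonomic_zero.
split=> //.
have [pi [pis pi0 piX piDd]] := direct_image_quotient hgh g_rho ht htZ htl htd hq (fun s c => hqd s c I).
have Dl : linear D.
  move=> c x y; rewrite /D linearP scalerDr scalerBr opprD addrACA; congr (_ + _).
  by rewrite !scalerA mulrC.
pose L (s : 'I_n + 'I_n) m := match s with
  | inl j => dX (twist M hgh) (lift ord0 j) m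
  | inr j => dD (twist M hgh) (lift ord0 j) m - ca (lift ord0 j) *: m end.
have raiseD j : raises (fun m : M => dD (twist M hgh) j m - ca j *: m).
  move=> r v l x hx; apply: (@subB _ _ (bf v l.+1)); last first.
    by apply: subZ; apply: bf_mono hx.
  by apply: (@sub_sum _ _ (bf v l.+1)) => i _; apply: subZ; apply: (bf_dop (inr i)).
apply: (@holonomic_quotient _ _ M H (pi \o psi) (mklin Dl) L hM.1).
- move=> x; have [m <-] := pis x; have [m' <-] := exp_section_surj hMa m.
  by exists m'.
- exact: Dinj.
- by move=> m; rewrite -[RHS](pi0 (psi m)); apply: (congr1 pi); symmetry; apply: psiD.
- exact: raiseD.
- by case=> j m /=; rewrite ?piX ?piDd ?psiX ?psiD.
case=> j; last exact: raiseD.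
move=> r v l x hx; apply: (@sub_sum _ _ (bf v l.+1)) => i _; apply: subZ.
exact: (bf_dop (inl i)).
Qed.
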